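(* Let $n\ge3$, $1\le j\le n-1$, and let $K_1,K_2,L_1,L_2$ be origin-symmetric convex bodies with non-empty interior in $\mathbb{R}^n$. If $K_1$ is the $j$-projection body of $L_1$ and $K_2$ is the $(n-j)$-projection body of $L_2$, then $$V(K_1[j],K_2[n-j])=V(L_1[n-j],L_2[j]).$$
   Context: For $1\le i\le n-1$, $K$ is called the $i$-projection body of $L$ if $\mathrm{vol}_i(K|E^\perp)=\mathrm{vol}_{n-i}(L|E)$ for every $(n-i)$-dimensional linear subspace $E$ ($K|E$ orthogonal projection). $V(K[j],L[n-j])$ denotes the mixed volume with $j$ copies of $K$ and $n-j$ copies of $L$, i.e. the coefficients in Minkowski's polynomial expansion $\mathrm{vol}_n(\lambda_1K_1+\dots+\lambda_mK_m)=\sum V(K_{i_1},\dots,K_{i_n})\lambda_{i_1}\cdots\lambda_{i_n}$ with symmetric coefficients. *)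

(* Defs.v *)
(* classical reals.  Euclidean space R^d is modelled by
   vectors [vec := nat -> R] of which only coordinates 0..d-1 are used;
   subsets of R^d are predicates [vec -> Prop]. *)
From Stdlib Require Import Reals List ZArith Binomial.
Open Scope R_scope.

Definition vec := nat -> R.

Fixpoint rsum (d : nat) (f : nat -> R) : R :=
  match d with O => 0 | S d' => rsum d' f + f d' end.

Definition dot (n : nat) (x y : vec) : R := rsum n (fun k => x k * y k).

Definition supp (d : nat) (x : vec) : Prop := forall k, (d <= k)%nat -> x k = 0.

(* ---------- d-dimensional volume (Jordan content via lattice counting) ---------- *)
Definition grid_pt (m : nat) (z : list Z) : vec :=
  fun k => IZR (nth k z 0%Z) / INR (S m).

Definition in_grid (d m : nat) (A : vec -> Prop) (z : list Z) : Prop :=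
  length z = d /\ A (grid_pt m z).

Definition grid_count (d m : nat) (A : vec -> Prop) (N : nat) : Prop :=
  exists l : list (list Z),
    NoDup l /\ length l = N /\ forall z, In z l <-> in_grid d m A z.

Definition is_vol (d : nat) (A : vec -> Prop) (v : R) : Prop :=
  exists N : nat -> nat,
    (forall m, grid_count d m A (N m)) /\
    Un_cv (fun m => INR (N m) / (INR (S m) ^ d)) v.

Record convex_body (n : nat) (K : vec -> Prop) : Prop := {
  cb_supp : forall x, K x -> supp n x;
  cb_convex : forall x y t, K x -> K y -> 0 <= t <= 1 ->
                K (fun k => t * x k + (1 - t) * y k);
  cb_bounded : exists M, forall x k, K x -> Rabs (x k) <= M;
  cb_closed : forall x, supp n x ->
                (forall eps, eps > 0 -> exists y, K y /\
                   forall k, (k < n)%nat -> Rabs (x k - y k) < eps) -> K x;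
  cb_interior : exists x r, r > 0 /\ forall y, supp n y ->
                  (forall k, (k < n)%nat -> Rabs (y k - x k) < r) -> K y
}.

Definition origin_symmetric (K : vec -> Prop) : Prop :=
  forall x, K x -> K (fun k => - x k).

Definition orthonormal_basis (n : nat) (u : nat -> vec) : Prop :=
  (forall i, (i < n)%nat -> supp n (u i)) /\
  (forall i j, (i < n)%nat -> (j < n)%nat ->
     dot n (u i) (u j) = if Nat.eqb i j then 1 else 0).

(* The orthogonal projection of K onto span(u a, ..., u (a+d-1)), written in
   the orthonormal coordinates of that subspace (an isometric copy in R^d). *)
Definition proj_coords (n : nat) (K : vec -> Prop) (u : nat -> vec) (a d : nat)
  : vec -> Prop :=
  fun c => supp d c /\ exists x, K x /\
             forall k, (k < d)%nat -> c k = dot n x (u (a + k)%nat).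

(* K is the i-projection body of L: vol_i(K|E^perp) = vol_{n-i}(L|E) for every
   (n-i)-dimensional subspace E.  Every such E is span(u 0..u (n-i-1)) for an
   orthonormal basis u, and then E^perp = span(u (n-i)..u (n-1)). *)
Definition is_proj_body (n i : nat) (K L : vec -> Prop) : Prop :=
  forall u, orthonormal_basis n u ->
    exists v, is_vol i (proj_coords n K u (n - i) i) v /\
              is_vol (n - i) (proj_coords n L u 0 (n - i)) v.

Definition mink_comb (lam mu : R) (K L : vec -> Prop) : vec -> Prop :=
  fun z => exists x y, K x /\ L y /\ forall k, z k = lam * x k + mu * y k.

(* a k = V(K[k], L[n-k]) for k = 0..n : Minkowski's expansion with symmetric
   coefficients, vol_n(lam K + mu L) = sum_k C(n,k) V(K[k],L[n-k]) lam^k mu^(n-k). *)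
Definition mixed_vol_coeffs (n : nat) (K L : vec -> Prop) (a : nat -> R) : Prop :=
  forall lam mu, lam > 0 -> mu > 0 ->
    is_vol n (mink_comb lam mu K L)
      (rsum (S n) (fun k => C n k * a k * lam ^ k * mu ^ (n - k))).

(* Main.v *)
(* The mixed volume V(gK[j], M[n-j]), g orthogonal, is determined on zonotopes
   by its values on j + (n-j) segments, where QR factorization reduces it to
   minor(y g x), the absolute value of the leading j-minor of y g x.  For a
   polynomial weight p on O(n), whose translates span a finite-dimensional
   space, the Haar mean H satisfies
     H[p(g) minor(y g x)] = sum_k H[q_k(g) minor(g x)] H[q'_k(g) minor(y g)],
   and minor(g x), minor(y g) measure projections of zonotopes.  Hence, for
   zonotopes, H[p(g) V(gK[j], M[n-j])] is a fixed bilinear expression in the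
   volumes of the j-dimensional projections of K and of the
   (n-j)-dimensional projections of M.

   The formula extends to all symmetric bodies: smoothing the support function
   of K by a polynomial weight yields a body K' near K with K' + Z close to Z'
   for zonotopes Z, Z', since the functions |<., a>| span a dense space of even
   functions on the sphere; polynomiality of volume in Z then removes Z.

   The projection body hypotheses make the expression for (K1, K2) with p equal
   to the one for (L2, L1) with the transposed weight.  Choosing
   p(g) = (n + tr g)^N, which is invariant under transposition and concentrates
   at the identity as N grows, gives V(K1[j], K2[n-j]) = V(L2[j], L1[n-j]). *)
Require Import Defs.
From Stdlib Require Import Reals List ZArith Binomial.
From mathcomp Require all_boot all_order all_algebra perm finmap.
From mathcomp Require boolp classical_sets functions cardinality reals.
From mathcomp Require complex ring lra zify ssrZ Rstruct.
Open Scope R_scope.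

(* Enclosed in a module so that ssrnat's [<=] and [-] on [nat] do not capture
   those in the statement of the theorem. *)
Module ProjectionBodies.

Import all_boot all_order all_algebra perm finmap.
Import boolp classical_sets functions cardinality reals.
Import complex ring lra zify ssrZ Rstruct.
Import Order.TTheory GRing.Theory Num.Theory.

Set Implicit Arguments.
Unset Strict Implicit.
Unset Printing Implicit Defensive.

Local Open Scope classical_set_scope.
Local Open Scope ring_scope.

(** * Lattice-point volume *)

(** At a single rotation [|det (gA, B)|] does not in general split into finitely many products of
    data of [A] and data of [B]. After averaging against a polynomial weight it does, because both
    partial functions lie in the span of the translates of the weight, and interpolation at finitely
    many nodes factors the kernel. The same finite dimensionality makes a smoothed support function
    an exact cosine transform of a signed density, where the original one is only a limit of such
    transforms. Both projection volumes come from one kernel because complementary minors of an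
    orthogonal matrix agree in absolute value.

    Functionals of bodies are handled through properties that survive averaging: affinity in the
    length of an added segment, recovery of the value at [K] from those at [K + r Z], and a
    Lipschitz bound for the Hausdorff distance; homogeneity under doubling is added to them. Mixed
    volumes occur only as fixed linear combinations of volumes of [r gK + M], [r = 1, ..., n+1], and
    the volume of the cube remains an uncomputed positive constant. *)

Definition ncard (T : choiceType) (A : set T) : nat := #|` fset_set A|.

Lemma finite_inj (T U : choiceType) (A : set T) (B : set U) (f : T -> U) :
  finite_set B -> (forall x, A x -> B (f x)) ->
  (forall x y, A x -> A y -> f x = f y -> x = y) -> finite_set A.
Proof.
move=> fB AB inj.
have cA : (f @` A #= A)%card.
  by apply: inj_card_eq => x y; rewrite !inE; exact: inj.
rewrite -(eq_finite_set cA); apply: sub_finite_set fB.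
by move=> _ [x Ax <-]; exact: AB.
Qed.

Lemma ncard_le (T : choiceType) (A B : set T) :
  finite_set B -> A `<=` B -> (ncard A <= ncard B)%N.
Proof.
move=> fB AB; apply: fsubset_leq_card; rewrite -fset_set_sub //.
exact: sub_finite_set fB.
Qed.

(** Each fibre of [f] injects into [F] through [rho]. When grids are refined, [f] is the coarse cell
    of a fine lattice point and [rho] its position inside that cell. *)
Lemma ncard_fibers (T U : choiceType) (F : finType) (A : set T) (B : set U)
    (f : T -> U) (rho : T -> F) :
  finite_set B -> (forall x, A x -> B (f x)) ->
  (forall x y, A x -> A y -> f x = f y -> rho x = rho y -> x = y) ->
  (ncard A <= #|F| * ncard B)%N.
Proof.
move=> fB AB inj.
have [fA|nfA] := pselect (finite_set A); last first.
  (* An infinite set has [ncard] 0, the default of [fset_set]. *)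
  by rewrite /ncard /fset_set; case: pselect => // _; rewrite cardfs0.
rewrite /ncard -[X in (X <= _)%N]sum1_size (partition_big rho xpredT) //=.
rewrite -sum_nat_const; apply: leq_sum => r _.
rewrite sum1_count -size_filter.
have mF x : x \in filter (fun i => rho i == r) (fset_set A) -> A x /\ rho x = r.
  by rewrite mem_filter => /andP[/eqP <-]; rewrite in_fset_set // => /set_mem.
rewrite -(size_map f); apply: uniq_leq_size.
  rewrite map_inj_in_uniq ?filter_uniq // => x y /mF[Ax rx] /mF[Ay ry] fxy.
  by apply: inj => //; rewrite rx.
move=> _ /mapP[x /mF[Ax _] ->]; rewrite in_fset_set// inE; exact: AB.
Qed.

Lemma ncard_le_inj (T U : choiceType) (A : set T) (B : set U) (f : T -> U) :
  finite_set B -> (forall x, A x -> B (f x)) ->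
  (forall x y, A x -> A y -> f x = f y -> x = y) -> (ncard A <= ncard B)%N.
Proof.
move=> fB AB inj; rewrite -[ncard B]mul1n -card_unit.
by apply: (@ncard_fibers _ _ _ _ _ f (fun=> tt)) => // x y Ax Ay fxy _; apply: inj.
Qed.

Lemma ncardUI (T : choiceType) (A B : set T) :
  finite_set A -> finite_set B ->
  (ncard (A `|` B) + ncard (A `&` B) = ncard A + ncard B)%N.
Proof. by move=> fA fB; rewrite /ncard fset_setU // fset_setI // cardfsUI. Qed.

Section Volume.
Variables (R : realType) (d : nat).
Implicit Types (A B K L : set 'cV[R]_d) (x y v : 'cV[R]_d) (e : R) (k : nat).

Definition cube e : set 'cV[R]_d := [set x | forall i, `|x i 0| <= e].

Definition msum A B : set 'cV[R]_d :=
  [set z | exists x y, [/\ A x, B y & z = x + y]].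

Definition mscale (t : R) A : set 'cV[R]_d := [set t *: x | x in A].

Definition shift v A : set 'cV[R]_d := [set x + v | x in A].

Definition fat e A := msum A (cube e).

Definition vbounded A := exists M, A `<=` cube M.

Definition convex A := forall x y (t : R), A x -> A y -> 0 <= t -> t <= 1 ->
  A (t *: x + (1 - t) *: y).

Definition lat k (z : {ffun 'I_d -> int}) : 'cV[R]_d :=
  \col_i ((z i)%:~R / 2 ^+ k).

Definition cnt k A : nat := ncard [set z | A (lat k z)].

Definition dens A k e : R := (cnt k (fat e A))%:R / 2 ^+ (k * d).

(* Fattening by more than the mesh 2^-k gives translation invariance and
   monotonicity under refinement without any estimate near the boundary. *)
Definition Vol A : R :=
  inf [set r | exists k e, 2 ^- k < e /\ r = dens A k e].

Lemma pow2_neq0 k : (2 ^+ k : R) != 0.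
Proof. by rewrite expf_neq0 // pnatr_eq0. Qed.

Lemma fatE e A x : fat e A x <-> exists2 a, A a & forall i, `|x i 0 - a i 0| <= e.
Proof.
split=> [[a [c [Aa cc ->]]]|[a Aa H]].
  by exists a => // i; rewrite !mxE addrAC subrr add0r; exact: cc.
exists a, (x - a); split=> //; last by rewrite addrC subrK.
by move=> i; rewrite !mxE.
Qed.

Lemma fat_sub e e' A B : A `<=` B -> e <= e' -> fat e A `<=` fat e' B.
Proof.
move=> AB ee x /fatE[a Aa H]; apply/fatE; exists a; first exact: AB.
by move=> i; apply: le_trans ee.
Qed.

Lemma vbounded_sub A B : A `<=` B -> vbounded B -> vbounded A.
Proof. by move=> AB [M BM]; exists M; apply: subset_trans BM. Qed.

Lemma vbounded_msum A B : vbounded A -> vbounded B -> vbounded (msum A B).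
Proof.
move=> [M AM] [N BN]; exists (M + N) => _ [x [y [/AM Ax /BN By ->]]] i.
by rewrite mxE (le_trans (ler_normD _ _)) // lerD.
Qed.

Lemma vbounded_fat e A : vbounded A -> vbounded (fat e A).
Proof. by move=> bA; apply: vbounded_msum => //; exists e. Qed.

Lemma vbounded_scale t A : vbounded A -> vbounded (mscale t A).
Proof.
move=> [M AM]; exists (`|t| * M) => _ [x /AM Ax <-] i.
by rewrite mxE normrM ler_wpM2l.
Qed.

Lemma vbounded_shift v A : vbounded A -> vbounded (shift v A).
Proof.
move=> bA; have : vbounded (msum A [set v]).
  apply: vbounded_msum bA _; exists (\sum_i `|v i 0|) => _ -> i.
  by rewrite (bigD1 i) //= lerDl sumr_ge0.
by apply: vbounded_sub => _ [x Ax <-]; exists x, v.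
Qed.

Lemma finite_lat k A : vbounded A -> finite_set [set z | A (lat k z)].
Proof.
move=> [M AM].
pose N := Num.bound (`|M| * 2 ^+ k).
apply: (@finite_inj _ _ _ [set: {ffun 'I_d -> 'I_(N + N).+1}]
  (fun z : {ffun 'I_d -> int} => [ffun i => inord (absz (z i + N%:Z)%R)])).
- exact: finite_finset.
- by [].
have bz z : A (lat k z) -> forall i, - N%:Z <= z i <= N%:Z.
  move=> /AM zM i; have := zM i; rewrite mxE normrM normfV [X in _ / X]gtr0_norm ?exprn_gt0 //.
  rewrite ler_pdivrMr ?exprn_gt0 // => zi.
  have : `|(z i)%:~R| <= N%:R :> R.
    apply: le_trans (ltW (archi_boundP _)); last by rewrite mulr_ge0 // exprn_ge0.
    by apply: le_trans zi _; rewrite ler_pM2r ?exprn_gt0 // ler_norm.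
  by rewrite ler_norml (pmulrn 1 N) -mulrNz !ler_int.
move=> z w Az Aw /ffunP zw; apply/ffunP => i.
have := zw i; rewrite !ffunE => /(congr1 (@nat_of_ord _)).
move: (bz z Az i) (bz w Aw i); move: (z i) (w i) => a b {AM bz zw}.
by move: N => N ab1 ab2; rewrite !inordK; lia.
Qed.

Lemma cnt_le k A B : vbounded B -> A `<=` B -> (cnt k A <= cnt k B)%N.
Proof.
move=> bB AB; apply: ncard_le; first exact: finite_lat.
by move=> z; apply: AB.
Qed.

Lemma cntUI k A B : vbounded A -> vbounded B ->
  (cnt k (A `|` B) + cnt k (A `&` B) = cnt k A + cnt k B)%N.
Proof. by move=> bA bB; apply: ncardUI; apply: finite_lat. Qed.

(** Rounding a fine lattice point down to the coarse lattice moves each coordinate by at most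
    [2^-k], which the larger fattening absorbs; the [2^(q d)] residues modulo [2^q] label the points
    of one coarse cell. *)
Lemma cnt_refine k q e A : vbounded A ->
  (cnt (k + q) (fat e A) <= 2 ^ (q * d) * cnt k (fat (e + 2 ^- k) A))%N.
Proof.
move=> bA.
have q0 : (0 < 2 ^ q)%N by rewrite expn_gt0.
have -> : (2 ^ (q * d) = #|{: {ffun 'I_d -> 'I_(2 ^ q).-1.+1}}|)%N.
  by rewrite card_ffun !card_ord prednK // expnM.
pose Q : int := (2 ^ q)%N.
have Q0 : 0 < Q by rewrite ltz_nat.
apply: (@ncard_fibers _ _ _ _ _
  (fun z : {ffun 'I_d -> int} => [ffun i => (z i %/ Q)%Z])
  (fun z : {ffun 'I_d -> int} => [ffun i => inord `|(z i %% Q)%Z|%N])).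
- by apply: finite_lat; apply: vbounded_fat.
- move=> z /fatE[a Aa H]; apply/fatE; exists a => // i.
  have -> : lat k [ffun i0 => (z i0 %/ Q)%Z] i 0 - a i 0 =
      (lat (k + q) z i 0 - a i 0) - (z i %% Q)%Z%:~R / 2 ^+ (k + q).
    rewrite !mxE ffunE {2}(divz_eq (z i) Q) rmorphD rmorphM /= mulrDl exprD.
    have -> : Q%:~R = 2 ^+ q :> R by rewrite /Q -pmulrn natrX.
    by field; rewrite !pow2_neq0.
  rewrite (le_trans (ler_normB _ _)) // lerD // ger0_norm; last first.
    by rewrite divr_ge0 ?exprn_ge0 // ler0z modz_ge0 ?gt_eqF.
  rewrite ler_pdivrMr ?exprn_gt0 // exprD mulrA mulVf ?pow2_neq0 // mul1r.
  have : (z i %% Q)%Z%:~R <= Q%:~R :> R by rewrite ler_int ltW // ltz_pmod.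
  by rewrite /Q -pmulrn natrX.
move=> z w _ _ /ffunP h1 /ffunP h2; apply/ffunP => i.
have := h1 i; have := h2 i; rewrite !ffunE => /(congr1 (@nat_of_ord _)).
have mb (t : int) : (`|(t %% Q)%Z| < (2 ^ q).-1.+1)%N.
  have := modz_ge0 t (lt0r_neq0 Q0); have := ltz_pmod t Q0.
  by rewrite prednK // /Q; move: (t %% _)%Z => a; lia.
rewrite !inordK // => e1 e2; rewrite (divz_eq (z i) Q) (divz_eq (w i) Q) e2.
have := modz_ge0 (z i) (lt0r_neq0 Q0); have := modz_ge0 (w i) (lt0r_neq0 Q0).
move: e1; move: (z i %% Q)%Z (w i %% Q)%Z => a b ab a0 b0; congr (_ + _); lia.
Qed.

Lemma dens_ge0 A k e : 0 <= dens A k e.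
Proof. by rewrite divr_ge0 // exprn_ge0. Qed.

Let Vset A := [set r | exists k e, 2 ^- k < e /\ r = dens A k e].

Lemma Vset_inf A : has_inf (Vset A).
Proof.
split; first by exists (dens A 0 2), 0%N, 2; rewrite expr0 invr1; split=> //; lra.
by exists 0 => _ [k [e [_ ->]]]; exact: dens_ge0.
Qed.

Lemma Vol_ge0 A : 0 <= Vol A.
Proof.
apply: lb_le_inf; first by have [] := Vset_inf A.
by move=> _ [k [e [_ ->]]]; exact: dens_ge0.
Qed.

Lemma Vol_le_dens A k e : 2 ^- k < e -> Vol A <= dens A k e.
Proof. by move=> ke; apply: ge_inf; [have [] := Vset_inf A | exists k, e]. Qed.

Lemma dens_refine A k q e e' : vbounded A -> e' + 2 ^- k <= e ->
  dens A (k + q) e' <= dens A k e.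
Proof.
move=> bA ee; rewrite /dens mulnDl exprD ler_pdivrMr ?mulr_gt0 ?exprn_gt0 //.
rewrite -mulrA mulKf ?pow2_neq0 // -natrX -natrM ler_nat mulnC.
apply: leq_trans (cnt_refine k q e' bA) _; rewrite leq_pmul2l ?expn_gt0 //.
by apply: cnt_le; [exact: vbounded_fat | exact: fat_sub].
Qed.

(** A nearly optimal pair [(k, e)] has slack [e - 2^-k > 0]; through [dens_refine] this slack bounds
    the density for all finer meshes and all smaller fattenings at once, so the infimum behaves like
    a limit. *)
Lemma Vol_dens A : vbounded A -> forall del, 0 < del ->
  exists e0 k0, 0 < e0 /\ forall k e, (k0 <= k)%N -> e <= e0 ->
    dens A k e <= Vol A + del.
Proof.
move=> bA del del0.
have [_ [k [e [ke ->]]] le] := inf_adherent del0 (Vset_inf A).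
exists (e - 2 ^- k), k; split; first by rewrite subr_gt0.
move=> k' e' kk ee; apply: le_trans (ltW le).
by rewrite -(subnKC kk); apply: dens_refine => //; rewrite -lerBrDr.
Qed.

Lemma ex_pow2_lt e : 0 < e -> exists k0, forall k, (k0 <= k)%N -> 2 ^- k < e.
Proof.
move=> e0; exists (Num.bound e^-1) => k kk.
rewrite -[e]invrK ltf_pV2 ?posrE ?exprn_gt0 ?invr_gt0 //.
exact: upper_nthrootP.
Qed.

Lemma Vol_le A B : vbounded B -> A `<=` B -> Vol A <= Vol B.
Proof.
move=> bB AB; apply/ler_addgt0Pr => del del0.
have [e0 [k0 [e00 H]]] := Vol_dens bB del0.
have [k1 H1] := ex_pow2_lt e00.
pose k := maxn k0 k1.
apply: le_trans (H k e0 (leq_maxl _ _) (lexx _)).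
apply: le_trans (Vol_le_dens _ (H1 k (leq_maxr _ _))) _.
rewrite /dens ler_pM2r ?invr_gt0 ?exprn_gt0 // ler_nat.
by apply: cnt_le; [exact: vbounded_fat | exact: fat_sub].
Qed.

(** The lattice is invariant under lattice vectors only: [v] is replaced by its rounding [w], and
    the error, less than one mesh, goes into the fattening. *)
Lemma cnt_shift k A v e : vbounded A ->
  (cnt k (fat e (shift v A)) <= cnt k (fat (e + 2 ^- k) A))%N.
Proof.
move=> bA.
pose w : {ffun 'I_d -> int} := [ffun i => Num.floor (v i 0 * 2 ^+ k)].
apply: (@ncard_le_inj _ _ _ _ (fun z : {ffun 'I_d -> int} => [ffun i => z i - w i])).
- by apply: finite_lat; apply: vbounded_fat.
- move=> z /fatE[_ [a Aa <-] H]; apply/fatE; exists a => // i.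
  have -> : lat k [ffun i0 => z i0 - w i0] i 0 - a i 0 =
     (lat k z i 0 - (a + v) i 0) + (v i 0 - (w i)%:~R / 2 ^+ k).
    by rewrite !mxE ffunE rmorphB /=; field; rewrite pow2_neq0.
  rewrite (le_trans (ler_normD _ _)) // lerD // ffunE.
  rewrite -[v i 0](@mulfK _ (2 ^+ k)) ?pow2_neq0 // -mulrBl normrM normfV.
  rewrite [X in _ / X]gtr0_norm ?exprn_gt0 // ler_pdivrMr ?exprn_gt0 //.
  rewrite mulVf ?pow2_neq0 // mulfK ?pow2_neq0 //.
  have := floor_le_tmp (v i 0 * 2 ^+ k); have := floorD1_gt (v i 0 * 2 ^+ k).
  rewrite rmorphD /= => h1 h2; rewrite ger0_norm; lra.
move=> z z' _ _ /ffunP zz; apply/ffunP => i; have := zz i.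
by rewrite !ffunE => /addIr.
Qed.

Lemma Vol_shift_le A v : vbounded A -> Vol (shift v A) <= Vol A.
Proof.
move=> bA; apply/ler_addgt0Pr => del del0.
have [e0 [k0 [e00 H]]] := Vol_dens bA del0.
have [k1 H1] := ex_pow2_lt (divr_gt0 e00 (ltr0Sn R 1)).
pose k := maxn k0 k1.
have kk := H1 k (leq_maxr _ _).
have le2 : e0 / 2 + 2 ^- k <= e0 by move: kk; lra.
apply: le_trans (H k _ (leq_maxl _ _) le2).
apply: le_trans (Vol_le_dens _ kk) _.
by rewrite /dens ler_pM2r ?invr_gt0 ?exprn_gt0 // ler_nat cnt_shift.
Qed.

Lemma shiftD u v A : shift u (shift v A) = shift (v + u) A.
Proof.
apply/seteqP; split=> x.
  by move=> [_ [y Ay <-] <-]; exists y; rewrite ?addrA.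
by move=> [y Ay <-]; exists (y + v); [exists y | rewrite addrA].
Qed.

Lemma shift0 A : shift 0 A = A.
Proof.
apply/seteqP; split=> x; first by move=> [y Ay <-]; rewrite addr0.
by exists x => //; rewrite addr0.
Qed.

Lemma Vol_shift A v : vbounded A -> Vol (shift v A) = Vol A.
Proof.
move=> bA; apply/eqP; rewrite eq_le Vol_shift_le //=.
rewrite -{1}[A]shift0 -(subrr v) -shiftD.
by rewrite -[X in shift _ X]/(shift v A); rewrite (Vol_shift_le _ (vbounded_shift v bA)).
Qed.

(** Doubling maps the lattice of mesh [2^-(k+1)] exactly onto that of mesh [2^-k]. For this reason
    homogeneity is stated for the factor 2. *)
Lemma cnt_scale2 k e A : cnt k (fat e (mscale 2 A)) = cnt k.+1 (fat (e / 2) A).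
Proof.
congr ncard; apply/seteqP; split=> z /fatE.
  move=> [_ [a Aa <-] H]; apply/fatE; exists a => // i; have := H i.
  rewrite !mxE exprS invfM mulrA ler_pdivlMr // => h.
  rewrite -[X in _ * X](@ger0_norm _ 2) // -normrM; apply: le_trans h.
  by rewrite le_eqVlt; apply/orP; left; apply/eqP; congr `| _ |; field; rewrite pow2_neq0.
move=> [a Aa H]; apply/fatE; exists (2 *: a); first by exists a.
move=> i; have := H i; rewrite !mxE exprS ler_pdivlMr //.
rewrite -[X in _ * X](@ger0_norm _ 2) // -normrM; apply: le_trans.
by rewrite le_eqVlt; apply/orP; left; apply/eqP; congr `| _ |; field; rewrite pow2_neq0.
Qed.

Lemma dens_scale2 k e A : dens (mscale 2 A) k e = 2 ^+ d * dens A k.+1 (e / 2).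
Proof.
by rewrite /dens cnt_scale2 mulSn exprD; field; rewrite !pow2_neq0.
Qed.

Lemma Vol_scale2 A : vbounded A -> Vol (mscale 2 A) = 2 ^+ d * Vol A.
Proof.
move=> bA; have p0 : 0 < 2 ^+ d :> R by rewrite exprn_gt0.
apply/eqP; rewrite eq_le; apply/andP; split.
  apply/ler_addgt0Pr => del del0.
  have [e0 [k0 [e00 H]]] := Vol_dens bA (divr_gt0 del0 p0).
  have [k1 H1] := ex_pow2_lt e00.
  pose k := maxn k0 k1.
  apply: le_trans (Vol_le_dens _ (H1 k (leq_maxr _ _))) _.
  rewrite dens_scale2 mulrC -ler_pdivlMr // mulrDl mulrAC mulfV ?pow2_neq0 // mul1r.
  by apply: H; [rewrite leqW // leq_maxl | lra].
apply: lb_le_inf; first by have [] := Vset_inf (mscale 2 A).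
move=> _ [k [e [ke ->]]]; rewrite dens_scale2 ler_pM2l //.
by apply: Vol_le_dens; rewrite exprS invfM; lra.
Qed.

(** Lattice counts obey inclusion and exclusion exactly. The set identities are demanded after
    fattening, since the fattening of an intersection is in general smaller than the intersection of
    the fattenings. *)
Lemma Vol_modular A B C D :
  vbounded A -> vbounded B -> vbounded C -> vbounded D ->
  (forall e, 0 < e -> fat e A `|` fat e B = fat e C) ->
  (forall e, 0 < e -> fat e A `&` fat e B = fat e D) ->
  Vol A + Vol B = Vol C + Vol D.
Proof.
move=> bA bB bC bD HU HI.
suff key del : 0 < del -> Vol A + Vol B <= Vol C + Vol D + del /\
    Vol C + Vol D <= Vol A + Vol B + del.
  by apply/eqP; rewrite eq_le; apply/andP; split; apply/ler_addgt0Pr => del /key[].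
move=> del0; have del2 : 0 < del / 2 by lra.
have [e1 [k1 [e10 H1]]] := Vol_dens bA del2.
have [e2 [k2 [e20 H2]]] := Vol_dens bB del2.
have [e3 [k3 [e30 H3]]] := Vol_dens bC del2.
have [e4 [k4 [e40 H4]]] := Vol_dens bD del2.
pose e := Num.min (Num.min e1 e2) (Num.min e3 e4).
have e0 : 0 < e by rewrite !lt_min e10 e20 e30 e40.
have [k5 H5] := ex_pow2_lt e0.
pose k := (k1 + k2 + k3 + k4 + k5)%N.
have ke : 2 ^- k < e by apply: H5; rewrite /k leq_addl.
have kk : dens A k e + dens B k e = dens C k e + dens D k e.
  rewrite /dens -!mulrDl -!natrD -HU // -HI // cntUI //; exact: vbounded_fat.
have := Vol_le_dens A ke; have := Vol_le_dens B ke.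
have := Vol_le_dens C ke; have := Vol_le_dens D ke.
have /andP[/andP[l1 l2] /andP[l3 l4]] :
    ((e <= e1) && (e <= e2)) && ((e <= e3) && (e <= e4)).
  by rewrite -!le_min.
have := H1 k e _ l1; have := H2 k e _ l2; have := H3 k e _ l3; have := H4 k e _ l4.
have [i1 i2 i3 i4] : [/\ k1 <= k, k2 <= k, k3 <= k & k4 <= k]%N by rewrite /k; split; clear; lia.
move: kk; move: (dens A k e) (dens B k e) (dens C k e) (dens D k e) => a b c f.
move=> kk /(_ i4) h4 /(_ i3) h3 /(_ i2) h2 /(_ i1) h1 ? ? ? ?; lra.
Qed.

Definition segt (t : R) v : set 'cV[R]_d := [set z | exists2 s, `|s| <= t & z = s *: v].

Lemma msumC A B : msum A B = msum B A.
Proof.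
by apply/seteqP; split=> _ [x [y [Ax By ->]]]; exists y, x; rewrite addrC.
Qed.

Lemma msumA A B C : msum A (msum B C) = msum (msum A B) C.
Proof.
apply/seteqP; split=> z.
  move=> [x [_ [Ax [y [t [By Ct ->]]] ->]]]; exists (x + y), t.
  by rewrite addrA; split=> //; exists x, y.
move=> [_ [t [[x [y [Ax By ->]]] Ct ->]]]; exists x, (y + t).
by rewrite addrA; split=> //; exists y, t.
Qed.

Lemma msumAC A B C : msum (msum A B) C = msum (msum A C) B.
Proof. by rewrite -msumA (msumC B) msumA. Qed.

Lemma msum_sub A A' B B' : A `<=` A' -> B `<=` B' -> msum A B `<=` msum A' B'.
Proof. by move=> AA BB _ [x [y [/AA Ax /BB By ->]]]; exists x, y. Qed.

Lemma msum_shift v A B : msum (shift v A) B = shift v (msum A B).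
Proof.
apply/seteqP; split=> z.
  move=> [_ [y [[x Ax <-] By ->]]]; exists (x + y); last by rewrite addrAC.
  by exists x, y.
by move=> [_ [x [y [Ax By ->]]] <-]; exists (x + v), y; rewrite addrAC; split=> //; exists x.
Qed.

Lemma convex_msum A B : convex A -> convex B -> convex (msum A B).
Proof.
move=> cA cB _ _ t [x [y [Ax By ->]]] [x' [y' [Ax' By' ->]]] t0 t1.
exists (t *: x + (1 - t) *: x'), (t *: y + (1 - t) *: y').
by split; [exact: cA | exact: cB | rewrite !scalerDr addrACA].
Qed.

Lemma convex_cube e : convex (cube e).
Proof.
move=> x y t xe ye t0 t1 i; rewrite !mxE (le_trans (ler_normD _ _)) //.
rewrite !normrM (ger0_norm t0) [X in _ + X * _]ger0_norm ?subr_ge0 //.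
have := ler_wpM2l t0 (xe i); have := @ler_wpM2l _ (1 - t) _ _ _ (ye i).
rewrite subr_ge0 => /(_ t1); lra.
Qed.

Lemma vbounded_segt t v : vbounded (segt t v).
Proof.
exists (t * \sum_i `|v i 0|) => _ [s st ->] i; rewrite mxE normrM.
by rewrite ler_pM // (bigD1 i) //= lerDl sumr_ge0.
Qed.

(** Together with [segt_inter] this cuts the sum of [K] and a long segment into two translates of
    sums with shorter segments, whose overlap is a translate of [K]. *)
Lemma segt_union K s t v : 0 <= s -> 0 <= t ->
  shift (- t *: v) (msum K (segt s v)) `|` shift (s *: v) (msum K (segt t v)) =
  msum K (segt (s + t) v).
Proof.
move=> s0 t0; apply/seteqP; split=> z.
  case=> [[_ [x [_ [Kx [a ha ->] ->]]] <-]|[_ [x [_ [Kx [a ha ->] ->]]] <-]].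
    exists x, ((a - t) *: v); split=> //; last by rewrite scalerBl -addrA scaleNr.
    by exists (a - t) => //; move: ha; rewrite !ler_norml => /andP[h1 h2]; apply/andP; split; lra.
  exists x, ((a + s) *: v); split=> //; last by rewrite scalerDl addrA.
  by exists (a + s) => //; move: ha; rewrite !ler_norml => /andP[h1 h2]; apply/andP; split; lra.
move=> [x [w [Kx [a ha ->] ->]]]; move: ha; rewrite ler_norml => /andP[a1 a2].
have [le|lt] := leP a (s - t).
  left; exists (x + (a + t) *: v); last by rewrite -addrA -scalerDl addrK.
  by exists x, ((a + t) *: v); split=> //; exists (a + t) => //; rewrite ler_norml; apply/andP; split; lra.
right; exists (x + (a - s) *: v); last by rewrite -addrA -scalerDl subrK.
by exists x, ((a - s) *: v); split=> //; exists (a - s) => //; rewrite ler_norml; apply/andP; split; lra.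
Qed.

Lemma segt_inter K s t v : convex K -> 0 <= s -> 0 <= t ->
  shift (- t *: v) (msum K (segt s v)) `&` shift (s *: v) (msum K (segt t v)) =
  shift ((s - t) *: v) K.
Proof.
move=> cK s0 t0; apply/seteqP; split=> z; last first.
  move=> [x Kx <-]; split.
    exists (x + s *: v); last by rewrite -addrA -scalerDl.
    by exists x, (s *: v); split=> //; exists s; rewrite // ger0_norm.
  exists (x - t *: v); last by rewrite scalerBl -!addrA [- _ + _]addrC.
  by exists x, (- t *: v); rewrite scaleNr; split=> //; exists (- t); rewrite ?scaleNr // normrN ger0_norm.
move=> [[_ [x [_ [Kx [a ha ->] ->]]] ez] [_ [y [_ [Ky [b hb ->] ->]]] ez']].
move: ha hb; rewrite !ler_norml => /andP[a1 a2] /andP[b1 b2].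
exists (z - (s - t) *: v); last by rewrite subrK.
(* The point [z - (s - t) v] equals [x - al v] and [y + be v] with [x], [y] in [K] and [al], [be]
   nonnegative, hence lies between [y] and [x]. *)
pose al := s - a; pose be := b + t.
have zx : z - (s - t) *: v = x - al *: v.
  by rewrite -ez /al; apply/colP => i; rewrite !mxE; ring.
have zy : z - (s - t) *: v = y + be *: v.
  by rewrite -ez' /be; apply/colP => i; rewrite !mxE; ring.
have al0 : 0 <= al by rewrite /al; lra.
have be0 : 0 <= be by rewrite /be; lra.
have [ab0|abn] := eqVneq (al + be) 0.
  have -> : z - (s - t) *: v = x; last by [].
  by rewrite zx (_ : al = 0) ?scale0r ?subr0 //; lra.
have abp : 0 < al + be by rewrite lt_neqAle eq_sym abn addr_ge0.
have -> : z - (s - t) *: v = (be / (al + be)) *: x + (1 - be / (al + be)) *: y.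
  set w := z - _ in zx zy *.
  have -> : x = w + al *: v by rewrite zx subrK.
  have -> : y = w - be *: v by rewrite zy addrK.
  by apply/colP => i; rewrite !mxE; field.
apply: cK => //; first by rewrite divr_ge0 // ltW.
by rewrite ler_pdivrMr // mul1r lerDr.
Qed.

(** The Cauchy equation for [t |-> Vol (K + t [-v, v]) - Vol K]. The cutting survives fattening
    because [fat] merely replaces [K] by the convex set [K + cube e]. *)
Lemma Vol_segtD K s t v : convex K -> vbounded K -> 0 <= s -> 0 <= t ->
  Vol (msum K (segt (s + t) v)) + Vol K =
  Vol (msum K (segt s v)) + Vol (msum K (segt t v)).
Proof.
move=> cK bK s0 t0.
have b u := vbounded_msum bK (vbounded_segt u v).
rewrite -(Vol_shift (- t *: v) (b s)) -(Vol_shift (s *: v) (b t)).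
rewrite -(Vol_shift ((s - t) *: v) bK).
symmetry; apply: Vol_modular => //; try exact: vbounded_shift.
  move=> e e0; rewrite /fat !msum_shift !(msumAC K (segt _ _)).
  exact: segt_union.
move=> e e0; rewrite /fat !msum_shift !(msumAC K (segt _ _)).
by apply: segt_inter => //; apply: convex_msum => //; exact: convex_cube.
Qed.

(** Serves to cancel the normalising constants [Vol (cube 1)]. The lattice points of the half-open
    unit cube already give the bound. *)
Lemma Vol_cube1_ge1 : 1 <= Vol (cube 1).
Proof.
apply: lb_le_inf; first by have [] := Vset_inf (cube 1).
move=> _ [k [e [ke ->]]]; rewrite /dens ler_pdivlMr ?exprn_gt0 // mul1r.
have e0 : 0 <= e by apply: ltW; apply: lt_trans ke; rewrite invr_gt0 exprn_gt0.
rewrite -natrX ler_nat expnM.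
have -> : ((2 ^ k) ^ d = #|{: {ffun 'I_d -> 'I_(2 ^ k)}}|)%N by rewrite card_ffun !card_ord.
have fin : finite_set [set z | fat e (cube 1) (lat k z)].
  by apply: finite_lat; apply: vbounded_fat; exists 1.
rewrite cardE -(size_map (fun f : {ffun 'I_d -> 'I_(2 ^ k)} =>
  [ffun i => Posz (f i)] : {ffun 'I_d -> int})).
apply: uniq_leq_size.
  rewrite map_inj_uniq ?enum_uniq // => f g /ffunP fg; apply/ffunP => i.
  by have := fg i; rewrite !ffunE => -[] /val_inj.
move=> _ /mapP[f _ ->]; rewrite in_fset_set // inE /=; apply/fatE.
exists (lat k [ffun i => Posz (f i)]); last by move=> i; rewrite subrr normr0.
move=> i; rewrite mxE ffunE -pmulrn ger0_norm ?divr_ge0 ?exprn_ge0 //.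
by rewrite ler_pdivrMr ?exprn_gt0 // mul1r -natrX ler_nat ltnW.
Qed.

End Volume.

(** * Zonotopes *)

(** Otherwise the leading term, of degree above [n], outgrows the bound along [x = 2^i]; the sum [L]
    of the other absolute coefficients controls the rest. *)
Lemma poly_growth (R : realType) (P : {poly R}) (n : nat) (C : R) :
  (forall i : nat, `|P.[2 ^+ i]| <= C * (2 ^+ i) ^+ n) -> (size P <= n.+1)%N.
Proof.
move=> H; rewrite leqNgt; apply/negP => sP.
have [m sm] : exists m, size P = m.+2 by case: (size P) sP => [|[|m]] // _; exists m.
have P0 : lead_coef P != 0 by rewrite lead_coef_eq0 -size_poly_eq0 sm.
have nm : (n <= m)%N by rewrite sm in sP.
pose L := \sum_(i < m.+1) `|P`_i|.
have key i : `|lead_coef P| * 2 ^+ i <= `|C| + L.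
  set x : R := 2 ^+ i.
  have x1 : 1 <= x by rewrite /x exprn_ege1 // ler1n.
  have x0 : 0 < x by apply: lt_le_trans x1.
  have := H i; rewrite -/x horner_coef sm big_ord_recr /= => h.
  have lc : P`_m.+1 = lead_coef P by rewrite lead_coefE sm.
  rewrite lc in h.
  have h1 : `|lead_coef P| * x ^+ m.+1 <= `|C| * x ^+ m + L * x ^+ m.
    have -> : `|lead_coef P| * x ^+ m.+1 = `|lead_coef P * x ^+ m.+1|.
      by rewrite normrM (@ger0_norm _ (x ^+ _)) // exprn_ge0 // ltW.
    set S := \sum_(i < _) _ in h.
    have -> : lead_coef P * x ^+ m.+1 = (S + lead_coef P * x ^+ m.+1) - S by rewrite addrC addKr.
    apply: le_trans (ler_normB _ _) _; apply: lerD.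
      apply: le_trans h _; apply: (@le_trans _ _ (`|C| * x ^+ n)).
        by rewrite ler_pM2r ?exprn_gt0 // ler_norm.
      by rewrite ler_wpM2l // ler_weXn2l.
    rewrite /S /L mulr_suml; apply: le_trans (ler_norm_sum _ _ _) _.
    apply: ler_sum => k _; rewrite normrM ler_wpM2l // ger0_norm; last by rewrite exprn_ge0 // ltW.
    by rewrite ler_weXn2l // -ltnS.
  by move: h1; rewrite exprS mulrA -mulrDl ler_pM2r // exprn_gt0.
pose y := (`|C| + L) / `|lead_coef P|.
have lp : 0 < `|lead_coef P| by rewrite normr_gt0.
have := key (Num.bound y); rewrite mulrC -ler_pdivlMr // leNgt => /negP; apply.
exact: upper_nthrootP.
Qed.

(** Inversion of the Vandermonde matrix with nodes [1, ..., n+1]. The weights [beta] are the same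
    for all polynomials, so a coefficient becomes a fixed linear functional of finitely many
    values. *)
Lemma coef_from_values (R : realType) (n j : nat) : (j <= n)%N ->
  exists beta : 'I_n.+1 -> R, forall P : {poly R}, (size P <= n.+1)%N ->
    P`_j = \sum_r beta r * P.[r.+1%:R].
Proof.
move=> jn; pose x : 'rV[R]_n.+1 := \row_r (r.+1)%:R.
pose V := Vandermonde n.+1 x.
have uV : V \in unitmx.
  rewrite unitmxE det_Vandermonde unitfE; apply/prodf_neq0 => i _.
  apply/prodf_neq0 => k ik; rewrite !mxE subr_eq0 eqr_nat eqSS.
  by rewrite neq_ltn ik orbT.
exists (fun r => invmx V r (inord j)) => P sP.
pose c : 'rV[R]_n.+1 := \row_i P`_i.
have cV : c *m V = \row_r P.[r.+1%:R].
  apply/rowP => r; rewrite !mxE (horner_coef_wide _ sP).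
  by apply: eq_bigr => i _; rewrite !mxE.
have -> : P`_j = c 0 (inord j) by rewrite mxE inordK.
rewrite -(mulmxK uV c) cV mxE; apply: eq_bigr => r _.
by rewrite mxE mulrC.
Qed.

Section Zonotopes.
Variables (R : realType) (d : nat).
Implicit Types (A B K L : set 'cV[R]_d) (x y v w : 'cV[R]_d) (l : seq 'cV[R]_d).

Definition seg v : set 'cV[R]_d := segt 1 v.

Definition zl l : set 'cV[R]_d := foldr (fun v A => msum A (seg v)) [set 0] l.

Lemma segtE t v : 0 <= t -> segt t v = seg (t *: v).
Proof.
move=> t0; apply/seteqP; split=> z [s st ->].
  have [t00|tn] := eqVneq t 0.
    exists 0; rewrite ?normr0 //; move: st; rewrite t00 normr_le0 => /eqP ->.
    by rewrite !scale0r.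
  exists (s / t); last by rewrite scalerA divfK.
  by rewrite normrM normfV (ger0_norm t0) ler_pdivrMr ?mul1r // lt_neqAle eq_sym tn.
exists (s * t); last by rewrite scalerA.
by rewrite normrM (ger0_norm t0) -[X in _ <= X]mul1r ler_wpM2r.
Qed.

Lemma mscale_msum t A B : mscale t (msum A B) = msum (mscale t A) (mscale t B).
Proof.
apply/seteqP; split=> z.
  by move=> [_ [x [y [Ax By ->]]] <-]; exists (t *: x), (t *: y); rewrite scalerDr; split=> //; [exists x|exists y].
by move=> [_ [_ [[x Ax <-] [y By <-] ->]]]; exists (x + y); rewrite ?scalerDr //; exists x, y.
Qed.

Lemma mscale_seg t v : mscale t (seg v) = seg (t *: v).
Proof.
apply/seteqP; split=> z.
  by move=> [_ [s s1 ->] <-]; exists s; rewrite // !scalerA mulrC.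
by move=> [s s1 ->]; exists (s *: v); [exists s | rewrite !scalerA mulrC].
Qed.

Lemma mscale_zl t l : mscale t (zl l) = zl (map ( *:%R t) l).
Proof.
elim: l => [|v l IH] /=; last by rewrite mscale_msum IH mscale_seg.
by apply/seteqP; split=> z; [move=> [_ -> <-]; rewrite scaler0 | move=> ->; exists 0; rewrite ?scaler0].
Qed.

Lemma msum0 A : msum A [set 0] = A.
Proof.
apply/seteqP; split=> x; first by move=> [y [_ [Ay -> ->]]]; rewrite addr0.
by exists x, 0; rewrite addr0.
Qed.

Lemma zl_cat l l' : zl (l ++ l') = msum (zl l) (zl l').
Proof.
elim: l => [|v l IH] /=; first by rewrite msumC msum0.
by rewrite IH msumAC.
Qed.

Lemma zl_rem v l : v \in l -> zl l = msum (zl (rem v l)) (seg v).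
Proof.
elim: l => [//|a l IH]; rewrite inE /=; have [-> //|av /= /IH ->] := eqVneq a v.
by rewrite msumAC.
Qed.

Lemma perm_zl l l' : perm_eq l l' -> zl l = zl l'.
Proof.
elim: l l' => [|v l IH] l'; first by rewrite perm_sym => /perm_nilP ->.
move=> pl; have vl : v \in l' by rewrite -(perm_mem pl) mem_head.
have : perm_eq (v :: l) (v :: rem v l') by rewrite (perm_trans pl) // perm_to_rem.
by rewrite perm_cons (zl_rem vl) => /IH /= ->.
Qed.

Lemma convex_seg v : convex (seg v).
Proof.
move=> _ _ t [a a1 ->] [b b1 ->] t0 t1; exists (t * a + (1 - t) * b).
  rewrite (le_trans (ler_normD _ _)) // !normrM (ger0_norm t0).
  rewrite [X in _ + X * _]ger0_norm ?subr_ge0 //.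
  have := ler_wpM2l t0 a1; have := @ler_wpM2l _ (1 - t) _ _ _ b1.
  rewrite subr_ge0 => /(_ t1); lra.
by rewrite [RHS]scalerDl !scalerA.
Qed.

Lemma convex_zl l : convex (zl l).
Proof.
elim: l => [|v l IH] /=; last by apply: convex_msum => //; exact: convex_seg.
by move=> _ _ t -> -> _ _; rewrite !scaler0 addr0.
Qed.

Lemma vbounded_seg v : vbounded (seg v).
Proof. exact: vbounded_segt. Qed.

Lemma vbounded_zl l : vbounded (zl l).
Proof.
elim: l => [|v l IH] /=; last by apply: vbounded_msum => //; exact: vbounded_seg.
by exists 0 => _ -> i; rewrite mxE normr0.
Qed.

Lemma seg0 : seg 0 = [set 0].
Proof.
apply/seteqP; split=> z; first by move=> [s _ ->]; rewrite scaler0.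
by move=> ->; exists 0; rewrite ?normr0 // scaler0.
Qed.

Lemma zl0 l : zl l 0.
Proof.
elim: l => [|v l IH] //=; exists 0, 0; rewrite addr0; split=> //.
by exists 0; rewrite ?normr0 // scale0r.
Qed.

Lemma msum_subl A B : B 0 -> A `<=` msum A B.
Proof. by move=> B0 x Ax; exists x, 0; rewrite addr0. Qed.

Lemma seg_0 v : seg v 0.
Proof. by exists 0; rewrite ?normr0 // scale0r. Qed.

(** Additivity gives [g (N t) = N g t]; monotonicity squeezes it between [m g 1] and [(m+1) g 1],
    where [m] is the integer part of [N t], and [N] is arbitrary. *)
Lemma monotone_additive (g : R -> R) :
  (forall s t, 0 <= s -> 0 <= t -> g (s + t) = g s + g t) ->
  (forall s t, 0 <= s -> s <= t -> g s <= g t) ->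
  forall t, 0 <= t -> g t = t * g 1.
Proof.
move=> gD gm t t0.
have g0 : g 0 = 0 by have := gD 0 0 (lexx _) (lexx _); rewrite addr0; lra.
have gN (N : nat) s : 0 <= s -> g (N%:R * s) = N%:R * g s.
  move=> s0; elim: N => [|N IH]; first by rewrite !mul0r.
  by rewrite -natr1 !mulrDl !mul1r gD ?mulr_ge0 // IH.
have g1 : 0 <= g 1 by rewrite -g0; apply: gm.
apply/eqP; rewrite -subr_eq0 -normr_le0; apply/ler_addgt0Pr => e e0; rewrite add0r.
have [N N0 h3] : exists2 N : nat, 0 < N%:R :> R & g 1 <= e * N%:R.
  exists (Num.bound (g 1 / e)).+1; first by rewrite ltr0n.
  rewrite mulrC -ler_pdivrMr //; apply: le_trans (ltW (archi_boundP _)) _.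
    by rewrite divr_ge0 // ltW.
  by rewrite ler_nat.
have Nt0 : 0 <= N%:R * t by rewrite mulr_ge0.
have /andP[m1 m2] := truncn_itv Nt0.
set m := Num.truncn _ in m1 m2.
have h1 : m%:R * g 1 <= N%:R * g t.
  by rewrite -gN // -(gN N t) //; apply: gm; rewrite ?mulr1.
have h2 : N%:R * g t <= m.+1%:R * g 1.
  by rewrite -gN // -(gN m.+1 1) //; apply: gm; rewrite ?mulr1 // ltW.
have h4 : m%:R * g 1 <= N%:R * t * g 1 by rewrite ler_wpM2r.
have h5 : N%:R * t * g 1 <= m.+1%:R * g 1 by rewrite ler_wpM2r // ltW.
rewrite -natr1 in h2 h5.
suff : `|g t - t * g 1| * N%:R <= e * N%:R by rewrite ler_pM2r.
rewrite -[X in _ * X](@ger0_norm _ N%:R) // -normrM ler_norml mulrBl.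
by apply/andP; split; lra.
Qed.

Lemma Vol_seg K v t : convex K -> vbounded K -> 0 <= t ->
  Vol (msum K (seg (t *: v))) = Vol K + t * (Vol (msum K (seg v)) - Vol K).
Proof.
move=> cK bK t0; pose g s := Vol (msum K (segt s v)) - Vol K.
have : g t = t * g 1.
  apply: monotone_additive t0 => [s s' s0 s'0|s s' s0 ss]; rewrite /g.
    by have := Vol_segtD v cK bK s0 s'0; lra.
  rewrite lerD2r; apply: Vol_le.
    by apply: vbounded_msum => //; exact: vbounded_segt.
  by apply: msum_sub => // _ [a al ->]; exists a => //; apply: le_trans ss.
by rewrite /g -segtE // -/(seg v); lra.
Qed.

(** Affinity in the length of an added segment, tested at the lengths 0, 1 and 2. In this form it
    passes to linear combinations and averages. *)
Definition seg2 (F : set 'cV[R]_d -> R) := forall K v, convex K -> vbounded K ->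
  F (msum K (seg (2 *: v))) + F K = 2 * F (msum K (seg v)).

Definition hom2 (j : nat) (F : set 'cV[R]_d -> R) :=
  forall l, F (zl (map ( *:%R 2) l)) = 2 ^+ j * F (zl l).

(** If [F] vanishes on sums of [m] segments, [seg2] says that doubling one of [m+1] segments doubles
    [F]. Doubling all of them gives the factor [2^(m+1)], whereas [hom2] gives [2^j]. *)
Lemma zl_vanish_step F j m : seg2 F -> hom2 j F -> m.+1 <> j ->
  (forall l, size l = m -> F (zl l) = 0) ->
  forall l, size l = m.+1 -> F (zl l) = 0.
Proof.
move=> F2 Fj mj F0 l sl.
have key l1 l2 : (size l1 + size l2 = m.+1)%N ->
    F (zl (map ( *:%R 2) l1 ++ l2)) = 2 ^+ size l1 * F (zl (l1 ++ l2)).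
  elim: l1 l2 => [|v l1 IH] l2; first by rewrite expr0 mul1r.
  rewrite /= addSn => -[ss].
  have := F2 (zl (map ( *:%R 2) l1 ++ l2)) v (@convex_zl _) (vbounded_zl _).
  rewrite [F (zl _)]F0 ?size_cat ?size_map ?ss // addr0 => ->.
  rewrite exprS -mulrA; congr (_ * _).
  rewrite -[msum _ _]/(zl (v :: (map ( *:%R 2) l1 ++ l2))).
  rewrite (@perm_zl _ (map ( *:%R 2) l1 ++ v :: l2)); last first.
    by rewrite -cat_cons perm_sym perm_catC /= perm_cons perm_catC.
  rewrite IH ?addnS ?ss //; congr (_ * F _).
  rewrite -[RHS]/(zl (v :: (l1 ++ l2))); apply: perm_zl.
  by rewrite perm_catC /= perm_cons perm_catC.
have := key l [::]; rewrite !cats0 addn0 sl => /(_ erefl).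
rewrite Fj => /eqP; rewrite -subr_eq0 -mulrBl mulf_eq0 => /orP[|/eqP //].
rewrite subr_eq0 => /eqP /ieexprIn e; case: mj; rewrite e //.
by rewrite gt_eqF // ltr1n.
Qed.

(** Length [j] is the one that [zl_vanish_step] cannot reach, and it is assumed. Shorter lists are
    padded with zero vectors, longer ones follow by induction. *)
Lemma zl_vanish_above F j : seg2 F -> hom2 j F ->
  (forall l, size l = j -> F (zl l) = 0) ->
  forall l, F (zl l) = 0.
Proof.
move=> F2 Fj F0.
have lo l : (size l <= j)%N -> F (zl l) = 0.
  move=> sl; rewrite -(F0 (nseq (j - size l) 0 ++ l)).
    congr F; elim: (j - size l)%N => //= k ->.
    by rewrite seg0 msum0.
  by rewrite size_cat size_nseq subnK.
have hi m l : size l = (j + m)%N -> F (zl l) = 0.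
  elim: m l => [|m IH] l; first by rewrite addn0 => h; apply: F0.
  rewrite addnS => h; apply: (zl_vanish_step F2 Fj _ IH h); lia.
move=> l; have [/lo //|/ltnW jl] := leqP (size l) j.
by apply: (hi (size l - j)%N); rewrite subnKC.
Qed.

Lemma seg2_Vol : seg2 (@Vol R d).
Proof. by move=> K v cK bK; rewrite Vol_seg //; lra. Qed.

Lemma hom2_Vol : hom2 d (@Vol R d).
Proof. by move=> l; rewrite -mscale_zl Vol_scale2 //; exact: vbounded_zl. Qed.

Lemma Vol_zl_null l : (size l < d)%N -> Vol (zl l) = 0.
Proof.
suff H m : (m < d)%N -> forall l, size l = m -> Vol (zl l) = 0.
  by move=> ld; exact: (H (size l)).
elim: m => [|m IH] md {}l sl.
  (* Without segments the set is the origin, whose volume satisfies [Vol = 2^d Vol] with [d > 0]. *)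
  have /nilP -> : nilp l by rewrite /nilp sl.
  have := hom2_Vol [::]; rewrite /= => /eqP.
  rewrite -{1}[Vol _]mul1r -subr_eq0 -mulrBl mulf_eq0 => /orP[|/eqP //].
  rewrite subr_eq0 -{1}(expr0 (2 : R)) => /eqP /ieexprIn d0.
  by move: md; rewrite -d0 // gt_eqF // ltr1n.
apply: (zl_vanish_step seg2_Vol hom2_Vol _ _ sl); first by move=> h; rewrite h ltnn in md.
by move=> l' sl'; apply: IH => //; apply: ltnW.
Qed.

Lemma seg_norm (c : R) v : seg (c *: v) = seg (`|c| *: v).
Proof.
have [c0|c0] := leP 0 c; first by rewrite ger0_norm.
rewrite ltr0_norm //; apply/seteqP; split=> _ [s s1 ->];
  exists (- s); rewrite ?normrN //; by rewrite !scalerA ?mulrNN ?mulNr ?mulrN.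
Qed.

Lemma Vol_zl_scale (c : R) v l : (size l < d)%N ->
  Vol (zl (c *: v :: l)) = `|c| * Vol (zl (v :: l)).
Proof.
move=> ld; rewrite /= seg_norm Vol_seg ?Vol_zl_null //; first by rewrite add0r subr0.
  exact: convex_zl.
exact: vbounded_zl.
Qed.

(** With [N w] in place of [w], the sheared zonotope lies in the one with [v] and [(N + |c|) w], so
    [N X <= (N + |c|) Y]; divide by [N] and let it grow. The size hypothesis means [d] segments in
    all, so that scaling one segment scales the volume. *)
Lemma Vol_zl_shear_le (c : R) v w l : (size l).+1 = d.-1 ->
  Vol (zl (v + c *: w :: w :: l)) <= Vol (zl (v :: w :: l)).
Proof.
move=> ld; have ld' : ((size l).+1 < d)%N by lia.
set X := Vol (zl (v + c *: w :: w :: l)); set Y := Vol (zl (v :: w :: l)).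
have Y0 : 0 <= Y by exact: Vol_ge0.
have key (N : nat) : N%:R * X <= (N%:R + `|c|) * Y.
  have sw (a : R) u : 0 <= a -> a * Vol (zl (u :: w :: l)) = Vol (zl (u :: a *: w :: l)).
    move=> a0; rewrite [zl [:: u, w & l]]msumAC [zl [:: u, _ & l]]msumAC.
    by rewrite (@Vol_zl_scale a w (u :: l)) // ger0_norm.
  rewrite /X /Y !sw // ?addr_ge0 //; apply: Vol_le; first exact: vbounded_zl.
  rewrite /= -!msumA; apply: msum_sub => //.
  move=> _ [_ [_ [[a a1 ->] [b b1 ->] ->]]].
  exists ((a * N%:R + b * c) *: w), (b *: v); split.
  - rewrite -segtE ?addr_ge0 //; exists (a * N%:R + b * c) => //.
    rewrite (le_trans (ler_normD _ _)) // !normrM normr_nat lerD //.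
      by rewrite -[X in _ <= X]mul1r ler_wpM2r.
    by rewrite -[X in _ <= X]mul1r ler_wpM2r.
  - by exists b.
  - by apply/colP => i; rewrite !mxE; ring.
apply/ler_addgt0Pr => e e0.
have [N N0 h3] : exists2 N : nat, 0 < N%:R :> R & `|c| * Y <= e * N%:R.
  exists (Num.bound (`|c| * Y / e)).+1; first by rewrite ltr0n.
  rewrite [X in _ <= X]mulrC -ler_pdivrMr //; apply: le_trans (ltW (archi_boundP _)) _.
    by rewrite divr_ge0 ?mulr_ge0 // ltW.
  by rewrite ler_nat.
rewrite -(ler_pM2l N0); apply: le_trans (key N) _; lra.
Qed.

Lemma Vol_zl_shear (c : R) v w l : w \in l -> (size l = d.-1)%N ->
  Vol (zl (v + c *: w :: l)) = Vol (zl (v :: l)).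
Proof.
move=> wl sl; have pl := perm_to_rem wl.
have sr : (size (rem w l)).+1 = d.-1 by rewrite -sl (perm_size pl).
have P u : zl (u :: l) = zl (u :: w :: rem w l).
  by apply: perm_zl; rewrite perm_cons.
rewrite !P; apply/eqP; rewrite eq_le Vol_zl_shear_le //=.
by rewrite -{1}[v](addrK (c *: w)) -scaleNr Vol_zl_shear_le.
Qed.

Definition cl (m : nat) (A : 'M[R]_(d, m)) : seq 'cV[R]_d :=
  [seq col i A | i <- enum 'I_m].

Lemma Vol_col_update (A B : 'M[R]_d) (k : 'I_d) (c : R) (a : 'I_d -> R) :
  (forall i, i != k -> col i B = col i A) ->
  col k B = c *: col k A + \sum_(i | i != k) a i *: col i A ->
  Vol (zl (cl B)) = `|c| * Vol (zl (cl A)).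
Proof.
move=> BA Bk; have kE : k \in enum 'I_d by rewrite mem_enum.
pose r := rem k (enum 'I_d).
have rk i : i \in r -> i != k by rewrite mem_rem_uniq ?enum_uniq // inE => /andP[].
have pE (M : 'M[R]_d) : zl (cl M) = zl (col k M :: [seq col i M | i <- r]).
  by apply: perm_zl; apply: (@perm_map _ _ (fun i => col i M) _ (k :: r)); exact: perm_to_rem.
have rBA : [seq col i B | i <- r] = [seq col i A | i <- r].
  by apply/eq_in_map => i /rk; exact: BA.
have sr : size [seq col i A | i <- r] = d.-1.
  by rewrite size_map size_rem // size_enum_ord.
rewrite !pE rBA -Vol_zl_scale; last first.
  by rewrite sr prednK // (leq_ltn_trans _ (ltn_ord k)).
rewrite Bk.
have -> : \sum_(i | i != k) a i *: col i A = \sum_(i <- r) a i *: col i A.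
  transitivity (\sum_(i in 'I_d | i != k) a i *: col i A); first by apply: eq_bigl.
  rewrite -big_enum_cond (big_rem k) //= eqxx add0r -/r.
  rewrite big_seq_cond [RHS]big_seq; apply: eq_bigl => i.
  by apply: andb_idr; exact: rk.
have : {subset r <= r} by [].
elim: {1 3}r => [|i s IH] sr'; first by rewrite big_nil addr0.
have mi : col i A \in [seq col i A | i <- r].
  by apply: map_f; apply: sr'; rewrite mem_head.
rewrite big_cons addrCA [X in zl (X :: _)]addrC (Vol_zl_shear (a i) _ mi sr).
by apply: IH => x xs; apply: sr'; rewrite inE xs orbT.
Qed.

Lemma Vol_mul_upper (A T : 'M[R]_d) : (forall i k : 'I_d, (k < i)%N -> T i k = 0) ->
  Vol (zl (cl (A *m T))) = `|\prod_i T i i| * Vol (zl (cl A)).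
Proof.
move=> Tu.
(* Columns from [m] on are taken from [A T], the earlier ones from [A]. Passing from [B k.+1] to
   [B k] rewrites column [k] by means of earlier columns of [A], which are still present. *)
pose B m : 'M[R]_d := \matrix_(i, k) (if (m <= k)%N then (A *m T) i k else A i k).
have colB m k : col k (B m) = if (m <= k)%N then col k (A *m T) else col k A.
  by apply/colP => i; rewrite !mxE; case: ifP => _; rewrite !mxE.
have step (k : 'I_d) : Vol (zl (cl (B k))) = `|T k k| * Vol (zl (cl (B k.+1))).
  apply: (Vol_col_update (k := k) (a := fun i => if (i < k)%N then T i k else 0)).
    by move=> i ik; rewrite !colB ltn_neqAle eq_sym (_ : val i != val k).
  rewrite !colB leqnn ltnn.
  have -> : col k (A *m T) = \sum_i T i k *: col i A.
    apply/colP => i; rewrite !mxE summxE; apply: eq_bigr => l _.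
    by rewrite !mxE mulrC.
  rewrite (bigD1 k) //=; congr (_ + _); apply: eq_bigr => i ik.
  rewrite colB; have [ik'|] := ltnP i k.
    by rewrite ltnNge (ltnW ik').
  rewrite leq_eqVlt eq_sym (negPf (_ : val i != val k)) //= => ki.
  by rewrite Tu // !scale0r.
have H m : (m <= d)%N -> Vol (zl (cl (B (d - m)%N))) =
    `|\prod_(i < d | (d - m <= i)%N) T i i| * Vol (zl (cl (B d))).
  elim: m => [|m IH] md.
    rewrite subn0 big_pred0 ?normr1 ?mul1r // => i.
    by rewrite leqNgt ltn_ord.
  have mlt : (d - m.+1 < d)%N by rewrite ltn_subrL (leq_ltn_trans _ md).
  pose k := Ordinal mlt.
  have := step k; rewrite /= subnSK // => ->.
  rewrite IH ?(ltnW md) // mulrA -normrM; congr (`|_| * _).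
  rewrite [RHS](bigD1 k) //=; congr (_ * _); apply: eq_bigl => i.
  rewrite -(subnSK md) ltn_neqAle andbC; congr (_ && _).
  by rewrite eq_sym.
have := H d (leqnn d); rewrite subnn.
have -> : B 0%N = A *m T by apply/matrixP => i k; rewrite mxE.
have -> : B d = A by apply/matrixP => i k; rewrite mxE leqNgt ltn_ord.
by [].
Qed.

(** Conjugation with the order-reversing permutation matrix [J] turns lower into upper triangular,
    and permuting columns does not change a zonotope. *)
Lemma Vol_mul_lower (A T : 'M[R]_d) : (forall i k : 'I_d, (i < k)%N -> T i k = 0) ->
  Vol (zl (cl (A *m T))) = `|\prod_i T i i| * Vol (zl (cl A)).
Proof.
move=> Tu.
pose J : 'M[R]_d := \matrix_(i, k) (i == rev_ord k)%:R.
have MJ (M : 'M[R]_d) i k : (M *m J) i k = M i (rev_ord k).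
  rewrite mxE (bigD1 (rev_ord k)) //= mxE eqxx mulr1 big1 ?addr0 // => l lk.
  by rewrite mxE (negPf lk) mulr0.
have JM (M : 'M[R]_d) i k : (J *m M) i k = M (rev_ord i) k.
  rewrite mxE (bigD1 (rev_ord i)) //= mxE rev_ordK eqxx mul1r big1 ?addr0 // => l lk.
  by rewrite mxE -(inj_eq rev_ord_inj) rev_ordK eq_sym (negPf lk) mul0r.
have zJ (M : 'M[R]_d) : zl (cl (M *m J)) = zl (cl M).
  apply: perm_zl; rewrite /cl.
  have -> : [seq col i (M *m J) | i <- enum 'I_d] =
            [seq col i M | i <- [seq rev_ord i | i <- enum 'I_d]].
    rewrite -map_comp; apply: eq_map => i /=.
    by apply/colP => k; rewrite mxE MJ mxE.
  apply: perm_map; apply: uniq_perm; rewrite ?enum_uniq //.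
    by rewrite map_inj_uniq ?enum_uniq //; exact: rev_ord_inj.
  move=> i; rewrite mem_enum inE; apply/mapP; exists (rev_ord i); rewrite ?mem_enum //.
  by rewrite rev_ordK.
have JJ : J *m J = 1%:M.
  by apply/matrixP => i k; rewrite MJ !mxE rev_ordK.
have JE (M : 'M[R]_d) i k : (J *m M *m J) i k = M (rev_ord i) (rev_ord k).
  by rewrite MJ JM.
rewrite -(zJ (A *m T)) -(zJ A).
have -> : A *m T *m J = (A *m J) *m (J *m T *m J) by rewrite !mulmxA -(mulmxA A J J) JJ mulmx1.
rewrite Vol_mul_upper; last first.
  by move=> i k ki; rewrite JE Tu //= ; have := ltn_ord i; have := ltn_ord k; lia.
congr (`|_| * _); rewrite (reindex_inj rev_ord_inj) /=.
by apply: eq_bigr => i _; rewrite JE rev_ordK.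
Qed.

End Zonotopes.

(** * Volume under zonotope summands: Lipschitz bound, polynomiality, lattice counts *)

Section ZonotopeVolume.
Variables (R : realType) (d : nat).
Implicit Types (A B K L : set 'cV[R]_d) (x y v w : 'cV[R]_d) (l : seq 'cV[R]_d).

Lemma zlP (I : eqType) (v : I -> 'cV[R]_d) (s : seq I) x : uniq s ->
  zl [seq v i | i <- s] x <->
  exists c : I -> R, (forall i, `|c i| <= 1) /\ x = \sum_(i <- s) c i *: v i.
Proof.
elim: s x => [|i s IH] x /=.
  by move=> _; split=> [->|[c [_ ->]]]; rewrite ?big_nil //; exists (fun=> 0); rewrite big_nil normr0.
move=> /andP[iNs us]; split.
  move=> [y [_ [/(IH _ us)[c [c1 ->]] [a a1 ->] ->]]].
  exists (fun k => if k == i then a else c k); split; first by move=> k; case: eqP.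
  rewrite big_cons eqxx addrC; congr (_ + _); apply: eq_big_seq => k ks.
  by case: eqP => // ki; rewrite -ki ks in iNs.
move=> [c [c1 ->]]; exists (\sum_(k <- s) c k *: v k), (c i *: v i); split.
- by apply/IH => //; exists c.
- by exists (c i).
- by rewrite big_cons addrC.
Qed.

Lemma cubeE (t : R) : 0 <= t -> cube t = zl (map ( *:%R t) (cl (1%:M : 'M[R]_d))).
Proof.
move=> t0; rewrite -map_comp; apply/seteqP; split=> x.
  move=> xt; apply/zlP; first exact: enum_uniq.
  exists (fun i => if t == 0 then 0 else x i 0 / t); split.
    move=> i; case: eqP => [|/eqP tn]; first by rewrite normr0.
    by rewrite normrM normfV (ger0_norm t0) ler_pdivrMr ?mul1r ?lt_neqAle ?(eq_sym 0) ?tn //; apply: xt.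
  apply/colP => i; rewrite summxE big_enum (bigD1 i) //= !mxE eqxx mulr1.
  rewrite big1 ?addr0; last by move=> k ki; rewrite !mxE [i == k]eq_sym (negPf ki) !mulr0.
  case: eqP => [t00|/eqP tn]; last by rewrite divfK.
  by have := xt i; rewrite t00 normr_le0 mul0r => /eqP.
move=> /zlP - /(_ (enum_uniq _))[c [c1 ->]] i; rewrite summxE big_enum (bigD1 i) //= !mxE eqxx mulr1.
rewrite big1 ?addr0; last by move=> k ki; rewrite !mxE [i == k]eq_sym (negPf ki) !mulr0.
by rewrite normrM (ger0_norm t0) -[X in _ <= X]mul1r ler_wpM2r.
Qed.

Lemma size_cl m (A : 'M[R]_(d, m)) : size (cl A) = m.
Proof. by rewrite size_map size_enum_ord. Qed.

(** By [Vol_seg] a segment shortened by the factor [1/N] contributes [1/N] of the increment of the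
    full one, and that increment is at most the volume of [L] plus the whole zonotope. *)
Lemma Vol_fat_inv (N : nat) l L : (0 < N)%N -> convex L -> vbounded L ->
  Vol (msum L (zl (map ( *:%R N%:R^-1) l))) <=
  Vol L + (size l)%:R / N%:R * Vol (msum L (zl l)).
Proof.
move=> N0 cL bL; have N0' : 0 < N%:R :> R by rewrite ltr0n.
elim: l => [|v l IH] /=; first by rewrite msum0 mul0r mul0r addr0.
set K := msum L (zl (map _ l)) in IH *.
have cK : convex K by apply: convex_msum => //; exact: convex_zl.
have bK : vbounded K by apply: vbounded_msum => //; exact: vbounded_zl.
rewrite msumA -/K Vol_seg ?invr_ge0 ?ler0n //.
rewrite -natr1 mulrDl mulrDl mul1r addrA.
have h1 : Vol (msum K (seg v)) - Vol K <= Vol (msum L (msum (zl l) (seg v))).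
  apply: (@le_trans _ _ (Vol (msum K (seg v)))); first by rewrite gerBl Vol_ge0.
  apply: Vol_le.
    by do 2?[apply: vbounded_msum => //]; [exact: vbounded_zl|exact: vbounded_seg].
  rewrite msumA; apply: msum_sub => //; apply: msum_sub => //.
  elim: (l) => [//|u l' IH'] /=; apply: msum_sub => //.
  move=> _ [s s1 ->]; exists (s / N%:R); last by rewrite scalerA.
  by rewrite normrM normfV normr_nat ler_pdivrMr // mul1r (le_trans s1) // ler1n.
have h2 : Vol (msum L (zl l)) <= Vol (msum L (msum (zl l) (seg v))).
  apply: Vol_le.
    by do 2?[apply: vbounded_msum => //]; [exact: vbounded_zl|exact: vbounded_seg].
  by apply: msum_sub => //; apply: msum_subl; exact: seg_0.
apply: lerD; last by rewrite ler_wpM2l // invr_ge0.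
apply: le_trans IH _; rewrite lerD2l; apply: ler_wpM2l h2.
by rewrite divr_ge0.
Qed.

Lemma Vol_lip (e : R) K L : 0 < e -> e <= 1 -> convex L -> vbounded L ->
  K `<=` fat e L -> Vol K <= Vol L + (2 * d%:R * e) * Vol (fat 1 L).
Proof.
move=> e0 e1 cL bL KL.
have ie1 : 1 <= e^-1 by rewrite -[X in X <= _]invr1 lef_pV2 ?posrE.
have /andP[m1 m2] := truncn_itv (le_trans ler01 ie1).
(* [N] is the integer part of [1/e], so [e <= 1/N <= 2 e]; this is the origin of the factor 2, while
   [d] counts the segments that span the cube. *)
set N := Num.truncn _ in m1 m2.
have N0 : (0 < N)%N by rewrite /N truncn_gt0.
have N0' : 0 < N%:R :> R by rewrite ltr0n.
have eN : e <= N%:R^-1 by rewrite -[e]invrK lef_pV2 ?posrE ?invr_gt0.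
have Ne : N%:R^-1 <= 2 * e.
  have h : e^-1 <= 2 * N%:R.
    apply: ltW; apply: lt_le_trans m2 _; rewrite -natr1.
    have : 1 <= N%:R :> R by rewrite ler1n.
    lra.
  have := mulrV (unitf_gt0 e0); have := ler_pM2l e0 (e^-1) (2 * N%:R); rewrite h => /esym h'.
  move=> h2; rewrite h2 in h'.
  by rewrite -[X in X <= _]mul1r ler_pdivrMr //; lra.
apply: (@le_trans _ _ (Vol (fat N%:R^-1 L))).
  by apply: Vol_le; [exact: vbounded_fat|apply: subset_trans KL _; exact: fat_sub].
rewrite /fat !cubeE ?invr_ge0 //.
have -> : map ( *:%R 1) (cl (1%:M : 'M[R]_d)) = cl 1%:M.
  by rewrite -[RHS]map_id; apply: eq_map => u; rewrite scale1r.
apply: le_trans (Vol_fat_inv _ N0 cL bL) _; rewrite lerD2l size_cl.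
apply: ler_wpM2r; first exact: Vol_ge0.
have -> : 2 * d%:R * e = d%:R * (2 * e) by ring.
by rewrite ler_wpM2l.
Qed.

(** Iterating [Vol_seg] yields a polynomial whose degree is bounded by the number of segments. The
    bound [d] comes from growth: [K + 2^i Z] lies in [2^i (cube M' + Z)], whose volume is [2^(i d)]
    times a constant. *)
Lemma Vol_poly K l : convex K -> vbounded K ->
  exists2 P : {poly R}, (size P <= d.+1)%N &
    forall N : nat, Vol (msum K (zl (map ( *:%R N%:R) l))) = P.[N%:R].
Proof.
move=> cK bK.
have [P HP] : exists P : {poly R}, forall N : nat,
    Vol (msum K (zl (map ( *:%R N%:R) l))) = P.[N%:R].
  elim: l K cK bK => [|v l IH] K cK bK /=.
    by exists (Vol K)%:P => N; rewrite hornerC msum0.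
  have [P1 H1] := IH K cK bK.
  have [P2 H2] := IH (msum K (seg v)) (convex_msum cK (@convex_seg _ _ v))
     (vbounded_msum bK (vbounded_seg v)).
  exists (P1 + 'X * (P2 - P1)) => N; rewrite msumA Vol_seg //; last 2 first.
  - by apply: convex_msum => //; exact: convex_zl.
  - by apply: vbounded_msum => //; exact: vbounded_zl.
  by rewrite msumAC H1 H2 !hornerE.
exists P => //.
have [M KM] := bK.
pose M' := Num.max M 0.
apply: (@poly_growth _ _ _ (Vol (msum (cube M') (zl l)))) => i.
have bZ : vbounded (msum (cube M') (zl l)).
  by apply: vbounded_msum; [exists M'|exact: vbounded_zl].
have hs k : Vol (mscale (2 ^+ k) (msum (cube M') (zl l))) = (2 ^+ k) ^+ d * Vol (msum (cube M') (zl l)).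
  elim: k => [|k IH].
    rewrite expr0 expr1n mul1r; congr Vol; apply/seteqP; split=> x.
      by move=> [y Ay <-]; rewrite scale1r.
    by exists x => //; rewrite scale1r.
  rewrite exprS exprMn -mulrA -IH -Vol_scale2; last exact: vbounded_scale.
  congr Vol; apply/seteqP; split=> x.
    by move=> [y Ay <-]; exists (2 ^+ k *: y); [exists y|rewrite scalerA].
  by move=> [_ [y Ay <-] <-]; exists y; rewrite ?scalerA.
have -> : 2 ^+ i = (2 ^ i)%N%:R :> R by rewrite natrX.
rewrite -HP ger0_norm ?Vol_ge0 // mulrC natrX -hs.
apply: Vol_le; first exact: vbounded_scale.
rewrite mscale_msum mscale_zl; apply: msum_sub => // x /KM xM.
exists (2 ^- i *: x); last by rewrite scalerA mulfV ?scale1r // expf_neq0 // pnatr_eq0.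
have i0 : 0 <= 2 ^- i :> R by rewrite invr_ge0 exprn_ge0.
move=> k; rewrite mxE normrM (ger0_norm i0).
apply: (@le_trans _ _ (1 * M')); last by rewrite mul1r.
apply: ler_pM => //; first by rewrite invf_le1 ?exprn_gt0 // exprn_ege1 // ler1n.
by rewrite le_max; apply/orP; left; apply: xM.
Qed.

(* Slightly shrunk copies of [K] stay inside [K] after fattening. *)
Lemma Vol_of_counts K (v r : R) x : convex K -> vbounded K -> 0 < r ->
  shift x (cube r) `<=` K ->
  (forall del, 0 < del -> exists k0, forall k, (k0 <= k)%N ->
     `|(cnt k K)%:R / 2 ^+ (k * d) - v| <= del) ->
  v = Vol K.
Proof.
move=> cK bK r0 xK Hv; apply/eqP; rewrite eq_le; apply/andP; split.
  apply/ler_addgt0Pr => del del0.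
  have d2 : 0 < del / 2 by lra.
  have [k0 H0] := Hv _ d2.
  have [e0 [k1 [e00 H1]]] := Vol_dens bK d2.
  have := H0 (maxn k0 k1) (leq_maxl _ _); rewrite ler_norml => /andP[h1 h2].
  have := H1 (maxn k0 k1) e0 (leq_maxr _ _) (lexx _).
  have : (cnt (maxn k0 k1) K)%:R / 2 ^+ (maxn k0 k1 * d) <= dens K (maxn k0 k1) e0.
    rewrite /dens ler_pM2r ?invr_gt0 ?exprn_gt0 // ler_nat.
    apply: cnt_le; first exact: vbounded_fat.
    by apply: msum_subl => i; rewrite mxE normr0 ltW.
  lra.
have [M0 KM0] := bK.
pose M := Num.max M0 1.
have KM : K `<=` cube M by move=> y /KM0 yM i; rewrite le_max yM.
have M1 : 1 <= M by rewrite le_max lexx orbT.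
pose C := 2 * d%:R * (2 * M) * Vol (fat 1 K).
have C0 : 0 <= C by rewrite !mulr_ge0 // ?Vol_ge0 //; lra.
have xKx : K x.
  by apply: xK; exists 0; rewrite ?add0r // => i; rewrite mxE normr0 ltW.
(* The copy of [K] shrunk towards [x] by the factor [1 - s] stays in [K] after fattening by [s r],
   so its volume is at most [v]; it is within [2 s M] of [K], so [Vol_lip] bounds the loss by
   [s C]. *)
have key s : 0 < s -> s * (2 * M) <= 1 -> Vol K <= v + s * C.
  move=> s0 sM; have s1 : s <= 1.
    by have : 0 < s * M by [rewrite mulr_gt0 //; lra]; move: sM; nra.
  pose L := [set (1 - s) *: y + s *: x | y in K].
  have cL : convex L.
    move=> _ _ t [a Ka <-] [b Kb <-] t0 t1; exists (t *: a + (1 - t) *: b); first exact: cK.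
    by apply/colP => i; rewrite !mxE; ring.
  have LK : L `<=` K.
    by move=> _ [a Ka <-]; have := @cK a x (1 - s) Ka xKx; rewrite subKr; apply; lra.
  have bL := vbounded_sub LK bK.
  have fL : fat (s * r) L `<=` K.
    move=> z /fatE[_ [y Ky <-] H].
    have -> : z = (1 - s) *: y + (1 - (1 - s)) *: (s^-1 *: (z - (1 - s) *: y)).
      by rewrite subKr scalerA mulfV ?gt_eqF // scale1r addrC subrK.
    apply: cK => //; last 2 first; [lra|lra|].
    apply: xK; exists (s^-1 *: (z - (1 - s) *: y) - x); last by rewrite subrK.
    move=> i; have := H i; rewrite !mxE.
    have -> : s^-1 * (z i 0 - (1 - s) * y i 0) - x i 0 =
       s^-1 * (z i 0 - ((1 - s) * y i 0 + s * x i 0)).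
      by field; rewrite gt_eqF.
    by rewrite normrM normfV (gtr0_norm s0) => h; rewrite mulrC ler_pdivrMr // [r * s]mulrC.
  have VL : Vol L <= v.
    apply/ler_addgt0Pr => del del0.
    have [k0 H0] := Hv _ del0.
    have [k1 H1] := ex_pow2_lt (mulr_gt0 s0 r0).
    have := H0 (maxn k0 k1) (leq_maxl _ _); rewrite ler_norml => /andP[h1 h2].
    have := Vol_le_dens L (H1 (maxn k0 k1) (leq_maxr _ _)).
    have : dens L (maxn k0 k1) (s * r) <= (cnt (maxn k0 k1) K)%:R / 2 ^+ (maxn k0 k1 * d).
      rewrite /dens ler_pM2r ?invr_gt0 ?exprn_gt0 // ler_nat; exact: cnt_le.
    lra.
  have KL : K `<=` fat (s * (2 * M)) L.
    move=> y Ky; apply/fatE; exists ((1 - s) *: y + s *: x); first by exists y.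
    move=> i; rewrite !mxE.
    have -> : y i 0 - ((1 - s) * y i 0 + s * x i 0) = s * (y i 0 - x i 0) by ring.
    rewrite normrM (gtr0_norm s0); apply: ler_wpM2l; first exact: ltW.
    have := KM y Ky i; have := KM x xKx i; rewrite !ler_norml => /andP[? ?] /andP[? ?].
    by apply/andP; split; lra.
  have sM0 : 0 < s * (2 * M) by rewrite mulr_gt0 //; lra.
  apply: le_trans (Vol_lip sM0 sM cL bL KL) _; apply: lerD => //.
  have -> : s * C = 2 * d%:R * (s * (2 * M)) * Vol (fat 1 K) by rewrite /C; ring.
  apply: ler_wpM2l; first by rewrite !mulr_ge0 //; lra.
  by apply: Vol_le; [exact: vbounded_fat | exact: fat_sub].
apply/ler_addgt0Pr => del del0.
pose s := Num.min (2 * M)^-1 (del / (C + 1)).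
have s0 : 0 < s by rewrite lt_min invr_gt0 divr_gt0 //; lra.
apply: le_trans (key s s0 _) _.
  by rewrite -ler_pdivlMr ?mul1r; [rewrite ge_min lexx|lra].
rewrite lerD2l; apply: (@le_trans _ _ (del / (C + 1) * C)).
  by rewrite ler_wpM2r // ge_min lexx orbT.
by rewrite mulrAC ler_pdivrMr; [rewrite ler_wpM2l //; lra | lra].
Qed.

End ZonotopeVolume.

(** LUP decomposition: the triangular factors act by column operations, and the permutation reorders
    the segments. [cormen_lup] takes matrices of positive size, so [d = 0] is treated apart. *)
Lemma Vol_det (R : realType) (d : nat) (A : 'M[R]_d) :
  Vol (zl (cl A)) = `|\det A| * Vol (cube 1 : set 'cV[R]_d).
Proof.
have c1 n : (cube 1 : set 'cV[R]_n) = zl (cl 1%:M).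
  rewrite cubeE //; congr zl; rewrite -[RHS]map_id.
  by apply: eq_map => u; rewrite scale1r.
case: d A => [|d] A.
  rewrite det_mx00 normr1 mul1r c1; congr (Vol (zl (cl _))).
  by apply/matrixP => -[].
case E : (cormen_lup A) => [[P L] U].
have := cormen_lup_correct A; rewrite E => PA.
have /existsP[s /eqP Ps] := cormen_lup_perm A; rewrite E /= in Ps.
have Llow (i k : 'I_d.+1) : (i <= k)%N -> L i k = (i == k)%:R.
  by move=> /(cormen_lup_lower A); rewrite E.
have Uup (i k : 'I_d.+1) : (k < i)%N -> U i k = 0 by move=> /(cormen_lup_upper A); rewrite E.
have Llow' (i k : 'I_d.+1) : (i < k)%N -> L i k = 0.
  by move=> ik; rewrite (Llow _ _ (ltnW ik)) -val_eqE (ltn_eqF ik).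
have AE : A = perm_mx (s^-1)%g *m L *m U.
  by rewrite -mulmxA -[L *m U]/(L * U) -PA Ps -mulmxE mulmxA -perm_mxM mulVg perm_mx1 mul1mx.
have detA : `|\det A| = `|\prod_i L i i| * `|\prod_i U i i|.
  rewrite AE !det_mulmx det_perm normrM normrM normrX normrN1 expr1n mul1r.
  rewrite -(det_tr U) !det_trig //; last 2 first.
  - by apply/is_trig_mxP => i k ik; rewrite ?mxE ?(Llow' _ _ ik) ?(Uup _ _ ik).
  - by apply/is_trig_mxP => i k ik; rewrite ?mxE ?(Llow' _ _ ik) ?(Uup _ _ ik).
  by congr (_ * `| _ |); apply: eq_bigr => i _; rewrite mxE.
rewrite detA AE Vol_mul_upper // Vol_mul_lower // mulrCA mulrA; congr (_ * _).
rewrite c1; congr Vol; apply: perm_zl; rewrite /cl.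
have -> : [seq col i (perm_mx (s^-1)%g : 'M[R]_d.+1) | i <- enum 'I_d.+1] =
    [seq col i (1%:M : 'M[R]_d.+1) | i <- [seq s i | i <- enum 'I_d.+1]].
  rewrite -[RHS]map_comp; apply: eq_map => i; apply/colP => k; rewrite !mxE.
  by rewrite -(inj_eq (@perm_inj _ s)) permKV.
apply: perm_map; apply: uniq_perm; rewrite ?enum_uniq //.
  by rewrite map_inj_uniq ?enum_uniq //; exact: perm_inj.
move=> i; rewrite mem_enum inE; apply/mapP; exists ((s^-1)%g i); rewrite ?mem_enum //.
by rewrite permKV.
Qed.

(** * The invariant mean on the orthogonal group *)

Lemma bernoulli_ge (R : realDomainType) (h : R) (k : nat) : 0 <= h ->
  1 + k%:R * h <= (1 + h) ^+ k.
Proof.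
move=> h0; elim: k => [|k IH]; first by rewrite mul0r addr0 expr0.
rewrite exprS -natr1; have := ler_wpM2l (_ : 0 <= 1 + h) IH.
have : 0 <= k%:R * h * h by rewrite !mulr_ge0.
rewrite addr_ge0 // => h1 /(_ isT) h2; lra.
Qed.

Lemma expr_lt_small (R : realType) (t e : R) : 0 <= t -> t < 1 -> 0 < e ->
  exists k : nat, t ^+ k <= e.
Proof.
move=> t0 t1 e0; have [->|tn] := eqVneq t 0.
  by exists 1%N; rewrite expr1 ltW.
have tp : 0 < t by rewrite lt_neqAle eq_sym tn.
pose h := t^-1 - 1; have h0 : 0 < h by rewrite subr_gt0 -[X in X < _]invr1 ltf_pV2 ?posrE.
have [N hN] : exists N : nat, e^-1 / h < N%:R.
  by exists (Num.bound (e^-1 / h)); rewrite archi_boundP // divr_ge0 ?invr_ge0 // ltW.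
exists N; rewrite -[t]invrK exprVn -[e]invrK lef_pV2 ?posrE ?invr_gt0 ?exprn_gt0 ?invr_gt0 //.
have -> : t^-1 = 1 + h by rewrite /h addrC subrK.
apply: le_trans (bernoulli_ge _ (ltW h0)).
move: hN; rewrite ltr_pdivrMr // => /ltW h'; apply: le_trans h' _.
by rewrite lerDr.
Qed.

Lemma ler_sum_pairs (R : realDomainType) (u v : seq R) (w : R) :
  size u = size v -> (forall a b, a \in u -> b \in v -> a - b <= w) ->
  \sum_(a <- u) a - \sum_(b <- v) b <= (size u)%:R * w.
Proof.
elim: u v => [|a u IH] [|b v] //=; first by rewrite !big_nil subr0 mul0r.
move=> [suv] H; rewrite !big_cons -natr1.
have h1 := H a b (mem_head _ _) (mem_head _ _).
have h2 := IH v suv (fun x y xu yv => H x y (mem_behead (s := a :: u) xu) (mem_behead (s := b :: v) yv)).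
lra.
Qed.

(** Radii of the form [c / (2 (L + 1))] recur below; the [+ 1] keeps them meaningful for [L = 0]. *)
Lemma ler_half_ratio (R : realType) (L c : R) : 0 <= L -> 0 <= c ->
  L * (c / (2 * (L + 1))) <= c / 2.
Proof.
move=> L0 c0; have L1 : 0 < L + 1 by lra.
have -> : L * (c / (2 * (L + 1))) = L / (L + 1) * (c / 2) by field; rewrite gt_eqF.
by rewrite ler_piMl ?divr_ge0 // ler_pdivrMr // mul1r lerDl.
Qed.

Section Orthogonal.
Variables (R : realType) (n : nat).
Implicit Types (g x y a b : 'M[R]_n) (f h : 'M[R]_n -> R).

Definition orth g := g *m g^T = 1%:M.

Lemma orth1 : orth 1%:M. Proof. by rewrite /orth trmx1 mulmx1. Qed.

Lemma orthTl g : orth g -> g^T *m g = 1%:M.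
Proof. exact: mulmx1C. Qed.

Lemma orthT g : orth g -> orth g^T.
Proof. by move=> /orthTl og; rewrite /orth trmxK. Qed.

Lemma orthM g x : orth g -> orth x -> orth (g *m x).
Proof. by move=> og oh; rewrite /orth trmx_mul mulmxA -(mulmxA g) oh mulmx1. Qed.

(** The squared Frobenius norm. Its invariance under orthogonal factors on both sides makes
    translations preserve Lipschitz constants. *)
Definition fn2 p q (X : 'M[R]_(p, q)) : R := \sum_i \sum_j X i j ^+ 2.

Definition fn p q (X : 'M[R]_(p, q)) : R := Num.sqrt (fn2 X).

Lemma fn2_ge0 p q (X : 'M[R]_(p, q)) : 0 <= fn2 X.
Proof. by apply: sumr_ge0 => i _; apply: sumr_ge0 => j _; exact: sqr_ge0. Qed.

Lemma fn_ge0 p q (X : 'M[R]_(p, q)) : 0 <= fn X.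
Proof. exact: sqrtr_ge0. Qed.

Lemma fn2_tr p q (X : 'M[R]_(p, q)) : fn2 X = \tr (X *m X^T).
Proof.
by apply: eq_bigr => i _; rewrite mxE; apply: eq_bigr => j _; rewrite mxE expr2.
Qed.

Lemma fn2T p q (X : 'M[R]_(p, q)) : fn2 X^T = fn2 X.
Proof. by rewrite !fn2_tr trmxK mxtrace_mulC. Qed.

Lemma fnT p q (X : 'M[R]_(p, q)) : fn X^T = fn X.
Proof. by rewrite /fn fn2T. Qed.

Lemma fn2Ml q g (X : 'M[R]_(n, q)) : orth g -> fn2 (g *m X) = fn2 X.
Proof.
by move=> og; rewrite -(fn2T (g *m X)) -(fn2T X) !fn2_tr !trmxK trmx_mul -mulmxA (mulmxA g^T) orthTl // mul1mx.
Qed.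

Lemma fnMl q g (X : 'M[R]_(n, q)) : orth g -> fn (g *m X) = fn X.
Proof. by move=> og; rewrite /fn fn2Ml. Qed.

Lemma fnMr g (X : 'M[R]_n) : orth g -> fn (X *m g) = fn X.
Proof. by move=> og; rewrite -fnT trmx_mul fnMl ?fnT //; exact: orthT. Qed.

Lemma fnN p q (X : 'M[R]_(p, q)) : fn (- X) = fn X.
Proof.
by rewrite /fn /fn2; congr Num.sqrt; do 2![apply: eq_bigr => ? _]; rewrite mxE sqrrN.
Qed.

Lemma fn_entry p q (X : 'M[R]_(p, q)) i j : `|X i j| <= fn X.
Proof.
rewrite -sqrtr_sqr ler_sqrt ?fn2_ge0 // /fn2 (bigD1 i) //= (bigD1 j) //= -addrA lerDl.
by rewrite addr_ge0 //; [|apply: sumr_ge0 => k _]; apply: sumr_ge0 => l _; exact: sqr_ge0.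
Qed.

Lemma fn_le p q (X : 'M[R]_(p, q)) (e : R) : 0 <= e ->
  (forall i j, `|X i j| <= e) -> fn X <= (p * q)%:R * e.
Proof.
move=> e0 Xe; rewrite -(@ger0_norm _ (_ * e)) ?mulr_ge0 // -sqrtr_sqr ler_sqrt ?sqr_ge0 //.
apply: (@le_trans _ _ (\sum_(i < p) \sum_(j < q) e ^+ 2)).
  apply: ler_sum => i _; apply: ler_sum => j _.
  by rewrite -[X in X <= _]real_normK ?num_real // lerXn2r ?nnegrE.
rewrite !sumr_const !card_ord -mulrnA (mulnC q p) -[X in X <= _]mulr_natl exprMn.
apply: ler_wpM2r; first exact: sqr_ge0.
rewrite expr2 -natrM ler_nat; case: (p * q)%N => // m; exact: leq_pmulr.
Qed.

Lemma orth_entry g i j : orth g -> `|g i j| <= 1.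
Proof.
move=> og; have := congr1 (fun M : 'M[R]_n => M i i) og; rewrite !mxE eqxx /= => h.
rewrite -sqrtr_sqr -[X in _ <= X]sqrtr1; apply: ler_wsqrtr.
apply: (@le_trans _ _ (\sum_k g i k * g^T k i)); last by rewrite h.
rewrite (bigD1 j) //= mxE -expr2 lerDl.
by apply: sumr_ge0 => k _; rewrite mxE -expr2 sqr_ge0.
Qed.

Definition diam : R := (n * n)%:R * 2.

Lemma orth_dist x y : orth x -> orth y -> fn (x - y) <= diam.
Proof.
move=> ox oy; apply: fn_le => // i j; rewrite !mxE (le_trans (ler_normB _ _)) //.
by have := orth_entry i j ox; have := orth_entry i j oy; lra.
Qed.

Definition lip (L : R) f := forall x y, orth x -> orth y -> `|f x - f y| <= L * fn (x - y).

Definition avg (s : seq (R * 'M[R]_n)) f x := \sum_(p <- s) p.1 * f (p.2 *m x).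

Definition okw (s : seq (R * 'M[R]_n)) :=
  (\sum_(p <- s) p.1 = 1) /\ (forall p, p \in s -> 0 <= p.1 /\ orth p.2).

Lemma lip_mono L L' f : L <= L' -> lip L f -> lip L' f.
Proof.
move=> LL fL x y ox oy; apply: le_trans (fL x y ox oy) _.
by rewrite ler_wpM2r // fn_ge0.
Qed.

Lemma lipT L f : lip L f -> lip L (fun x => f x^T).
Proof.
move=> fL x y ox oy; apply: le_trans (fL _ _ (orthT ox) (orthT oy)) _.
by rewrite -linearB /= fnT.
Qed.

Lemma lipMr L f b : orth b -> lip L f -> lip L (fun x => f (x *m b)).
Proof.
move=> ob fL x y ox oy; apply: le_trans (fL _ _ (orthM ox ob) (orthM oy ob)) _.
by rewrite -mulmxBl fnMr.
Qed.

Lemma lipMl L f b : orth b -> lip L f -> lip L (fun x => f (b *m x)).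
Proof.
move=> ob fL x y ox oy; apply: le_trans (fL _ _ (orthM ob ox) (orthM ob oy)) _.
by rewrite -mulmxBr fnMl.
Qed.

Lemma avg_lip L s f : okw s -> lip L f -> lip L (avg s f).
Proof.
move=> [s1 sp] fL x y ox oy; rewrite /avg -sumrB.
apply: le_trans (ler_norm_sum _ _ _) _.
rewrite -[X in _ <= X]mul1r -s1 mulr_suml big_seq [X in _ <= X]big_seq.
apply: ler_sum => p /sp[p0 op]; rewrite -mulrBr normrM (ger0_norm p0) ler_wpM2l //.
exact: (lipMl op fL).
Qed.

Lemma avg_le s f c : okw s -> (forall x, orth x -> f x <= c) ->
  forall x, orth x -> avg s f x <= c.
Proof.
move=> [s1 sp] fc x ox; rewrite -[X in _ <= X]mul1r -s1 mulr_suml /avg.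
rewrite big_seq [X in _ <= X]big_seq; apply: ler_sum => p /sp[p0 op].
by rewrite ler_wpM2l // fc //; exact: orthM.
Qed.

Lemma avg_ge s f c : okw s -> (forall x, orth x -> c <= f x) ->
  forall x, orth x -> c <= avg s f x.
Proof.
move=> [s1 sp] fc x ox; rewrite -[X in X <= _]mul1r -s1 mulr_suml /avg.
rewrite big_seq [X in _ <= X]big_seq; apply: ler_sum => p /sp[p0 op].
by rewrite ler_wpM2l // fc //; exact: orthM.
Qed.

(** Entries of orthogonal matrices lie in [[-1, 1]]; rounding them to cells of width [1/m] leaves
    finitely many classes. One element is taken from each inhabited class, and the identity stands
    in for the empty ones. *)
Lemma ex_net (r : R) : 0 < r -> exists A : seq 'M[R]_n,
  [/\ A != [::], (forall a, a \in A -> orth a) &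
      forall g, orth g -> exists2 a, a \in A & fn (a - g) <= r].
Proof.
move=> r0.
have [m m0 hm] : exists2 m : nat, (0 < m)%N & (n * n)%:R / m%:R <= r.
  exists (Num.bound ((n * n)%:R / r)).+1 => //.
  rewrite ler_pdivrMr ?ltr0n // mulrC -ler_pdivrMr //.
  apply: le_trans (ltW (archi_boundP _)) _; first by rewrite divr_ge0 // ltW.
  by rewrite ler_nat.
have m0' : 0 < m%:R :> R by rewrite ltr0n.
pose cell g : {ffun 'I_n * 'I_n -> 'I_(2 * m).+1} :=
  [ffun p => inord (Num.truncn ((g p.1 p.2 + 1) * m%:R))].
pose S c := [set g | orth g /\ cell g = c].
exists [seq xget 1%:M (S c) | c <- enum {: {ffun 'I_n * 'I_n -> 'I_(2 * m).+1}}].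
split.
- rewrite -size_eq0 size_map -cardE -lt0n; apply/card_gt0P.
  by exists [ffun=> ord0].
- move=> _ /mapP[c _ ->].
  by case: xgetP => [g _ [] //|_]; exact: orth1.
move=> g og; exists (xget 1%:M (S (cell g))).
  by apply: map_f; rewrite mem_enum.
have [oa ca] : S (cell g) (xget 1%:M (S (cell g))) by apply: (@xgetPex _ _ (S (cell g))); exists g.
set a := xget _ _ in oa ca *.
have bd b i j : orth b -> 0 <= (b i j + 1) * m%:R <= (2 * m)%:R.
  move=> ob; have := orth_entry i j ob; rewrite ler_norml => /andP[b1 b2].
  rewrite mulr_ge0 /=; [|lra|exact: ltW].
  by rewrite natrM ler_pM2r //; lra.
apply: le_trans hm; rewrite -[_ / _]/(_ * m%:R^-1); apply: fn_le; first by rewrite invr_ge0.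
move=> i j; rewrite !mxE.
have := congr1 (fun c : {ffun _ -> 'I_(2 * m).+1} => nat_of_ord (c (i, j))) ca.
have tr b : orth b -> (Num.truncn ((b i j + 1) * m%:R)%R < (2 * m).+1)%N.
  move=> /(bd b i j)/andP[b0 b1]; rewrite ltnS -(ler_nat R); apply: le_trans b1.
  by rewrite truncn_le.
rewrite !ffunE /= !inordK ?tr // => ct.
have /andP[a1 a2] := truncn_itv (proj1 (andP (bd a i j oa))).
have /andP[g1 g2] := truncn_itv (proj1 (andP (bd g i j og))).
rewrite ct in a1 a2; rewrite -natr1 in a2; rewrite -natr1 in g2.
rewrite -[_^-1]mul1r ler_pdivlMr // -[X in _ * X](@gtr0_norm _ m%:R) // -normrM.
by rewrite ler_norml; apply/andP; split; lra.
Qed.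

Definition compw (s t : seq (R * 'M[R]_n)) :=
  [seq (p.1 * q.1, q.2 *m p.2) | p <- s, q <- t].

Lemma avg_comp s t f x : avg (compw s t) f x = avg s (avg t f) x.
Proof.
rewrite /avg /compw big_allpairs_dep; apply: eq_bigr => p _.
by rewrite mulr_sumr; apply: eq_bigr => q _; rewrite mulmxA mulrA.
Qed.

Lemma okw_comp s t : okw s -> okw t -> okw (compw s t).
Proof.
move=> [s1 sp] [t1 tp]; split.
  rewrite /compw big_allpairs_dep /= -s1; apply: eq_bigr => p _.
  by rewrite -mulr_sumr t1 mulr1.
move=> _ /allpairsP[[p q] /= [/sp[p0 op] /tp[q0 oq] ->]] /=.
by split; [rewrite mulr_ge0 | exact: orthM].
Qed.

Definition osc f (w : R) := forall x y, orth x -> orth y -> f x - f y <= w.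

(** Average over a net [A] of [q] rotations. Given [x] and [y], some [a0] in [A] lies near
    [a1 y x^T], so [f (a0 x)] exceeds [f (a1 y)] by at most [L r]; the remaining [q - 1] terms are
    paired arbitrarily at cost [w] each. *)
Lemma contraction (L r : R) : 0 < r -> 0 <= L -> exists2 q : nat, (0 < q)%N &
  exists2 s, okw s & forall f w, lip L f -> osc f w ->
    osc (avg s f) ((1 - q%:R^-1) * w + q%:R^-1 * (L * r)).
Proof.
move=> r0 L0; have [A [A0 oA netA]] := ex_net r0.
pose q := size A.
have q0 : (0 < q)%N by rewrite lt0n size_eq0.
have q0' : 0 < q%:R :> R by rewrite ltr0n.
exists q => //; exists [seq (q%:R^-1, a) | a <- A].
  split; last by move=> _ /mapP[a /oA oa ->]; split; rewrite //= invr_ge0.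
  rewrite big_map /= big_const_seq count_predT iter_addr addr0 -/q.
  by rewrite -[_ *+ q]mulr_natl mulfV // gt_eqF.
move=> f w fL fw x y ox oy.
have avE z : avg [seq (q%:R^-1, a) | a <- A] f z = q%:R^-1 * \sum_(a <- A) f (a *m z).
  by rewrite /avg big_map mulr_sumr.
have [a1 A1] : exists a1, a1 \in A.
  by case: (A) A0 => [//|a ? _]; exists a; rewrite mem_head.
have [a0 A0' h0] := netA (a1 *m y *m x^T) (orthM (orthM (oA _ A1) oy) (orthT ox)).
rewrite !avE -mulrBr.
have -> : (1 - q%:R^-1) * w + q%:R^-1 * (L * r) = q%:R^-1 * ((q%:R - 1) * w + L * r).
  by field; rewrite gt_eqF.
rewrite ler_pM2l ?invr_gt0 //.
rewrite (bigop.perm_big _ (perm_to_rem A0')) (bigop.perm_big (a1 :: rem a1 A) (perm_to_rem A1)) /= !big_cons.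
have h1 : f (a0 *m x) - f (a1 *m y) <= L * r.
  apply: le_trans (ler_norm _) _.
  apply: le_trans (fL _ _ (orthM (oA _ A0') ox) (orthM (oA _ A1) oy)) _.
  rewrite ler_wpM2l //; apply: le_trans h0.
  by rewrite -(fnMr (a0 - a1 *m y *m x^T) ox) mulmxBl -(mulmxA _ x^T) orthTl // mulmx1.
have := @ler_sum_pairs _ [seq f (a *m x) | a <- rem a0 A] [seq f (a *m y) | a <- rem a1 A] w.
rewrite !size_map !size_rem // !big_map -/q => /(_ erefl).
rewrite -subn1 natrB // => H.
have {}H := H _; rewrite [_%:R]/= in H.
suff : \sum_(j <- rem a0 A) f (j *m x) - \sum_(j <- rem a1 A) f (j *m y) <= (q%:R - 1) * w by lra.
apply: H => _ _ /mapP[a /mem_rem aA ->] /mapP[b /mem_rem bA ->].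
by apply: fw; apply: orthM => //; exact: oA.
Qed.

(** Iterated contraction. One weight system [s] serves all [L]-Lipschitz functions simultaneously;
    the later replacement of means by finite sums, uniformly in a parameter, rests on this. *)
Lemma ex_small_osc (L e : R) : 0 < e -> 0 <= L ->
  exists2 s, okw s & forall f, lip L f -> osc (avg s f) e.
Proof.
move=> e0 L0; pose r := e / (2 * (L + 1)).
have L1 : 0 < L + 1 by lra.
have r0 : 0 < r by rewrite divr_gt0 // mulr_gt0.
have Lr : L * r <= e / 2 by exact: ler_half_ratio (ltW e0).
have [q q0 [s os Hs]] := contraction r0 L0.
have q0' : 0 < q%:R :> R by rewrite ltr0n.
have q1 : q%:R^-1 <= 1 :> R by rewrite invf_le1 // ler1n.
pose th : R := 1 - q%:R^-1.
have th0 : 0 <= th by rewrite subr_ge0.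
have th1 : th < 1 by rewrite /th ltrBlDr ltrDl invr_gt0.
have W0 : 0 <= L * diam by rewrite !mulr_ge0.
have W1 : 0 < L * diam + 1 by lra.
have [k hk] := expr_lt_small th0 th1 (divr_gt0 (divr_gt0 e0 (ltr0Sn R 1)) W1).
have [s' os' Hs'] : exists2 s', okw s' & forall f, lip L f ->
    osc (avg s' f) (th ^+ k * (L * diam) + L * r).
  elim: (k) => [|k' [s' os' IH]].
    exists [:: (1, 1%:M)].
      split; first by rewrite big_seq1.
      by move=> p; rewrite inE => /eqP ->; split=> //=; exact: orth1.
    move=> f fL x y ox oy; rewrite /avg !big_seq1 !mul1mx !mul1r.
    apply: le_trans (ler_norm _) _; apply: le_trans (fL x y ox oy) _.
    apply: (@le_trans _ _ (L * diam)); first by rewrite ler_wpM2l // orth_dist.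
    by rewrite lerDl mulr_ge0 // ltW.
  exists (compw s s'); first exact: okw_comp.
  move=> f fL x y ox oy; rewrite !avg_comp.
  apply: le_trans (Hs _ _ (avg_lip os' fL) (IH f fL) x y ox oy) _.
  by rewrite -/th (_ : q%:R^-1 = 1 - th) ?exprS; [lra | rewrite /th subKr].
exists s' => // f fL x y ox oy; apply: le_trans (Hs' f fL x y ox oy) _.
have : th ^+ k * (L * diam) <= e / 2.
  apply: (@le_trans _ _ (e / 2 / (L * diam + 1) * (L * diam))); first by rewrite ler_wpM2r.
  rewrite mulrAC ler_pdivrMr // ler_wpM2l //; last by lra.
  by rewrite ltW // divr_gt0.
lra.
Qed.

(** Left and right averages commute; a right average is written as a left average conjugated by
    transposition. *)
Lemma avg_tr_comm s t f x : avg s (fun y => avg t (fun z => f z^T) y^T) x =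
  avg t (fun z => avg s f z^T) x^T.
Proof.
rewrite /avg; under eq_bigr do rewrite mulr_sumr.
rewrite exchange_big /=; apply: eq_bigr => p _; rewrite mulr_sumr.
apply: eq_bigr => q _; rewrite mulrCA; congr (_ * (_ * f _)).
by rewrite !trmx_mul !trmxK mulmxA.
Qed.

(* For Lipschitz [f] this is the Haar integral, because finite averages of
   translates have arbitrarily small oscillation. *)
Definition haar f : R :=
  inf [set c | exists2 s, okw s & forall x, orth x -> avg s f x <= c].

(** Uniqueness of the mean. A right average [B] of [f] is almost constant, so averaging it on the
    left by [s] or by a competitor [t] hardly changes it; by [avg_tr_comm] the results also inherit
    the bounds of [avg s f] and [avg t f]. *)
Lemma haar_osc L f s e : 0 <= L -> lip L f -> okw s -> 0 <= e -> osc (avg s f) e ->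
  forall x, orth x -> `|avg s f x - haar f| <= e.
Proof.
move=> L0 fL os e0 hs x ox.
set E := [set c | exists2 s, okw s & forall x, orth x -> avg s f x <= c].
set m := avg s f x.
have Em : E (m + e).
  by exists s => // y oy; have := hs y x oy ox; rewrite -/m; lra.
have low c : E c -> m - e <= c.
  move=> [t ot ht]; apply/ler_addgt0Pr => e' e'0.
  have e2 : 0 < e' / 2 by lra.
  have [r or hr] := ex_small_osc e2 L0.
  have {}hr := hr _ (lipT fL).
  pose B z := avg r (fun z => f z^T) z^T.
  have Bosc y : orth y -> `|B y - B x| <= e' / 2.
    move=> oy; rewrite ler_norml /B.
    have h1 := hr y^T x^T (orthT oy) (orthT ox); have h2 := hr x^T y^T (orthT ox) (orthT oy).
    by apply/andP; split; lra.
  have AB u : okw u -> `|avg u B x - B x| <= e' / 2.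
    move=> ou; rewrite ler_norml; apply/andP; split.
      rewrite lerBrDr; apply: (avg_ge ou) => // y /Bosc; rewrite ler_norml => /andP[]; lra.
    rewrite lerBlDr; apply: (avg_le ou) => // y /Bosc; rewrite ler_norml => /andP[]; lra.
  have h1 : avg t B x <= c.
    rewrite /B avg_tr_comm; apply: (avg_le or); last exact: orthT.
    by move=> y oy; apply: ht; exact: orthT.
  have h2 : m - e <= avg s B x.
    rewrite /B avg_tr_comm; apply: (avg_ge or); last exact: orthT.
    by move=> y oy; have := hs x y^T ox (orthT oy); rewrite -/m; lra.
  have := AB t ot; have := AB s os; rewrite !ler_norml => /andP[? ?] /andP[? ?].
  lra.
have hinf : has_inf E by split; [exists (m + e) | exists (m - e) => c; exact: low].
rewrite ler_norml; apply/andP; split.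
  have : haar f <= m + e by apply: ge_inf => //; case: hinf.
  lra.
have : m - e <= haar f by apply: lb_le_inf; [exists (m + e) | move=> c; exact: low].
lra.
Qed.

Lemma haar_riemann (L e : R) : 0 < e -> 0 <= L ->
  exists2 s, okw s & forall f, lip L f -> forall x, orth x -> `|avg s f x - haar f| <= e.
Proof.
move=> e0 L0; have [s os Hs] := ex_small_osc e0 L0; exists s => // f fL.
by apply: (haar_osc L0 fL os); [exact: ltW | exact: Hs].
Qed.

Definition lipschitz f := exists2 L, 0 <= L & lip L f.

Lemma haar_lin (a : R) f h : lipschitz f -> lipschitz h ->
  haar (fun g => a * f g + h g) = a * haar f + haar h.
Proof.
move=> [L1 L10 fL] [L2 L20 hL].
have L0 : 0 <= `|a| * L1 + L1 + L2 by rewrite !addr_ge0 // mulr_ge0.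
have fhL : lip (`|a| * L1 + L1 + L2) (fun g => a * f g + h g).
  move=> x y ox oy; have h1 := fL x y ox oy; have h2 := hL x y ox oy.
  have -> : a * f x + h x - (a * f y + h y) = a * (f x - f y) + (h x - h y) by ring.
  apply: le_trans (ler_normD _ _) _; rewrite normrM.
  have := ler_wpM2l (normr_ge0 a) h1; have := mulr_ge0 L10 (fn_ge0 (x - y)); lra.
apply/eqP; rewrite -subr_eq0 -normr_le0; apply/ler_addgt0Pr => e e0; rewrite add0r.
have e3 : 0 < e / (2 + `|a|) by rewrite divr_gt0 //; have := normr_ge0 a; lra.
have [s os Hs] := haar_riemann e3 L0.
have m1 : L1 <= `|a| * L1 + L1 + L2 by have := mulr_ge0 (normr_ge0 a) L10; lra.
have m2 : L2 <= `|a| * L1 + L1 + L2 by have := mulr_ge0 (normr_ge0 a) L10; lra.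
have h1 := Hs _ (lip_mono m1 fL) _ orth1; have h2 := Hs _ (lip_mono m2 hL) _ orth1.
have h3 := Hs _ fhL _ orth1.
have avE : avg s (fun g => a * f g + h g) 1%:M = a * avg s f 1%:M + avg s h 1%:M.
  by rewrite /avg mulr_sumr -big_split; apply: eq_bigr => p _ /=; ring.
rewrite avE in h3.
set X := avg s f _ in h1 h3; set Y := avg s h _ in h2 h3.
have -> : haar (fun g => a * f g + h g) - (a * haar f + haar h) =
   - (a * X + Y - haar (fun g => a * f g + h g)) + a * (X - haar f) + (Y - haar h) by ring.
apply: le_trans (ler_normD _ _) _.
have h4 : `|- (a * X + Y - haar (fun g => a * f g + h g)) + a * (X - haar f)| <=
    e / (2 + `|a|) + `|a| * (e / (2 + `|a|)).
  apply: le_trans (ler_normD _ _) _; rewrite normrN normrM.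
  by have := ler_wpM2l (normr_ge0 a) h1; move: h3; lra.
apply: le_trans (lerD h4 h2) _; rewrite le_eqVlt; apply/orP; left; apply/eqP.
by field; rewrite gt_eqF //; have := normr_ge0 a; lra.
Qed.

Lemma haar_le f h : lipschitz f -> lipschitz h ->
  (forall g, orth g -> f g <= h g) -> haar f <= haar h.
Proof.
move=> [L1 L10 fL] [L2 L20 hL] fh; apply/ler_addgt0Pr => e e0.
have e2 : 0 < e / 2 by lra.
have [s os Hs] := haar_riemann e2 (addr_ge0 L10 L20).
have m1 : L1 <= L1 + L2 by rewrite lerDl.
have m2 : L2 <= L1 + L2 by rewrite lerDr.
have h1 := Hs _ (lip_mono m1 fL) _ orth1; have h2 := Hs _ (lip_mono m2 hL) _ orth1.
have : avg s f 1%:M <= avg s h 1%:M.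
  have [_ sp] := os; rewrite /avg big_seq [X in _ <= X]big_seq.
  apply: ler_sum => p /sp[p0 op]; rewrite ler_wpM2l // fh //; exact: orthM orth1.
move: h1 h2; rewrite !ler_norml => /andP[? ?] /andP[? ?]; lra.
Qed.

Lemma haar_eq f h : lipschitz f -> lipschitz h ->
  (forall g, orth g -> f g = h g) -> haar f = haar h.
Proof.
move=> lf lh fh; apply/eqP; rewrite eq_le !haar_le //.
- by move=> g og; rewrite fh.
- by move=> g og; rewrite fh.
Qed.

Lemma lip_cst c : lipschitz (fun=> c).
Proof. by exists 0 => // x y _ _; rewrite subrr normr0 mul0r. Qed.

Lemma haar_cst c : haar (fun=> c) = c.
Proof.
have [s os Hs] := haar_riemann (@ltr01 R) (lexx 0).
have l0 : lip 0 (fun=> c) by move=> x y _ _; rewrite subrr normr0 mul0r.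
have av t x : okw t -> avg t (fun=> c) x = c.
  by move=> [t1 _]; rewrite /avg -mulr_suml t1 mul1r.
have := @haar_osc 0 _ s 0 (lexx 0) l0 os (lexx 0) _ _ orth1.
rewrite av // => /(_ _) h; apply/esym/eqP; rewrite -subr_eq0 -normr_le0.
by apply: h => x y _ _; rewrite !av // subrr.
Qed.

Lemma haar_Mr f b : lipschitz f -> orth b -> haar (fun g => f (g *m b)) = haar f.
Proof.
move=> [L L0 fL] ob.
apply/eqP; rewrite -subr_eq0 -normr_le0; apply/ler_addgt0Pr => e e0; rewrite add0r.
have e2 : 0 < e / 2 by lra.
have [s os Hs] := haar_riemann e2 L0.
have h1 := Hs _ (lipMr ob fL) _ orth1.
have h2 := Hs _ fL _ ob.
have E : avg s (fun g => f (g *m b)) 1%:M = avg s f b.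
  by rewrite /avg; apply: eq_bigr => p _; rewrite mulmx1.
rewrite E in h1; move: h1 h2; rewrite !ler_norml => /andP[? ?] /andP[? ?].
by apply/andP; split; lra.
Qed.

(** The average of [f] by [s] on both sides is close to the mean of [f] and to that of its
    transpose. *)
Lemma haar_T f : lipschitz f -> haar (fun g => f g^T) = haar f.
Proof.
move=> [L L0 fL].
apply/eqP; rewrite -subr_eq0 -normr_le0; apply/ler_addgt0Pr => e e0; rewrite add0r.
have e2 : 0 < e / 2 by lra.
have [s os Hs] := haar_riemann e2 L0.
have h1 y := Hs _ (lipT fL) y^T.
have h2 y := Hs _ fL y^T.
have b1 c F : (forall y, orth y -> `|F y - c| <= e / 2) ->
    forall x, orth x -> `|avg s F x - c| <= e / 2.
  move=> H x ox; rewrite ler_norml; apply/andP; split.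
    rewrite lerBrDr; apply: (avg_ge os) => // y /H; rewrite ler_norml => /andP[]; lra.
  rewrite lerBlDr; apply: (avg_le os) => // y /H; rewrite ler_norml => /andP[]; lra.
have k1 := b1 _ _ (fun y oy => h1 y (orthT oy)) _ orth1.
have k2 := b1 _ _ (fun y oy => h2 y (orthT oy)) _ (orthT orth1).
rewrite avg_tr_comm in k1.
move: k1 k2; rewrite !ler_norml => /andP[? ?] /andP[? ?].
by apply/andP; split; lra.
Qed.

Lemma lipschitzT f : lipschitz f -> lipschitz (fun x => f x^T).
Proof. by move=> [L L0 /lipT fL]; exists L. Qed.

Lemma lipschitzMr f b : orth b -> lipschitz f -> lipschitz (fun x => f (x *m b)).
Proof. by move=> ob [L L0 /(lipMr ob) fL]; exists L. Qed.

Lemma lipschitzMl f b : orth b -> lipschitz f -> lipschitz (fun x => f (b *m x)).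
Proof. by move=> ob [L L0 /(lipMl ob) fL]; exists L. Qed.

Lemma haar_Ml f b : lipschitz f -> orth b -> haar (fun g => f (b *m g)) = haar f.
Proof.
move=> lf ob; rewrite -(haar_T lf) -(haar_T (lipschitzMl ob lf)).
rewrite -(haar_Mr (lipschitzT lf) (orthT ob)); apply: haar_eq.
- exact: lipschitzT (lipschitzMl ob lf).
- exact: lipschitzMr (orthT ob) (lipschitzT lf).
- by move=> g _; rewrite trmx_mul trmxK.
Qed.

Lemma lipschitzM f h : lipschitz f -> lipschitz h -> lipschitz (fun g => f g * h g).
Proof.
move=> [L1 L10 fL] [L2 L20 hL].
pose B f (L : R) := `|f 1%:M : R| + L * diam.
have bd f' L : 0 <= L -> lip L f' -> forall x, orth x -> `|f' x| <= B f' L.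
  move=> L0 l x ox; have := l x _ ox orth1.
  have := ler_wpM2l L0 (orth_dist ox orth1) => h1 h2.
  have := ler_normD (f' x - f' 1%:M) (f' 1%:M); rewrite subrK /B; lra.
have B10 : 0 <= B f L1 by rewrite addr_ge0 // !mulr_ge0.
have B20 : 0 <= B h L2 by rewrite addr_ge0 // !mulr_ge0.
exists (B f L1 * L2 + B h L2 * L1); first by rewrite addr_ge0 // mulr_ge0.
move=> x y ox oy.
have -> : f x * h x - f y * h y = f x * (h x - h y) + h y * (f x - f y) by ring.
apply: le_trans (ler_normD _ _) _; rewrite !normrM mulrDl -!mulrA.
by apply: lerD; apply: ler_pM => //; [exact: bd | exact: hL | exact: bd | exact: fL].
Qed.

Lemma lipschitzD f h : lipschitz f -> lipschitz h -> lipschitz (fun g => f g + h g).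
Proof.
move=> [L1 L10 fL] [L2 L20 hL]; exists (L1 + L2); first exact: addr_ge0.
move=> x y ox oy.
have -> : f x + h x - (f y + h y) = (f x - f y) + (h x - h y) by ring.
by apply: le_trans (ler_normD _ _) _; rewrite mulrDl lerD // ?fL ?hL.
Qed.

Lemma lipschitzZ c f : lipschitz f -> lipschitz (fun g => c * f g).
Proof. by move=> lf; apply: lipschitzM => //; exact: lip_cst. Qed.

Lemma lipschitzN f : lipschitz f -> lipschitz (fun g => - f g).
Proof.
move=> [L L0 fL]; exists L => // x y ox oy.
by rewrite -opprD normrN; exact: fL.
Qed.

Lemma lipschitzB f h : lipschitz f -> lipschitz h -> lipschitz (fun g => f g - h g).
Proof. by move=> lf lh; apply: lipschitzD => //; exact: lipschitzN. Qed.

Lemma lipschitz_norm f : lipschitz f -> lipschitz (fun g => `|f g|).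
Proof.
move=> [L L0 fL]; exists L => // x y ox oy.
by apply: le_trans (fL x y ox oy); rewrite ler_dist_dist.
Qed.

Lemma lipschitz_entry i j : lipschitz (fun g => g i j).
Proof.
exists 1 => // x y _ _; rewrite mul1r.
by have := fn_entry (x - y) i j; rewrite !mxE.
Qed.

Lemma lipschitz_sum (I : Type) (r : seq I) (F : I -> 'M[R]_n -> R) :
  (forall i, lipschitz (F i)) -> lipschitz (fun g => \sum_(i <- r) F i g).
Proof.
move=> lF; elim: r => [|i r IH].
  have [L L0 l] := lip_cst 0; exists L => // x y ox oy; rewrite !big_nil; exact: l.
have [L L0 l] := lipschitzD (lF i) IH; exists L => // x y ox oy.
by rewrite !big_cons; exact: l.
Qed.

Lemma lipschitz_prod (I : Type) (r : seq I) (F : I -> 'M[R]_n -> R) :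
  (forall i, lipschitz (F i)) -> lipschitz (fun g => \prod_(i <- r) F i g).
Proof.
move=> lF; elim: r => [|i r IH].
  have [L L0 l] := lip_cst 1; exists L => // x y ox oy; rewrite !big_nil; exact: l.
have [L L0 l] := lipschitzM (lF i) IH; exists L => // x y ox oy.
by rewrite !big_cons; exact: l.
Qed.

Lemma lipschitzX f k : lipschitz f -> lipschitz (fun g => f g ^+ k).
Proof.
move=> lf; elim: k => [|k IH]; first by have [L L0 l] := lip_cst 1; exists L.
have [L L0 l] := lipschitzM lf IH; exists L => // x y ox oy.
by rewrite !exprS; exact: l.
Qed.

Lemma haarD f h : lipschitz f -> lipschitz h ->
  haar (fun g => f g + h g) = haar f + haar h.
Proof.
move=> lf lh; rewrite -[haar f]mul1r -haar_lin //; apply: haar_eq.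
- exact: lipschitzD.
- by apply: lipschitzD => //; exact: lipschitzZ.
- by move=> g _; rewrite mul1r.
Qed.

Lemma haarZ c f : lipschitz f -> haar (fun g => c * f g) = c * haar f.
Proof.
move=> lf; rewrite -[RHS]addr0 -(haar_cst 0) -haar_lin //; last exact: lip_cst.
apply: haar_eq => [||g _]; last by rewrite addr0.
- exact: lipschitzZ.
- by apply: lipschitzD; [exact: lipschitzZ | exact: lip_cst].
Qed.

Lemma haarB f h : lipschitz f -> lipschitz h ->
  haar (fun g => f g - h g) = haar f - haar h.
Proof.
move=> lf lh; rewrite haarD //; last exact: lipschitzN.
congr (_ + _); rewrite -mulN1r -haarZ //; apply: haar_eq => [||g _].
- exact: lipschitzN.
- exact: lipschitzZ.
- by rewrite mulN1r.
Qed.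

Lemma haar_sum (I : Type) (r : seq I) (F : I -> 'M[R]_n -> R) :
  (forall i, lipschitz (F i)) ->
  haar (fun g => \sum_(i <- r) F i g) = \sum_(i <- r) haar (F i).
Proof.
move=> lF; elim: r => [|i r IH].
  rewrite big_nil -[RHS](haar_cst 0); apply: haar_eq => [||g _]; rewrite ?big_nil //.
    exact: lipschitz_sum.
  exact: lip_cst.
rewrite big_cons -IH -haarD //; last exact: lipschitz_sum.
apply: haar_eq => [||g _]; last by rewrite big_cons.
  exact: lipschitz_sum.
by apply: lipschitzD => //; exact: lipschitz_sum.
Qed.

Lemma haar_ge0 f : lipschitz f -> (forall g, orth g -> 0 <= f g) -> 0 <= haar f.
Proof. by move=> lf f0; rewrite -(haar_cst 0); apply: haar_le => //; exact: lip_cst. Qed.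

(** [f] is at least [f 1 / 2] near the identity, so the sum of its translates over a finite net is
    bounded below everywhere; by invariance each translate has the same mean. *)
Lemma haar_gt0 f : lipschitz f -> (forall g, orth g -> 0 <= f g) -> 0 < f 1%:M ->
  0 < haar f.
Proof.
move=> lf f0 f1; have [L L0 fL] := lf.
pose r := f 1%:M / (2 * (L + 1)).
have L1 : 0 < L + 1 by lra.
have r0 : 0 < r by rewrite divr_gt0 // mulr_gt0.
have Lr : L * r <= f 1%:M / 2 by exact: ler_half_ratio (ltW f1).
have [A [A0 oA netA]] := ex_net r0.
(* The membership test makes every summand Lipschitz, since orthogonality is known for members of
   [A] only. *)
have lA : lipschitz (fun g => \sum_(a <- A) (if a \in A then f (a^T *m g) else 0)).
  apply: lipschitz_sum => a; case aA: (a \in A); last exact: lip_cst.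
  exact: lipschitzMl (orthT (oA _ aA)) lf.
have : f 1%:M / 2 <= haar (fun g => \sum_(a <- A) (if a \in A then f (a^T *m g) else 0)).
  rewrite -[X in X <= _]haar_cst; apply: haar_le => //; first exact: lip_cst.
  move=> g og; have [a aA ag] := netA g og.
  rewrite (big_rem a) //= aA.
  have h : `|f (a^T *m g) - f 1%:M| <= f 1%:M / 2.
    apply: le_trans (fL _ _ (orthM (orthT (oA _ aA)) og) orth1) _.
    apply: le_trans Lr; rewrite ler_wpM2l //; apply: le_trans ag.
    have -> : a^T *m g - 1%:M = a^T *m (g - a) by rewrite mulmxBr (orthTl (oA _ aA)).
    by rewrite (fnMl _ (orthT (oA _ aA))) -fnN opprB.
  have : 0 <= \sum_(y <- rem a A) (if y \in A then f (y^T *m g) else 0).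
    apply: sumr_ge0 => b _; case: ifP => // /oA ob; apply: f0.
    exact: orthM (orthT ob) og.
  move: h; rewrite ler_norml => /andP[]; lra.
rewrite haar_sum; last first.
  move=> a; case aA: (a \in A); last exact: lip_cst.
  exact: lipschitzMl (orthT (oA _ aA)) lf.
rewrite big_seq (eq_bigr (fun=> haar f)); last first.
  by move=> a aA; rewrite aA haar_Ml //; apply: orthT; exact: oA.
rewrite -big_seq big_const_seq count_predT iter_addr addr0 -[haar f *+ _]mulr_natl => h.
have : 0 < (size A)%:R * haar f by apply: lt_le_trans h; rewrite divr_gt0.
by rewrite pmulr_rgt0 // ltr0n lt0n size_eq0.
Qed.

End Orthogonal.

(** * Orthogonal triangularization *)

Section Triangular.
Variable R : realType.

Definition dotp n (u v : 'cV[R]_n) : R := \sum_i u i 0 * v i 0.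

Lemma dotpC n (u v : 'cV[R]_n) : dotp u v = dotp v u.
Proof. by apply: eq_bigr => i _; rewrite mulrC. Qed.

Lemma dotpDl n (u v w : 'cV[R]_n) : dotp (u + v) w = dotp u w + dotp v w.
Proof. by rewrite -big_split; apply: eq_bigr => i _; rewrite !mxE mulrDl. Qed.

Lemma dotpZl n (c : R) (u v : 'cV[R]_n) : dotp (c *: u) v = c * dotp u v.
Proof. by rewrite mulr_sumr; apply: eq_bigr => i _; rewrite mxE mulrA. Qed.

Lemma dotpNl n (u v : 'cV[R]_n) : dotp (- u) v = - dotp u v.
Proof. by rewrite -scaleN1r dotpZl mulN1r. Qed.

Lemma dotpBl n (u v w : 'cV[R]_n) : dotp (u - v) w = dotp u w - dotp v w.
Proof. by rewrite dotpDl dotpNl. Qed.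

Lemma dotpDr n (u v w : 'cV[R]_n) : dotp w (u + v) = dotp w u + dotp w v.
Proof. by rewrite dotpC dotpDl !(dotpC w). Qed.

Lemma dotpZr n (c : R) (u v : 'cV[R]_n) : dotp u (c *: v) = c * dotp u v.
Proof. by rewrite dotpC dotpZl dotpC. Qed.

Lemma dotpBr n (u v w : 'cV[R]_n) : dotp w (u - v) = dotp w u - dotp w v.
Proof. by rewrite dotpC dotpBl !(dotpC w). Qed.

Lemma dotp_mx n (u v : 'cV[R]_n) : u^T *m v = (dotp u v)%:M.
Proof.
apply/matrixP => i j; rewrite !ord1 !mxE eqxx mulr1n.
by apply: eq_bigr => k _; rewrite mxE.
Qed.

Lemma dotpM n (g : 'M[R]_n) (u v : 'cV[R]_n) : dotp (g *m u) v = dotp u (g^T *m v).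
Proof.
have : (dotp (g *m u) v)%:M = (dotp u (g^T *m v))%:M :> 'M[R]_1.
  by rewrite -!dotp_mx trmx_mul mulmxA.
by move/(congr1 (fun M : 'M[R]_1 => M 0 0)); rewrite !mxE eqxx !mulr1n.
Qed.

Lemma dotp_fn2 n (u : 'cV[R]_n) : dotp u u = fn2 u.
Proof. by apply: eq_bigr => i _; rewrite big_ord1 expr2. Qed.

Lemma dotp_ge0 n (u : 'cV[R]_n) : 0 <= dotp u u.
Proof. by rewrite dotp_fn2 fn2_ge0. Qed.

Lemma dotp_eq0 n (u : 'cV[R]_n) : dotp u u = 0 -> u = 0.
Proof.
move=> /eqP; rewrite psumr_eq0 => [/allP h|i _]; last by rewrite -expr2 sqr_ge0.
apply/colP => i; have := h i (mem_index_enum _); rewrite -expr2 sqrf_eq0 => /eqP ->.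
by rewrite mxE.
Qed.

Lemma cauchy_schwarz n (u v : 'cV[R]_n) : `|dotp u v| <= fn u * fn v.
Proof.
have [v0|vn] := eqVneq (dotp v v) 0.
  rewrite (dotp_eq0 v0) (_ : dotp u 0 = 0) ?normr0 ?mulr_ge0 ?fn_ge0 //.
  by apply: big1 => i _; rewrite mxE mulr0.
have v0 : 0 < dotp v v by rewrite lt_neqAle eq_sym vn dotp_ge0.
have h : dotp u v ^+ 2 <= dotp u u * dotp v v.
  have := dotp_ge0 (dotp v v *: u - dotp u v *: v).
  rewrite !(dotpBl, dotpBr, dotpZl, dotpZr) (dotpC v u) => h.
  rewrite -(ler_pM2l v0) -subr_ge0; apply: le_trans h _.
  by rewrite le_eqVlt; apply/orP; left; apply/eqP; ring.
rewrite -(@ler_pXn2r _ 2) ?nnegrE ?mulr_ge0 ?fn_ge0 //.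
by rewrite real_normK ?num_real // exprMn !sqr_sqrtr ?fn2_ge0 // -!dotp_fn2.
Qed.

(** Reflection in the hyperplane orthogonal to [w = v - |v| e], which sends [v] to [|v| e]; if
    [w = 0] the identity does. *)
Lemma householder n (v : 'cV[R]_n.+1) : exists2 o : 'M[R]_n.+1, orth o &
  forall i, i != 0 -> (o *m v) i 0 = 0.
Proof.
pose a := fn v; pose e : 'cV[R]_n.+1 := delta_mx 0 0; pose w := v - a *: e.
pose q := dotp w w.
have aa : a * a = dotp v v by rewrite dotp_fn2 -expr2 sqr_sqrtr ?fn2_ge0.
have ee : dotp e e = 1.
  rewrite /dotp (bigD1 0) //= big1 ?addr0 ?mxE ?eqxx ?mulr1 // => i i0.
  by rewrite !mxE (negPf i0) mul0r.
have [q0|qn] := eqVneq q 0.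
  exists 1%:M; first exact: orth1.
  move=> i i0; rewrite mul1mx; have := dotp_eq0 q0 => /(congr1 (fun u : 'cV[R]_n.+1 => u i 0)).
  by rewrite !mxE (negPf i0) mulr0 subr0.
have qE : q = 2 * dotp w v.
  rewrite /q {2}/w dotpBr dotpZr.
  have : dotp w e * a = dotp v e * a - dotp v v.
    by rewrite /w dotpBl dotpZl ee mulr1 mulrBl aa.
  have -> : dotp w v = dotp v v - a * dotp v e.
    by rewrite /w dotpBl dotpZl (dotpC e).
  rewrite mulrC => ->; ring.
pose o : 'M[R]_n.+1 := 1%:M - (2 / q) *: (w *m w^T).
have ww : w *m w^T *m (w *m w^T) = q *: (w *m w^T).
  by rewrite mulmxA -(mulmxA w) dotp_mx -/q mul_mx_scalar -scalemxAl.
exists o; rewrite /orth.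
  have -> : o^T = o.
    apply/matrixP => i k; rewrite !mxE eq_sym; congr (_ - _ * _).
    by apply: eq_bigr => t _; rewrite !mxE mulrC.
  rewrite /o; move: (w *m w^T) ww => W ww.
  rewrite mulmxBr !mulmxBl !mulmx1 mul1mx -scalemxAl -scalemxAr ww !scalerA.
  by apply/matrixP => i j; rewrite !mxE; field.
move=> i i0.
have -> : o *m v = v - w.
  rewrite /o mulmxBl mul1mx -scalemxAl -mulmxA dotp_mx mul_mx_scalar scalerA.
  congr (_ - _); rewrite (_ : 2 / q * dotp w v = 1) ?scale1r // qE.
  by field; apply: contra qn => /eqP h; rewrite qE h mulr0.
by rewrite /w !mxE (negPf i0) mulr0 subr0 subrr.
Qed.

Lemma ex_triang n m (A : 'M[R]_(n, m)) : exists2 o : 'M[R]_n, orth o &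
  forall (i : 'I_n) (k : 'I_m), (k < i)%N -> (o *m A) i k = 0.
Proof.
elim: n m A => [|n IH] [|m] A.
- by exists 1%:M; [exact: orth1 | case].
- by exists 1%:M; [exact: orth1 | case].
- by exists 1%:M; [exact: orth1 | move=> i []].
have [o1 oo1 h1] := householder (col 0 A).
pose B : 'M[R]_(1 + n, 1 + m) := o1 *m A.
have [o2 oo2 h2] := IH m (drsubmx B).
pose o2' : 'M[R]_(1 + n) := block_mx 1%:M 0 0 o2.
have oo2' : orth o2'.
  rewrite /orth /o2' tr_block_mx mulmx_block !trmx0 trmx1.
  by rewrite !mulmx0 !mul0mx !addr0 !add0r mulmx1 oo2 -scalar_mx_block.
exists (o2' *m o1); first exact: orthM.
have Bd : dlsubmx B = 0.
  apply/matrixP => i k; rewrite !mxE.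
  have i0 : rshift 1 i != 0 :> 'I_n.+1 by [].
  have := h1 _ i0; rewrite !mxE => h; rewrite -[RHS]h.
  by apply: eq_bigr => j _; rewrite mxE; congr (_ * A _ _); apply: val_inj; rewrite /= ord1.
have E : o2' *m B = block_mx (ulsubmx B) (ursubmx B) 0 (o2 *m drsubmx B).
  rewrite -{1}[B]submxK Bd /o2' mulmx_block.
  by rewrite !mul1mx !mulmx0 !mul0mx !addr0 add0r.
move=> i k ki; rewrite -mulmxA -/B; have -> : o2' *m B = _ := E.
case: (splitP (i : 'I_(1 + n))) => [i' ii'|i' ii']; first by move: ki; rewrite ii' ord1.
have -> : i = rshift 1 i' by apply: val_inj.
case: (splitP (k : 'I_(1 + m))) => [k' kk'|k' kk'].
  have -> : k = lshift m k' by apply: val_inj.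
  by apply: etrans (block_mxEdl _ _ _ _ i' k') _; rewrite mxE.
have -> : k = rshift 1 k' by apply: val_inj.
apply: etrans (block_mxEdr _ _ _ _ i' k') _; rewrite h2 //; move: ki; rewrite ii' kk'; lia.
Qed.

Lemma ex_qr_top j l (A : 'M[R]_(j + l, j)) : exists o r,
  orth o /\ A = o *m col_mx r 0.
Proof.
have [o oo h] := ex_triang A.
exists o^T, (usubmx (o *m A)); split; first exact: orthT.
have -> : col_mx (usubmx (o *m A)) 0 = o *m A.
  rewrite -[RHS]vsubmxK; congr col_mx; apply/matrixP => i k.
  by rewrite !mxE; have := h (rshift j i) k; rewrite mxE => ->//=; rewrite ltn_addr.
by rewrite mulmxA orthTl // mul1mx.
Qed.

(** Triangularization followed by reversal of the coordinates, which moves the zero rows to the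
    top. *)
Lemma ex_qr_bot j l (B : 'M[R]_(j + l, l)) : exists o r,
  orth o /\ B = o *m col_mx 0 r.
Proof.
pose J : 'M[R]_(j + l) := \matrix_(i, k) (i == rev_ord k)%:R.
have JM m (M : 'M[R]_(j + l, m)) i k : (J *m M) i k = M (rev_ord i) k.
  rewrite mxE (bigD1 (rev_ord i)) //= mxE rev_ordK eqxx mul1r big1 ?addr0 // => q qk.
  by rewrite mxE -(inj_eq rev_ord_inj) rev_ordK eq_sym (negPf qk) mul0r.
have oJ : orth J.
  rewrite /orth; have -> : J^T = J.
    by apply/matrixP => i k; rewrite !mxE -(inj_eq rev_ord_inj) rev_ordK eq_sym.
  by apply/matrixP => i k; rewrite JM !mxE (inj_eq rev_ord_inj).
have [o oo h] := ex_triang B.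
exists (J *m o)^T, (dsubmx (J *m o *m B)); split; first exact/orthT/orthM.
have -> : col_mx 0 (dsubmx (J *m o *m B)) = J *m o *m B.
  rewrite -[RHS]vsubmxK; congr col_mx; apply/matrixP => i k.
  rewrite [RHS]mxE -mulmxA JM h ?mxE //=.
  by have := ltn_ord i; have := ltn_ord k; lia.
by rewrite mulmxA orthTl ?mul1mx //; exact: orthM.
Qed.

End Triangular.

(** * Polynomial kernels on the orthogonal group *)

Section Interpolation.
Variables (R : realType) (T : Type) (t0 : T) (I : eqType) (e : I -> T -> R).

Definition span (s : seq I) (f : T -> R) :=
  exists c : I -> R, forall t, f t = \sum_(i <- s) c i * e i t.

Lemma span_lin s (a b : R) f h : span s f -> span s h ->
  span s (fun t => a * f t + b * h t).
Proof.
move=> [c cf] [c' ch]; exists (fun i => a * c i + b * c' i) => t.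
by rewrite cf ch !mulr_sumr -big_split; apply: eq_bigr => i _ /=; ring.
Qed.

Lemma span_sum s (r : nat) (a : nat -> R) (u : nat -> T -> R) :
  (forall k, span s (u k)) -> span s (fun t => \sum_(k < r) a k * u k t).
Proof.
move=> su; elim: r => [|r [c IH]].
  by exists (fun=> 0) => t; rewrite big_ord0 big1 // => i _; rewrite mul0r.
have [c' h'] := span_lin 1 (a r) (ex_intro _ c IH) (su r).
by exists c' => t; rewrite big_ord_recr /= -h' mul1r.
Qed.

Lemma span_cons i s f : i \notin s -> span s f -> span (i :: s) f.
Proof.
move=> nis [c cf]; exists (fun k => if k == i then 0 else c k) => t.
rewrite big_cons eqxx mul0r add0r cf; apply: eq_big_seq => k ks.
by case: eqP => // ki; rewrite -ki ks in nis.
Qed.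

(** A finite-dimensional function space has nodes [x k] and dual functions [u k]. When a generator
    is added, its residual [e'] either vanishes or is nonzero at some [t1]; that point becomes a new
    node, and the old [u k] are corrected to vanish there. *)
Lemma interpolation (s : seq I) : uniq s -> exists (r : nat) (x : nat -> T) (u : nat -> T -> R),
  (forall k, span s (u k)) /\
  forall f, span s f -> forall t, f t = \sum_(k < r) f (x k) * u k t.
Proof.
elim: s => [|i s IH] /=.
  move=> _; exists 0%N, (fun=> t0), (fun _ _ => 0); split.
    by move=> k; exists (fun=> 0) => t; rewrite big_nil.
  by move=> f [c cf] t; rewrite cf big_nil big_ord0.
move=> /andP[nis us]; have [r [x [u [su H]]]] := IH us.
pose e' t := e i t - \sum_(k < r) e i (x k) * u k t.
have se : span (i :: s) (e i).
  exists (fun k => if k == i then 1 else 0) => t.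
  rewrite big_cons eqxx mul1r big_seq big1 ?addr0 // => k ks.
  by case: eqP => [ki|_]; [rewrite -ki ks in nis | rewrite mul0r].
have su' k : span (i :: s) (u k) by apply: span_cons.
have se' : span (i :: s) e'.
  have [c h] := span_lin 1 (-1) se (span_sum r (fun k => e i (x k)) su').
  by exists c => t; rewrite -h /e' mul1r mulN1r.
have dec f : span (i :: s) f -> exists c f0, span s f0 /\ forall t, f t = c * e i t + f0 t.
  move=> [c cf]; exists (c i), (fun t => \sum_(k <- s) c k * e k t); split.
    by exists c.
  by move=> t; rewrite cf big_cons.
have [e0|] := pselect (forall t, e' t = 0).
  exists r, x, u; split=> // f /dec[c [f0 [sf0 fE]]] t.
  under eq_bigr do rewrite fE mulrDl.
  rewrite big_split /= -(H _ sf0) fE; congr (_ + _).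
  under eq_bigr do rewrite -mulrA; rewrite -mulr_sumr; congr (_ * _).
  by have /eqP := e0 t; rewrite subr_eq0 => /eqP.
move=> /existsNP[t1 /eqP e1].
pose un t := (e' t1)^-1 * e' t.
pose u' k t := if k == r then un t else u k t - u k t1 * un t.
pose x' k := if k == r then t1 else x k.
have sun : span (i :: s) un.
  have [c h] := span_lin (e' t1)^-1 0 se' se'.
  by exists c => t; rewrite -h mul0r addr0.
exists r.+1, x', u'; split.
  move=> k; rewrite /u'; case: (k == r) => //.
  have [c h] := span_lin 1 (- u k t1) (su' k) sun.
  by exists c => t; rewrite -h mul1r mulNr.
move=> f /dec[c [f0 [sf0 fE]]] t.
rewrite big_ord_recr /= /x' /u' eqxx.
have -> : \sum_(k < r) f (if k == r :> nat then t1 else x k) *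
      (if k == r :> nat then un t else u k t - u k t1 * un t) =
    \sum_(k < r) f (x k) * u k t - (\sum_(k < r) f (x k) * u k t1) * un t.
  rewrite mulr_suml -sumrB; apply: eq_bigr => k _.
  by rewrite ltn_eqF // mulrBr mulrA.
have S t' : \sum_(k < r) f (x k) * u k t' = c * (e i t' - e' t') + f0 t'.
  under eq_bigr do rewrite fE mulrDl.
  rewrite big_split /= -(H _ sf0); congr (_ + _).
  under eq_bigr do rewrite -mulrA; rewrite -mulr_sumr; congr (_ * _).
  by rewrite /e' subKr.
rewrite !S !fE /un; field; exact: e1.
Qed.

End Interpolation.

Lemma lipschitz_det (R : realType) n m (F : 'I_m -> 'I_m -> 'M[R]_n -> R) :
  (forall i k, lipschitz (F i k)) -> lipschitz (fun g => \det (\matrix_(i, k) F i k g)).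
Proof.
move=> lF; rewrite /determinant; apply: lipschitz_sum => s; apply: lipschitzM.
  exact: lip_cst.
apply: (@lipschitz_prod _ _ _ _ (fun i g => (\matrix_(i, k) F i k g) i (s i))) => i.
have [L L0 l] := lF i (s i); exists L => // x y ox oy; rewrite !mxE; exact: l.
Qed.

(** * Concentration of powers of a function at its maximum *)

Section Peak.
Variables (R : realType) (n : nat).

Lemma peak (phi : 'M[R]_n -> R) (M del eta B : R) : lipschitz phi ->
  (forall g, orth g -> 0 <= phi g) -> (forall g, orth g -> phi g <= M) ->
  phi 1%:M = M -> 0 < M -> 0 < del -> 0 < eta -> 0 <= B ->
  exists N, 0 < haar (fun g => phi g ^+ N) /\ forall psi, lipschitz psi ->
    (forall g, orth g -> M - del < phi g -> `|psi g| <= eta / 2) ->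
    (forall g, orth g -> `|psi g| <= B) ->
    `|haar (fun g => phi g ^+ N * psi g)| <= eta * haar (fun g => phi g ^+ N).
Proof.
move=> lphi phi0 phiM phi1 M0 del0 eta0 B0.
(* Off the peak [phi <= M1]; the level [M2], strictly between [M1] and [M], bounds the total mass
   from below, and [(M1 / M2)^N] tends to 0. *)
pose M1 := Num.max (M - del) 0; pose M2 := (M1 + M) / 2.
have M10 : 0 <= M1 by rewrite le_max lexx orbT.
have M1M : M1 < M by rewrite gt_max M0 andbT; lra.
have M12 : M1 < M2 by rewrite /M2; lra.
have M2M : M2 < M by rewrite /M2; lra.
have M20 : 0 < M2 by rewrite (le_lt_trans M10).
(* Positive part of [phi - M2], scaled to be 1 at the identity: a Lipschitz substitute for the
   indicator of [phi > M2]. *)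
pose b g : R := (M - M2)^-1 / 2 * (`|phi g - M2| + (phi g - M2)).
have D0 : 0 < M - M2 by lra.
have lb : lipschitz b.
  apply: lipschitzZ; apply: lipschitzD; [apply: lipschitz_norm|];
    by apply: lipschitzB => //; exact: lip_cst.
have i0 : 0 < (M - M2)^-1 / 2 by rewrite divr_gt0 ?invr_gt0.
have b0 g : orth g -> 0 <= b g.
  move=> og; rewrite /b mulr_ge0 // ?(ltW i0) //.
  by rewrite -lerBlDr sub0r -normrN ler_norm.
have c0 : 0 < haar b.
  apply: haar_gt0 => //; rewrite /b phi1 ger0_norm ?(ltW D0) //.
  by rewrite mulr_gt0 // addr_gt0.
have bN N g : orth g -> M2 ^+ N * b g <= phi g ^+ N.
  move=> og; have p0 := phi0 g og.
  have [le|lt] := leP (phi g) M2.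
    by rewrite /b ler0_norm ?subr_le0 // addNr mulr0 mulr0 exprn_ge0.
  apply: (@le_trans _ _ (M2 ^+ N * 1)); last by rewrite mulr1 lerXn2r ?nnegrE // ltW.
  apply: ler_wpM2l; first by rewrite exprn_ge0 // ltW.
  rewrite /b ger0_norm; last by rewrite subr_ge0 ltW.
  have -> : (M - M2)^-1 / 2 * (phi g - M2 + (phi g - M2)) = (phi g - M2) / (M - M2).
    by field; rewrite gt_eqF.
  by rewrite ler_pdivrMr // mul1r lerD2r phiM.
have B1 : 0 < B + 1 by lra.
have q1 : M1 / M2 < 1 by rewrite ltr_pdivrMr // mul1r.
have [N hN] := expr_lt_small (divr_ge0 M10 (ltW M20)) q1
   (divr_gt0 (mulr_gt0 (divr_gt0 eta0 (ltr0Sn R 1)) c0) B1).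
have lN := lipschitzX N lphi.
have hB : M2 ^+ N * haar b <= haar (fun g => phi g ^+ N).
  by rewrite -haarZ //; apply: haar_le => //; [exact: lipschitzZ | exact: bN].
exists N; split.
  by apply: lt_le_trans hB; rewrite mulr_gt0 // exprn_gt0.
move=> psi lpsi psi1 psi2.
have lP := lipschitzM lN lpsi.
have e2 : 0 < eta / 2 by rewrite divr_gt0.
have bd g : orth g -> `|phi g ^+ N * psi g| <= eta / 2 * phi g ^+ N + M1 ^+ N * B.
  move=> og; have P0 : 0 <= phi g ^+ N by rewrite exprn_ge0 // phi0.
  have MN : 0 <= M1 ^+ N by rewrite exprn_ge0.
  rewrite normrM (ger0_norm P0); have [lt|le] := ltP (M - del) (phi g).
    have := ler_wpM2l P0 (psi1 g og lt); have := mulr_ge0 MN B0; lra.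
  have h2 : phi g ^+ N <= M1 ^+ N.
    by rewrite lerXn2r ?nnegrE ?phi0 // le_max le.
  apply: le_trans (ler_pM P0 (normr_ge0 _) h2 (psi2 g og)) _.
  by rewrite lerDr mulr_ge0 // ltW.
have lR : lipschitz (fun g => eta / 2 * phi g ^+ N + M1 ^+ N * B).
  by apply: lipschitzD; [exact: lipschitzZ | exact: lip_cst].
have HR : haar (fun g => eta / 2 * phi g ^+ N + M1 ^+ N * B) <=
    eta * haar (fun g => phi g ^+ N).
  rewrite haar_lin //; last exact: lip_cst.
  rewrite haar_cst.
  have : M1 ^+ N * B <= eta / 2 * (M2 ^+ N * haar b).
    have -> : M1 ^+ N = (M1 / M2) ^+ N * M2 ^+ N.
      by rewrite expr_div_n divfK // expf_neq0 // gt_eqF.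
    have MN : 0 <= M2 ^+ N by rewrite exprn_ge0 // ltW.
    rewrite mulrAC [X in _ <= X]mulrCA [X in _ <= X]mulrC; apply: ler_wpM2r => //.
    apply: (@le_trans _ _ (eta / 2 * haar b / (B + 1) * B)).
      by rewrite ler_wpM2r.
    rewrite mulrAC ler_pdivrMr // ler_wpM2l //; last by lra.
    by rewrite mulr_ge0 // ltW.
  have := ler_wpM2l (ltW e2) hB; lra.
rewrite ler_norml; apply/andP; split; last first.
  apply: le_trans HR; apply: haar_le => // g /bd; rewrite ler_norml => /andP[_]; exact.
rewrite lerNl -[X in X <= _]mulN1r -(haarZ (-1) lP); apply: le_trans HR; apply: haar_le => //.
  exact: lipschitzZ.
by move=> g /bd; rewrite ler_norml mulN1r => /andP[h _]; rewrite lerNl.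
Qed.

End Peak.

Section Kernel.
Variables (R : realType) (j l : nat).
Notation n := (j + l)%N.
Implicit Types (g x y : 'M[R]_n).

Definition minor g : R := `|\det (ulsubmx g)|.

Lemma lipschitz_minor : lipschitz minor.
Proof.
apply: lipschitz_norm.
have [L L0 h] := @lipschitz_det R n j (fun i k g => g (lshift l i) (lshift l k))
  (fun i k => lipschitz_entry _ _ _).
exists L => // x y ox oy.
suff E g : ulsubmx g = \matrix_(i, k) g (lshift l i) (lshift l k) by rewrite !E; exact: h.
by apply/matrixP => i k; rewrite !mxE.
Qed.

Lemma minorT g : minor g^T = minor g.
Proof. by rewrite /minor -trmx_ulsub det_tr. Qed.

(** Jacobi's identity for complementary minors: with [M] made of the top rows of [g] above [(0, 1)],
    the product [M g^T] is block lower triangular. Thereby volumes of projections to the last [l]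
    coordinates are read off the same kernel [minor]. *)
Lemma minor_dr g : orth g -> minor g = `|\det (drsubmx g)|.
Proof.
move=> og; have ng : `|\det g| = 1.
  have := congr1 determinant og; rewrite det_mulmx det_tr det1 => /eqP.
  rewrite -expr2 sqrf_eq1 => /orP[/eqP ->|/eqP ->]; rewrite ?normrN ?normr1 //.
pose M := block_mx (ulsubmx g) (ursubmx g) 0 (1%:M : 'M[R]_l).
have := og; rewrite /orth -{1 2}[g]submxK tr_block_mx mulmx_block scalar_mx_block.
move=> /eq_block_mx[h1 h2 h3 h4].
have E : M *m g^T = block_mx 1%:M 0 (ursubmx g)^T (drsubmx g)^T.
  rewrite /M -{3}[g]submxK tr_block_mx mulmx_block h1 h2.
  by rewrite !mul0mx !add0r !mul1mx.
have := congr1 (fun X => `|\det X|) E.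
by rewrite det_mulmx normrM det_tr ng mulr1 det_ublock det_lblock !det1 mulr1 mul1r det_tr.
Qed.

Definition bump N g : R := (n%:R + \tr g) ^+ N.

(** A factor of the expanded power is either an entry of [g] or the constant. *)
Let cidx : finType := ('I_n * 'I_n + unit)%type.

Definition coordf (c : cidx) g : R := if c is inl p then g p.1 p.2 else 1.

Definition monof N (al : {ffun 'I_N -> cidx}) g : R := \prod_(i < N) coordf (al i) g.

Lemma lipschitz_monof N (al : {ffun 'I_N -> cidx}) : lipschitz (monof al).
Proof.
apply: (@lipschitz_prod _ _ _ _ (fun i => coordf (al i))) => i.
by case: (al i) => [p|t] /=; [exact: lipschitz_entry | exact: lip_cst].
Qed.

Lemma bump_expand N y : exists c : {ffun 'I_N -> cidx} -> R,
  forall g, bump N (y *m g) = \sum_al c al * monof al g.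
Proof.
pose a (c : cidx) : R := if c is inl p then y p.2 p.1 else n%:R.
exists (fun al : {ffun 'I_N -> cidx} => \prod_i a (al i)) => g.
have -> : bump N (y *m g) = \prod_(i < N) \sum_(c : cidx) a c * coordf c g.
  rewrite prodr_const card_ord /bump; congr (_ ^+ _).
  rewrite big_sumType /= (big_pred1 tt) ?mulr1 => [|[] //]; rewrite addrC; congr (_ + _).
  have -> : \tr (y *m g) = \sum_i \sum_k y i k * g k i.
    by apply: eq_bigr => i _; rewrite mxE.
  by rewrite exchange_big pair_big.
rewrite bigA_distr_bigA; apply: eq_bigr => al _ /=.
by rewrite /monof -big_split.
Qed.

Lemma bumpC N g x : bump N (g *m x) = bump N (x *m g).
Proof. by rewrite /bump mxtrace_mulC. Qed.

Lemma bumpT N g : bump N g^T = bump N g.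
Proof. by rewrite /bump mxtrace_tr. Qed.

Lemma lipschitz_bump N : lipschitz (bump N).
Proof.
apply: lipschitzX; apply: lipschitzD; first exact: lip_cst.
apply: (@lipschitz_sum _ _ _ _ (fun i g => g i i)) => i; exact: lipschitz_entry.
Qed.

Lemma lipschitz_comb N (s : {ffun 'I_N -> cidx} -> R) :
  lipschitz (fun g => \sum_al s al * monof al g).
Proof.
apply: (@lipschitz_sum _ _ _ _ (fun al g => s al * monof al g)) => al.
by apply: lipschitzZ; exact: lipschitz_monof.
Qed.

(* Both partial functions of (x, y) |-> H[bump(g) F(y g x)] range over fixed
   finite-dimensional spaces, because translates of [bump] do. *)
Lemma kernel_factor N (F : 'M[R]_n -> R) : lipschitz F ->
  exists (r : nat) (q q' : nat -> 'M[R]_n -> R),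
  [/\ forall k, lipschitz (q k), forall k, lipschitz (q' k) &
  forall x y, orth x -> orth y ->
    haar (fun g => bump N g * F (y *m g *m x)) =
    \sum_(k < r) haar (fun g => q k g * F (g *m x)) * haar (fun g => q' k g * F (y *m g))].
Proof.
move=> lF.
pose T := {x : 'M[R]_n | orth x}.
pose t0 : T := exist _ 1%:M (@orth1 R n).
pose e (al : {ffun 'I_N -> cidx}) (t : T) := haar (fun g => monof al g * F (g *m sval t)).
have [r [x [u [su H]]]] := interpolation t0 e (enum_uniq {: {ffun 'I_N -> cidx}}).
have lx (t : T) : lipschitz (fun g => F (g *m sval t)) by apply: lipschitzMr (svalP t) lF.
have ly y : orth y -> lipschitz (fun g => F (y *m g)) by move=> oy; apply: lipschitzMl oy lF.
have lxy (t : T) y : orth y -> lipschitz (fun g => bump N g * F (y *m g *m sval t)).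
  move=> oy; apply: lipschitzM; first exact: lipschitz_bump.
  by apply: (lipschitzMl oy (lx t)).
have [s sE] : exists s, forall k t, u k t = \sum_al s k al * e al t.
  have := fun k => cid (su k) => c.
  exists (fun k => sval (c k)) => k t; rewrite (svalP (c k)) big_enum /=.
  by apply: eq_bigr.
(* [q k] represents the dual function [u k]; [q' k] comes from the slice at the node [x k], which
   right invariance shifts from [F] to [bump]. *)
exists r, (fun k g => \sum_al s k al * monof al g), (fun k g => bump N (g *m (sval (x k))^T)); split.
- by move=> k; exact: lipschitz_comb.
- move=> k; apply: (lipschitzMr (orthT (svalP (x k)))); exact: lipschitz_bump.
move=> x1 y ox oy.
pose P (t : T) := haar (fun g => bump N g * F (y *m g *m sval t)).
have sP : span e (enum {: {ffun 'I_N -> cidx}}) P.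
  have [c cE] := bump_expand N y^T; exists c => t.
  rewrite /P -(haar_Ml (lxy t y oy) (orthT oy)) big_enum /= /e.
  transitivity (haar (fun g => \sum_al c al * (monof al g * F (g *m sval t)))).
    apply: haar_eq.
    - exact: (lipschitzMl (orthT oy) (lxy t y oy)).
    - apply: lipschitz_sum => al; apply: lipschitzZ; apply: lipschitzM (lx t).
      exact: lipschitz_monof.
    move=> g og; rewrite cE !mulmxA oy mul1mx mulr_suml.
    by apply: eq_bigr => al _; rewrite mulrA.
  rewrite haar_sum; last first.
    move=> al; apply: lipschitzZ; apply: lipschitzM (lx t); exact: lipschitz_monof.
  apply: eq_bigr => al _; rewrite haarZ //; apply: lipschitzM (lx t); exact: lipschitz_monof.
have := H P sP (exist _ x1 ox); rewrite {1}/P /= => ->; apply: eq_bigr => k _.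
rewrite mulrC; congr (_ * _).
  rewrite sE /e /=.
  rewrite -[RHS](@haar_eq _ _ (fun g => \sum_al s k al * (monof al g * F (g *m x1)))).
  - rewrite haar_sum; last first.
      move=> al; apply: lipschitzZ; apply: lipschitzM (lx (exist _ x1 ox)); exact: lipschitz_monof.
    apply: eq_bigr => al _; rewrite haarZ //; apply: lipschitzM (lx (exist _ x1 ox)); exact: lipschitz_monof.
  - apply: lipschitz_sum => al; apply: lipschitzZ.
    apply: lipschitzM (lx (exist _ x1 ox)); exact: lipschitz_monof.
  - by apply: lipschitzM (lx (exist _ x1 ox)); exact: lipschitz_comb.
  - by move=> g og; rewrite mulr_suml; apply: eq_bigr => al _; rewrite mulrA.
rewrite /P -(haar_Mr (lxy (x k) y oy) (orthT (svalP (x k)))); apply: haar_eq.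
- exact: (lipschitzMr (orthT (svalP (x k))) (lxy (x k) y oy)).
- apply: lipschitzM (ly y oy); apply: (lipschitzMr (orthT (svalP (x k)))).
  exact: lipschitz_bump.
- move=> g og; rewrite !mulmxA -(mulmxA (y *m g)) (orthTl (svalP (x k))) mulmx1 //.
Qed.

(** The base of [bump] falls short of its maximum [2 n] by half the squared distance to the
    identity, so its powers concentrate there. *)
Lemma bump1E g : orth g -> n%:R + \tr g = 2 * n%:R - fn2 (g - 1%:M) / 2 :> R.
Proof.
move=> og; rewrite fn2_tr linearB /= trmx1 mulmxBl !mulmxBr mulmx1 mul1mx mulmx1 og.
rewrite !linearB /= mxtrace1 mxtrace_tr natrD; lra.
Qed.

Lemma bump1_ge0 g : orth g -> 0 <= n%:R + \tr g :> R.
Proof.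
move=> og; have -> : n%:R = \sum_(i < n) (1 : R) by rewrite sumr_const card_ord.
rewrite /mxtrace -big_split; apply: sumr_ge0 => i _ /=.
by have := orth_entry i i og; rewrite ler_norml => /andP[]; lra.
Qed.

(** [N] depends on [L] and [eta] alone, so one kernel smooths a support function at all directions
    simultaneously. *)
Lemma bump_peak (L eta : R) : (0 < n)%N -> 0 <= L -> 0 < eta ->
  exists N, 0 < haar (bump N) /\ forall f, lip L f ->
    `|haar (fun g => bump N g * f g) - f 1%:M * haar (bump N)| <= eta * haar (bump N).
Proof.
move=> n0 L0 eta0.
pose rho := eta / (2 * (L + 1)).
have rho0 : 0 < rho by rewrite divr_gt0 // mulr_gt0 //; lra.
have Lrho : L * rho <= eta / 2 by exact: ler_half_ratio (ltW eta0).
have n1 : 1 <= n%:R :> R by rewrite ler1n.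
have r2 : 0 < rho ^+ 2 by rewrite exprn_gt0.
pose phi g : R := n%:R + \tr g.
have lphi : lipschitz phi.
  apply: lipschitzD; first exact: lip_cst.
  apply: (@lipschitz_sum _ _ _ _ (fun i g => g i i)) => i; exact: lipschitz_entry.
have phi2 g : orth g -> phi g <= 2 * n%:R.
  by move=> og; rewrite /phi bump1E // gerBl divr_ge0 // fn2_ge0.
have phi1 : phi 1%:M = 2 * n%:R by rewrite /phi mxtrace1; ring.
have M0 : 0 < 2 * n%:R :> R by lra.
have del0 : 0 < rho ^+ 2 / 2 by rewrite divr_gt0.
have Ld : 0 <= L * diam R n by rewrite !mulr_ge0.
have [N [N0 HN]] := peak lphi (fun g og => bump1_ge0 og) phi2 phi1 M0 del0 eta0 Ld.
exists N; split=> // f fL.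
have lf : lipschitz f by exists L.
have lN := lipschitz_bump N.
have -> : haar (fun g => bump N g * f g) - f 1%:M * haar (bump N) =
    haar (fun g => bump N g * (f g - f 1%:M)).
  have lA := lipschitzM lN lf; have lB := lipschitzZ (f 1%:M) lN.
  rewrite -haarZ // -haarB //; apply: haar_eq => //; first exact: lipschitzB lA lB.
    by apply: lipschitzM => //; apply: lipschitzB => //; exact: lip_cst.
  by move=> g _; ring.
apply: HN.
- by apply: lipschitzB => //; exact: lip_cst.
- move=> g og; rewrite /phi bump1E // ltrD2l ltrN2 ltr_pM2r ?invr_gt0 // => h.
  apply: le_trans (fL g 1%:M og (@orth1 _ _)) _; apply: le_trans Lrho.
  rewrite ler_wpM2l // ltW // -(@ltr_pXn2r _ 2) ?nnegrE ?fn_ge0 ?(ltW rho0) //.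
  by rewrite sqr_sqrtr ?fn2_ge0.
- move=> g og; apply: le_trans (fL g 1%:M og (@orth1 _ _)) _.
  by rewrite ler_wpM2l // orth_dist //; exact: orth1.
Qed.

End Kernel.

(** * Density of cosine transforms on the sphere *)

Notation cRe := (@complex.Re _).
Notation cIm := (@complex.Im _).

Section ComplexPowers.
Variable R : realType.
Implicit Types (u v w : R[i]).

Lemma cReM u v : cRe (u * v) = cRe u * cRe v - cIm u * cIm v.
Proof. by case: u v => [a b] [c d]. Qed.

Lemma cImM u v : cIm (u * v) = cRe u * cIm v + cIm u * cRe v.
Proof. by case: u v => [a b] [c d] /=; rewrite addrC. Qed.

Lemma cReD u v : cRe (u + v) = cRe u + cRe v.
Proof. by case: u v => [a b] [c d]. Qed.

Lemma cReC (a : R) u : cRe (a%:C%C * u) = a * cRe u.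
Proof. by case: u => [c d] /=; rewrite mul0r subr0. Qed.

Lemma cReJ u : cRe (u^*)%C = cRe u. Proof. by case: u. Qed.

Lemma cImJ u : cIm (u^*)%C = - cIm u. Proof. by case: u. Qed.

Lemma cconjM u v : ((u * v)^*)%C = (u^*)%C * (v^*)%C.
Proof. exact: rmorphM. Qed.

Lemma cRe_pow_expand u (N : nat) :
  2 ^+ N * cRe u ^+ N =
  \sum_(i < N.+1) 'C(N, i)%:R * cRe (u ^+ (N - i) * (u^*)%C ^+ i).
Proof.
have h : (u + (u^*)%C) ^+ N = ((2 * cRe u) ^+ N)%:C%C.
  rewrite addcJ rmorphXn /= rmorphM /=; congr ((_ * _) ^+ _).
  by rewrite rmorph_nat.
have := congr1 (@complex.Re R) h; rewrite exprMn /= => <-; rewrite exprDn.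
rewrite (big_morph (@complex.Re R) cReD (erefl _)); apply: eq_bigr => i _.
by rewrite -mulr_natl -cReC rmorph_nat.
Qed.

(** Chebyshev polynomials of the first kind: [chb m (cos a) = cos (m a)]. *)
Fixpoint chb (m : nat) (c : R) : R :=
  match m with
  | 0 => 1
  | m'.+1 => match m' with 0 => c | m''.+1 => 2 * c * chb m' c - chb m'' c end
  end.

Lemma chb_unit v m : cRe v ^+ 2 + cIm v ^+ 2 = 1 -> cRe (v ^+ m) = chb m (cRe v).
Proof.
move=> v1.
have iv : cIm v ^+ 2 = 1 - cRe v ^+ 2 by move: v1; lra.
have : cRe (v ^+ m) = chb m (cRe v) /\ cRe (v ^+ m.+1) = chb m.+1 (cRe v).
  elim: m => [//|m [IH1 IH2]]; split=> //.
  have h : chb m.+2 (cRe v) = 2 * cRe v * chb m.+1 (cRe v) - chb m (cRe v) by [].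
  rewrite h -IH1 -IH2 (exprS v m.+1) (exprS v m) !cReM !cImM.
  move: iv; rewrite expr2; move: (cRe v) (cIm v) (cRe (v ^+ m)) (cIm (v ^+ m)) => a b c d bb.
  have -> : a * (a * c - b * d) - b * (a * d + b * c) = a * a * c - 2 * a * b * d - b * b * c by ring.
  rewrite bb; ring.
by case.
Qed.

Lemma chb_Re w m : cRe w ^+ 2 + cIm w ^+ 2 = 1 ->
  cRe (w ^+ (2 * m)) = chb m (2 * cRe w ^+ 2 - 1).
Proof.
move=> w1; have iw : cIm w ^+ 2 = 1 - cRe w ^+ 2 by move: w1; lra.
have vE : cRe (w ^+ 2) = 2 * cRe w ^+ 2 - 1 by rewrite {1}expr2 cReM -!expr2 iw; ring.
have vI : cIm (w ^+ 2) = 2 * cRe w * cIm w by rewrite expr2 cImM; ring.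
rewrite exprM chb_unit vE // vI !exprMn iw; ring.
Qed.

(** For [w = e^(i a)] both sides are [cos (2 (k - b) a)]; the sum of the two truncated differences
    is [|k - b|]. *)
Lemma chb_mixed w (k b : nat) : cRe w ^+ 2 + cIm w ^+ 2 = 1 -> (b <= 2 * k)%N ->
  cRe ((w^*)%C ^+ (2 * k - b) * w ^+ b) = chb ((k - b) + (b - k))%N (2 * cRe w ^+ 2 - 1).
Proof.
move=> w1 bk.
have ww : (w^*)%C * w = 1.
  case: w w1 => [x y] /= h; apply/eqP; rewrite eq_complex /=; apply/andP; split; apply/eqP.
    by move: h; lra.
  by ring.
have [le|lt] := leqP b k.
  have -> : (2 * k - b = 2 * (k - b) + b)%N by lia.
  have -> : ((k - b) + (b - k) = k - b)%N by lia.
  by rewrite exprD -mulrA -exprMn ww expr1n mulr1 chb_Re cReJ // cImJ sqrrN.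
have -> : (b = (2 * k - b) + 2 * (b - k))%N by lia.
rewrite exprD mulrA.
have -> : (2 * k - (2 * k - b + 2 * (b - k)) = 2 * k - b)%N by lia.
rewrite -exprMn ww expr1n mul1r chb_Re //; congr chb; lia.
Qed.

Lemma Re_pow_bound (y : R) (m : nat) : `|y| <= 1 ->
  [/\ `|cRe ((1 +i* y)%C ^+ m)| <= 2 ^+ m, `|cIm ((1 +i* y)%C ^+ m)| <= 2 ^+ m &
      1 - `|y| * 2 ^+ m <= cRe ((1 +i* y)%C ^+ m)].
Proof.
move=> y1; elim: m => [|m [h1 h2 h3]].
  by rewrite !expr0 /= normr1 normr0 mulr1; split=> //; rewrite gerBl.
set z := (1 +i* y)%C ^+ m in h1 h2 h3.
rewrite exprS cReM cImM -/z /= !mul1r.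
have p0 : 0 <= 2 ^+ m :> R by rewrite exprn_ge0.
have a1 : `|y * cIm z| <= `|y| * 2 ^+ m by rewrite normrM ler_wpM2l.
have a2 : `|y * cRe z| <= `|y| * 2 ^+ m by rewrite normrM ler_wpM2l.
have a3 : `|y| * 2 ^+ m <= 2 ^+ m by rewrite ler_piMl.
rewrite exprS; split.
- by apply: le_trans (ler_normB _ _) _; lra.
- by apply: le_trans (ler_normD _ _) _; lra.
- by move: a1; rewrite ler_norml => /andP[]; lra.
Qed.

(** Near the real axis an even power keeps a nonnegative real part. The crude slope [2^-(2m)] comes
    from [Re_pow_bound] and reappears as [ep] in [lam_neq0]. *)
Lemma Re_pow_ge0 (m : nat) (x y : R) : `|y| * 2 ^+ (2 * m) <= `|x| ->
  0 <= cRe ((x +i* y)%C ^+ (2 * m)).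
Proof.
move=> yx; have p1 : 1 <= 2 ^+ (2 * m) :> R by rewrite exprn_ege1 // ler1n.
have [x0|xn] := eqVneq x 0.
  have y0 : y = 0.
    apply/eqP; rewrite -normr_le0; move: yx; rewrite x0 normr0.
    by rewrite pmulr_lle0 // (lt_le_trans _ p1).
  rewrite x0 y0; case: m {yx p1} => [|m]; first by rewrite muln0 expr0 /= ler01.
  by rewrite mulnS expr0n.
have -> : (x +i* y)%C = x%:C%C * (1 +i* (y / x))%C.
  by apply/eqP; rewrite eq_complex /= !mul0r mulr1 subr0 addr0 mulrCA mulfV // mulr1 !eqxx.
have xp : 0 < `|x| by rewrite normr_gt0.
have q : `|y / x| * 2 ^+ (2 * m) <= 1.
  by rewrite normrM normfV mulrAC ler_pdivrMr // mul1r.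
have q1 : `|y / x| <= 1 by apply: le_trans q; rewrite ler_peMr.
have [_ _ h] := Re_pow_bound (2 * m) q1.
rewrite exprMn -rmorphXn cReC mulr_ge0 //; last by move: h q; lra.
by rewrite exprM exprn_ge0 // sqr_ge0.
Qed.

End ComplexPowers.

Section Sphere.
Variables (R : realType) (n : nat) (i0 i1 : 'I_n).
Hypotheses (h0 : nat_of_ord i0 = 0%N) (h1 : nat_of_ord i1 = 1%N).
Implicit Types (g : 'M[R]_n) (x y b a : 'cV[R]_n).

Let i01 : i0 != i1. Proof. by rewrite -val_eqE /= h0 h1. Qed.
Let i10 : i1 != i0. Proof. by rewrite eq_sym. Qed.

Definition e0 : 'cV[R]_n := delta_mx i0 0.
Definition e1 : 'cV[R]_n := delta_mx i1 0.

Definition unitv x := dotp x x = 1.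

Lemma dotp_delta k x : dotp (delta_mx k 0) x = x k 0.
Proof.
rewrite /dotp (bigD1 k) //= mxE !eqxx mul1r big1 ?addr0 // => i ik.
by rewrite mxE (negPf ik) mul0r.
Qed.

Lemma unitv_e0 : unitv e0.
Proof. by rewrite /unitv dotp_delta mxE !eqxx. Qed.

Lemma unitvM g x : orth g -> unitv x -> unitv (g *m x).
Proof. by move=> og ux; rewrite /unitv dotpM mulmxA orthTl // mul1mx. Qed.

Lemma fn_unit x : unitv x -> fn x = 1.
Proof. by rewrite /unitv dotp_fn2 /fn => ->; rewrite sqrtr1. Qed.

Lemma dotp_le1 x y : unitv x -> unitv y -> `|dotp x y| <= 1.
Proof.
by move=> ux uy; apply: le_trans (cauchy_schwarz x y) _; rewrite !fn_unit // mulr1.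
Qed.

Lemma fn_col g : fn (g *m e0) <= fn g.
Proof.
rewrite /fn ler_sqrt ?fn2_ge0 //; apply: ler_sum => i _.
rewrite big_ord1 -colE mxE (bigD1 i0) //= lerDl.
by apply: sumr_ge0 => k _; exact: sqr_ge0.
Qed.

Lemma lip_dotp x : unitv x -> lip 1 (fun g => dotp x (g *m e0)).
Proof.
move=> ux g g' og og'; rewrite -dotpBr -mulmxBl mul1r.
apply: le_trans (cauchy_schwarz _ _) _; rewrite fn_unit // mul1r; exact: fn_col.
Qed.

Definition wsum (l : seq (R * 'cV[R]_n)) x := \sum_(p <- l) p.1 * `|dotp x p.2|.

(** Uniform closure, on the unit sphere, of the span of the functions [|<., a>|]. *)
Definition W (f : 'cV[R]_n -> R) := forall eta, 0 < eta ->
  exists l, forall x, unitv x -> `|f x - wsum l x| <= eta.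

Lemma W_abs a : W (fun x => `|dotp x a|).
Proof.
move=> eta eta0; exists [:: (1, a)] => x _.
by rewrite /wsum big_seq1 mul1r subrr normr0 ltW.
Qed.

Lemma W_lim f : (forall eta, 0 < eta -> exists2 f', W f' &
  forall x, unitv x -> `|f x - f' x| <= eta) -> W f.
Proof.
move=> H eta eta0; have e2 : 0 < eta / 2 by rewrite divr_gt0.
have [f' Wf' h] := H _ e2; have [l hl] := Wf' _ e2; exists l => x ux.
have := h x ux; have := hl x ux; rewrite !ler_norml => /andP[? ?] /andP[? ?].
by apply/andP; split; lra.
Qed.

Lemma W_eq f f' : (forall x, unitv x -> f x = f' x) -> W f' -> W f.
Proof.
by move=> E H eta eta0; have [l hl] := H eta eta0; exists l => x ux; rewrite E // hl.
Qed.

Lemma W_lin (c c' : R) f f' : W f -> W f' -> W (fun x => c * f x + c' * f' x).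
Proof.
move=> Wf Wf' eta eta0.
pose C := `|c| + `|c'| + 1.
have C0 : 0 < C by rewrite ltr_wpDl // addr_ge0.
have e2 : 0 < eta / C by rewrite divr_gt0.
have [l hl] := Wf _ e2; have [l' hl'] := Wf' _ e2.
exists ([seq (c * p.1, p.2) | p <- l] ++ [seq (c' * p.1, p.2) | p <- l']) => x ux.
have -> : wsum ([seq (c * p.1, p.2) | p <- l] ++ [seq (c' * p.1, p.2) | p <- l']) x =
    c * wsum l x + c' * wsum l' x.
  rewrite /wsum big_cat !big_map /= !mulr_sumr.
  by congr (_ + _); apply: eq_bigr => p _; rewrite mulrA.
have -> : c * f x + c' * f' x - (c * wsum l x + c' * wsum l' x) =
    c * (f x - wsum l x) + c' * (f' x - wsum l' x) by ring.
apply: le_trans (ler_normD _ _) _; rewrite !normrM.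
have k1 := ler_wpM2l (normr_ge0 c) (hl x ux).
have k2 := ler_wpM2l (normr_ge0 c') (hl' x ux).
apply: le_trans (lerD k1 k2) _; rewrite -mulrDl mulrA ler_pdivrMr //.
by rewrite mulrC ler_pM2l // /C lerDl.
Qed.

Lemma W_sum (I : Type) (r : seq I) (P : pred I) (c : I -> R) (F : I -> 'cV[R]_n -> R) :
  (forall i, P i -> W (F i)) -> W (fun x => \sum_(i <- r | P i) c i * F i x).
Proof.
move=> WF; elim: r => [|i r IH].
  by move=> eta eta0; exists [::] => x _; rewrite /wsum !big_nil subrr normr0 ltW.
case Pi : (P i).
  apply: (W_eq _ (W_lin (c i) 1 (WF i Pi) IH)) => x _.
  by rewrite big_cons Pi mul1r.
by apply: (W_eq _ IH) => x _; rewrite big_cons Pi.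
Qed.

Lemma lipschitz_bounded (f : 'M[R]_n -> R) : lipschitz f ->
  exists2 B, 0 <= B & forall g, orth g -> `|f g| <= B.
Proof.
move=> [L L0 fL]; exists (`|f 1%:M| + L * diam R n); first by rewrite addr_ge0 // !mulr_ge0.
move=> g og; have := fL g _ og (@orth1 _ _).
have := ler_wpM2l L0 (orth_dist og (@orth1 _ _)) => k1 k2.
have := ler_normD (f g - f 1%:M) (f 1%:M); rewrite subrK; lra.
Qed.

(** [haar_riemann] replaces the mean by one finite sum for all [x] at once, because the integrands
    share a Lipschitz constant. *)
Lemma W_haar (c : 'M[R]_n -> R) (Psi : 'M[R]_n -> 'cV[R]_n -> R) (L2 : R) : lipschitz c ->
  0 <= L2 -> (forall x, unitv x -> lip L2 (Psi^~ x)) ->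
  (forall x g, unitv x -> orth g -> `|Psi g x| <= 1) ->
  (forall g, orth g -> W (Psi g)) -> W (fun x => haar (fun g => c g * Psi g x)).
Proof.
move=> lc L20 lP bP WP; have [B B0 cB] := lipschitz_bounded lc; have [L1 L10 cL] := lc.
have lip_cP x : unitv x -> lip (B * L2 + L1) (fun g => c g * Psi g x).
  move=> ux g g' og og'.
  have -> : c g * Psi g x - c g' * Psi g' x =
    c g * (Psi g x - Psi g' x) + Psi g' x * (c g - c g') by ring.
  apply: le_trans (ler_normD _ _) _; rewrite !normrM mulrDl -mulrA.
  apply: lerD; first by apply: ler_pM => //; [exact: cB | exact: lP].
  by rewrite -[X in _ <= X]mul1r; apply: ler_pM => //; [exact: bP | exact: cL].
have BL0 : 0 <= B * L2 + L1 by rewrite addr_ge0 // mulr_ge0.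
apply: W_lim => eta eta0.
have [s [_ sp] Hs] := haar_riemann n eta0 BL0.
exists (fun x => \sum_(p <- s | p \in s) (p.1 * c p.2) * Psi p.2 x).
  by apply: W_sum => p /sp[_ op]; exact: WP.
move=> x ux; rewrite distrC; have := Hs _ (lip_cP x ux) _ (@orth1 _ _).
have -> : avg s (fun g => c g * Psi g x) 1%:M = \sum_(p <- s | p \in s) p.1 * c p.2 * Psi p.2 x.
  by rewrite /avg -big_seq; apply: eq_bigr => p _; rewrite mulmx1 mulrA.
by [].
Qed.

Lemma ler_pow_dist (a b : R) k : `|a| <= 1 -> `|b| <= 1 ->
  `|a ^+ k - b ^+ k| <= k%:R * `|a - b|.
Proof.
move=> a1 b1; elim: k => [|k IH]; first by rewrite subrr normr0 mul0r.
have -> : a ^+ k.+1 - b ^+ k.+1 = a * (a ^+ k - b ^+ k) + (a - b) * b ^+ k.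
  by rewrite !exprS; ring.
apply: le_trans (ler_normD _ _) _; rewrite !normrM -natr1 mulrDl mul1r; apply: lerD.
  by rewrite -[X in _ <= X]mul1r; apply: ler_pM.
by rewrite ler_piMr // normrX exprn_ile1.
Qed.

Definition t0 g := g i0 i0.
Definition s0 g := g i1 i0.
(** Projection of the random unit vector [g e0] to the plane of the first two coordinates, read as a
    complex number. *)
Definition z0 g : R[i] := (t0 g +i* s0 g)%C.

Lemma dotp_e0 g : dotp e0 (g *m e0) = t0 g.
Proof. by rewrite dotp_delta -colE mxE. Qed.

Lemma dotp_e1 g : dotp e1 (g *m e0) = s0 g.
Proof. by rewrite dotp_delta -colE mxE. Qed.

(** Triangularizing the pair [(x, b)] brings both vectors into the plane of [e0] and [e1], with [al]
    a sign; functions of two points are then computed from [z0] alone. *)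
Lemma sphere_frame x b : unitv x -> unitv b -> exists o al rho sig,
  [/\ orth o, al ^+ 2 = 1, rho ^+ 2 + sig ^+ 2 = 1, dotp x b = al * rho &
  o *m x = al *: e0 /\ o *m b = rho *: e0 + sig *: e1].
Proof.
move=> ux ub; have [o oo ht] := ex_triang (row_mx x b).
pose al := (o *m x) i0 0; pose rho := (o *m b) i0 0; pose sig := (o *m b) i1 0.
have ox : o *m x = al *: e0.
  apply/colP => i; rewrite [RHS]mxE [e0 i 0]mxE andbT.
  case: eqP => [->|/eqP ii]; first by rewrite mulr1.
  have := ht i (lshift 1 0); rewrite mul_mx_row row_mxEl => -> ; first by rewrite mulr0.
  by rewrite /= lt0n; apply: contra ii => /eqP h; apply/eqP/val_inj; rewrite /= h h0.
have ob : o *m b = rho *: e0 + sig *: e1.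
  apply/colP => i; rewrite [RHS]mxE [(rho *: e0) i 0]mxE [(sig *: e1) i 0]mxE.
  rewrite [e0 i 0]mxE [e1 i 0]mxE !andbT.
  case: eqP => [->|/eqP ii]; first by rewrite (negPf i01) mulr1 mulr0 addr0.
  case: eqP => [->|/eqP ii']; first by rewrite mulr1 mulr0 add0r.
  have := ht i (rshift 1 0); rewrite mul_mx_row row_mxEr => -> ; first by rewrite !mulr0 addr0.
  rewrite /= addn0; move: ii ii'; rewrite -!val_eqE /= h0 h1; case: (nat_of_ord i) => [|[|m]] //.
have e01 : dotp e0 e1 = 0 by rewrite dotp_delta mxE (negPf i01).
have e11 : dotp e1 e1 = 1 by rewrite dotp_delta mxE !eqxx.
have e00 : dotp e0 e0 = 1 := unitv_e0.
exists o, al, rho, sig; split=> //.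
- have := unitvM oo ux; rewrite ox /unitv dotpZl dotpZr e00 mulr1 => <-.
  by rewrite expr2.
- have := unitvM oo ub; rewrite ob /unitv !(dotpDl, dotpDr, dotpZl, dotpZr).
  by rewrite (dotpC e1 e0) e01 e00 e11 => <-; ring.
have -> : dotp x b = dotp (o *m x) (o *m b) by rewrite dotpM mulmxA orthTl // mul1mx.
by rewrite ox ob dotpZl dotpDr !dotpZr e00 e01 mulr0 addr0 mulr1.
Qed.

Definition plane (a b c d : R) : 'M[R]_n := \matrix_(i, k)
  (if i == i0 then (if k == i0 then a else if k == i1 then b else 0)
   else if i == i1 then (if k == i0 then c else if k == i1 then d else 0)
   else (i == k)%:R).

Lemma plane_mul (a b c d : R) m (X : 'M[R]_(n, m)) i k : (plane a b c d *m X) i k =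
  if i == i0 then a * X i0 k + b * X i1 k
  else if i == i1 then c * X i0 k + d * X i1 k else X i k.
Proof.
rewrite mxE; case: eqP => [->|/eqP ii].
  rewrite (bigD1 i0) //= (bigD1 i1) //= !mxE !eqxx (negPf i10) big1 ?addr0 // => q /andP[q0 q1].
  by rewrite mxE eqxx (negPf q0) (negPf q1) mul0r.
case: eqP => [->|/eqP ii'].
  rewrite (bigD1 i0) //= (bigD1 i1) //= !mxE !eqxx (negPf i10) big1 ?addr0 // => q /andP[q0 q1].
  by rewrite mxE eqxx (negPf i10) (negPf q0) (negPf q1) mul0r.
rewrite (bigD1 i) //= mxE (negPf ii) (negPf ii') eqxx mul1r big1 ?addr0 // => q qi.
by rewrite mxE (negPf ii) (negPf ii') eq_sym (negPf qi) mul0r.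
Qed.

Lemma plane_orth (a b c d : R) : a ^+ 2 + b ^+ 2 = 1 -> c ^+ 2 + d ^+ 2 = 1 ->
  a * c + b * d = 0 -> orth (plane a b c d).
Proof.
move=> e1 e2 e3; apply/matrixP => i k; rewrite plane_mul !mxE !eqxx (negPf i10).
case: (eqVneq i i0) => [->|ni0].
  case: (eqVneq k i0) => [_|nk0]; first by rewrite -!expr2.
  case: (eqVneq k i1) => [_|nk1]; first by rewrite e3.
  by rewrite !mulr0 addr0.
case: (eqVneq i i1) => [->|ni1].
  case: (eqVneq k i0) => [->|nk0]; first by rewrite (negPf i10) mulrC [d * b]mulrC e3.
  case: (eqVneq k i1) => [_|nk1]; first by rewrite -!expr2.
  by rewrite !mulr0 addr0.
case: (eqVneq k i0) => [->|nk0]; first by rewrite (negPf ni0).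
case: (eqVneq k i1) => [->|nk1]; first by rewrite (negPf ni1).
by rewrite eq_sym.
Qed.

Definition lipC (F : 'M[R]_n -> R[i]) :=
  lipschitz (fun g => cRe (F g)) /\ lipschitz (fun g => cIm (F g)).

Lemma lipC_ext F F' : (forall g, F g = F' g) -> lipC F -> lipC F'.
Proof. by move=> E; have -> : F' = F by apply/funext => g. Qed.

Lemma lipC_mul F F' : lipC F -> lipC F' -> lipC (fun g => F g * F' g).
Proof.
move=> [a1 a2] [b1 b2]; split.
  have -> : (fun g => cRe (F g * F' g)) = (fun g => cRe (F g) * cRe (F' g) - cIm (F g) * cIm (F' g)).
    by apply/funext => g; rewrite cReM.
  by apply: lipschitzB; apply: lipschitzM.
have -> : (fun g => cIm (F g * F' g)) = (fun g => cRe (F g) * cIm (F' g) + cIm (F g) * cRe (F' g)).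
  by apply/funext => g; rewrite cImM.
by apply: lipschitzD; apply: lipschitzM.
Qed.

Lemma lipC_cst c : lipC (fun=> c).
Proof. by split; exact: lip_cst. Qed.

Lemma lipC_pow F k : lipC F -> lipC (fun g => F g ^+ k).
Proof.
move=> lF; elim: k => [|k IH]; first exact: lipC_cst.
by apply: lipC_ext (lipC_mul lF IH) => g; rewrite exprS.
Qed.

Lemma lipC_conj F : lipC F -> lipC (fun g => (F g)^*%C).
Proof.
move=> [a1 a2]; split.
  by have -> : (fun g => cRe (F g)^*%C) = (fun g => cRe (F g)) by apply/funext => g; rewrite cReJ.
have -> : (fun g => cIm (F g)^*%C) = (fun g => - cIm (F g)) by apply/funext => g; rewrite cImJ.
exact: lipschitzN.
Qed.

Lemma lipC_z0 : lipC z0.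
Proof. by split; exact: lipschitz_entry. Qed.

Lemma lipC_zz (a b : nat) : lipC (fun g => z0 g ^+ a * (z0 g)^*%C ^+ b).
Proof.
by apply: lipC_mul; apply: lipC_pow; [exact: lipC_z0 | apply: lipC_conj; exact: lipC_z0].
Qed.

Lemma lip_t0 : lipschitz (fun g => `|t0 g|).
Proof. by apply: lipschitz_norm; exact: lipschitz_entry. Qed.

Lemma plane_t0 (a b c d : R) g : t0 (plane a b c d *m g) = a * t0 g + b * s0 g.
Proof. by rewrite /t0 plane_mul eqxx. Qed.

Lemma plane_s0 (a b c d : R) g : s0 (plane a b c d *m g) = c * t0 g + d * s0 g.
Proof. by rewrite /s0 plane_mul eqxx (negPf i10). Qed.

(** Reflecting the coordinate [s0] conjugates [z0] and so changes the sign of the integrand. *)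
Lemma haar_Im0 (a b : nat) : haar (fun g => `|t0 g| * cIm (z0 g ^+ a * (z0 g)^*%C ^+ b)) = 0.
Proof.
set f := fun g => _.
have lf : lipschitz f by apply: lipschitzM lip_t0 _; have [] := lipC_zz a b.
have o : orth (plane 1 0 0 (-1)).
  by apply: plane_orth; rewrite ?expr1n ?expr0n ?sqrrN ?expr1n /= ?addr0 ?add0r // mulr0 mul0r addr0.
have E : haar (fun g => f (plane 1 0 0 (-1) *m g)) = - haar f.
  rewrite -[RHS]mulN1r -haarZ //; apply: haar_eq.
  - exact: lipschitzMl.
  - exact: lipschitzZ.
  move=> g _; rewrite /f plane_t0.
  have -> : z0 (plane 1 0 0 (-1) *m g) = ((z0 g)^*)%C.
    by rewrite /z0 plane_t0 plane_s0 /= mul1r !mul0r addr0 add0r mulN1r.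
  have -> : ((z0 g)^*)%C ^+ a * (((z0 g)^*)^*)%C ^+ b = ((z0 g ^+ a * (z0 g)^*%C ^+ b)^*)%C.
    by rewrite !rmorphM !rmorphXn /=.
  by rewrite cImJ mul1r mul0r addr0 mulrN mulN1r.
have h : - haar f = haar f by rewrite -E; exact: haar_Ml lf o.
by apply/eqP; rewrite -eqNr h.
Qed.

(** For [i = 0] this is the multiplier by which the cosine transform acts on the spherical harmonic
    [Re z0^(2k)]. *)
Definition lam k i := haar (fun g => `|t0 g| * cRe (z0 g ^+ (2 * k - i) * (z0 g)^*%C ^+ i)).

Lemma lip_tre k i : lipschitz (fun g => `|t0 g| * cRe (z0 g ^+ (2 * k - i) * (z0 g)^*%C ^+ i)).
Proof. by apply: lipschitzM lip_t0 _; have [] := lipC_zz (2 * k - i) i. Qed.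

(** A rotation of the coordinate plane turns [|al t0 + be s0|] into [|t0|] and [z0] into its product
    with [al + i be]; the imaginary part drops out by [haar_Im0]. *)
Lemma lam_rot (al be : R) k : al ^+ 2 + be ^+ 2 = 1 ->
  haar (fun g => `|al * t0 g + be * s0 g| * cRe (z0 g ^+ (2 * k))) =
  cRe ((al +i* be)%C ^+ (2 * k)) * lam k 0.
Proof.
move=> ab; set om := (al +i* be)%C.
have o : orth (plane al be (- be) al) by apply: plane_orth; rewrite ?sqrrN //; [rewrite addrC|ring].
have lz : lipC (fun g => z0 g ^+ (2 * k)) by apply: lipC_pow; exact: lipC_z0.
pose f g := `|t0 g| * cRe (om ^+ (2 * k) * z0 g ^+ (2 * k)).
have lf : lipschitz f by apply: lipschitzM lip_t0 _; have [] := lipC_mul (lipC_cst (om ^+ (2 * k))) lz.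
transitivity (haar f).
  rewrite -(haar_Ml lf o); apply: haar_eq.
  - apply: lipschitzM; last by have [] := lz.
    apply: lipschitz_norm; apply: lipschitzD; apply: lipschitzZ; exact: lipschitz_entry.
  - exact: lipschitzMl.
  move=> g _; rewrite /f plane_t0 -exprMn; congr (_ * cRe (_ ^+ _)).
  rewrite /z0 plane_t0 plane_s0 /om; apply/eqP; rewrite eq_complex /=; apply/andP; split; apply/eqP.
    have -> : al * (al * t0 g + be * s0 g) - be * (- be * t0 g + al * s0 g) =
      (al ^+ 2 + be ^+ 2) * t0 g by ring.
    by rewrite ab mul1r.
  have -> : al * (- be * t0 g + al * s0 g) + be * (al * t0 g + be * s0 g) =
      (al ^+ 2 + be ^+ 2) * s0 g by ring.
  by rewrite ab mul1r.
have l1 : lipschitz (fun g => `|t0 g| * cRe (z0 g ^+ (2 * k) * (z0 g)^*%C ^+ 0)).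
  by have := lip_tre k 0; rewrite subn0.
have l2 : lipschitz (fun g => `|t0 g| * cIm (z0 g ^+ (2 * k) * (z0 g)^*%C ^+ 0)).
  by apply: lipschitzM lip_t0 _; have [] := lipC_zz (2 * k) 0.
rewrite /lam subn0 -[RHS]subr0 -{1}(mulr0 (cIm (om ^+ (2 * k)))) -(haar_Im0 (2 * k) 0).
rewrite -!haarZ // -haarB; [|exact: lipschitzZ|exact: lipschitzZ].
apply: haar_eq => //; first by apply: lipschitzB; exact: lipschitzZ.
move=> g _; rewrite /f expr0 mulr1 cReM.
by move: (cRe _) (cIm _) (cRe _) (cIm _) `|t0 g| => p q u v t; ring.
Qed.

(** If the multiplier vanished, [Re z0^(2k)] would average to 0 against every [|a t0 + b s0|], hence
    against a tent that is nonnegative, positive at the identity and supported in the cone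
    [|s0| <= ep |t0|], where [Re z0^(2k) >= 0]. The multiplier itself is never computed. *)
Lemma lam_neq0 k : lam k 0 != 0.
Proof.
apply/negP => /eqP lam0.
pose ep : R := 2 ^- (2 * k).
have ep0 : 0 < ep by rewrite invr_gt0 exprn_gt0.
have lz : lipschitz (fun g => cRe (z0 g ^+ (2 * k))) by have [] := lipC_pow (2 * k) lipC_z0.
have lts (a b : R) : lipschitz (fun g => `|a * t0 g + b * s0 g|).
  by apply: lipschitz_norm; apply: lipschitzD; apply: lipschitzZ; exact: lipschitz_entry.
have lab (a b : R) := lipschitzM (lts a b) lz.
have H0 (a b : R) : 0 < a ^+ 2 + b ^+ 2 ->
    haar (fun g => `|a * t0 g + b * s0 g| * cRe (z0 g ^+ (2 * k))) = 0.
  move=> ab; pose c := Num.sqrt (a ^+ 2 + b ^+ 2).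
  have c0 : 0 < c by rewrite sqrtr_gt0.
  have cc : c ^+ 2 = a ^+ 2 + b ^+ 2 by rewrite sqr_sqrtr // ltW.
  have := @lam_rot (a / c) (b / c) k; rewrite !expr_div_n cc -mulrDl mulfV ?gt_eqF // lam0 mulr0.
  move=> /(_ erefl) h; rewrite -[RHS](mulr0 c) -h -haarZ; last exact: lab.
  apply: haar_eq => [||g _]; [exact: lab | by apply: lipschitzZ; exact: lab |].
  rewrite mulrA -{1}(gtr0_norm c0) -normrM; congr (`| _ | * _).
  by field; rewrite gt_eqF.
pose tent g := `|ep * t0 g + (-1) * s0 g| + `|ep * t0 g + 1 * s0 g| - 2 * `|0 * t0 g + 1 * s0 g|.
have ltent : lipschitz tent.
  by apply: lipschitzB; [apply: lipschitzD; exact: lts | apply: lipschitzZ; exact: lts].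
have ltz : lipschitz (fun g => tent g * cRe (z0 g ^+ (2 * k))) by apply: lipschitzM.
have : 0 < haar (fun g => tent g * cRe (z0 g ^+ (2 * k))).
  apply: haar_gt0 => //.
    move=> g _; rewrite /tent mulN1r !mul1r mul0r add0r.
    have [le|lt] := leP `|s0 g| (ep * `|t0 g|).
      apply: mulr_ge0; last first.
        by apply: Re_pow_ge0; move: le; rewrite /ep mulrC ler_pdivlMr ?exprn_gt0.
      have := ler_normB (ep * t0 g + s0 g) (ep * t0 g - s0 g).
      have -> : ep * t0 g + s0 g - (ep * t0 g - s0 g) = 2 * s0 g by ring.
      by rewrite normrM normr_nat; lra.
    have at0 : `|ep * t0 g| = ep * `|t0 g| by rewrite normrM gtr0_norm.
    have := lt; rewrite -at0 => lt'.
    suff -> : `|ep * t0 g - s0 g| + `|ep * t0 g + s0 g| - 2 * `|s0 g| = 0 by rewrite mul0r.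
    move: lt'; rewrite ltr_norml; have [s00|s00] := leP 0 (s0 g).
      rewrite (ger0_norm s00) => /andP[k1 k2].
      by rewrite ler0_norm ?ger0_norm; lra.
    rewrite (ltr0_norm s00) => /andP[k1 k2].
    by rewrite ger0_norm ?ler0_norm; lra.
  have t1 : t0 1%:M = 1 by rewrite /t0 mxE eqxx.
  have s1 : s0 1%:M = 0 by rewrite /s0 mxE (negPf i10).
  rewrite /tent /z0 t1 s1 !mulr0 !addr0 !mulr1 normr0 mulr0 subr0.
  have -> : (1 +i* 0)%C = 1 :> R[i] by [].
  by rewrite expr1n mulr1 gtr0_norm // addr_gt0.
suff -> : haar (fun g => tent g * cRe (z0 g ^+ (2 * k))) = 0 by rewrite ltxx.
have p1 : 0 < ep ^+ 2 + (-1) ^+ 2 by rewrite sqrrN expr1n ltr_pwDr // sqr_ge0.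
have p2 : 0 < ep ^+ 2 + 1 ^+ 2 by rewrite expr1n ltr_pwDr // sqr_ge0.
have p3 : 0 < 0 ^+ 2 + 1 ^+ 2 :> R by rewrite expr0n expr1n add0r.
transitivity (haar (fun g => `|ep * t0 g + (-1) * s0 g| * cRe (z0 g ^+ (2 * k)) +
    `|ep * t0 g + 1 * s0 g| * cRe (z0 g ^+ (2 * k)) -
    2 * (`|0 * t0 g + 1 * s0 g| * cRe (z0 g ^+ (2 * k))))).
  apply: haar_eq => //; last by move=> g _; rewrite /tent; ring.
  by apply: lipschitzB; [apply: lipschitzD; exact: lab | apply: lipschitzZ; exact: lab].
rewrite haarB; [|by apply: lipschitzD; exact: lab|by apply: lipschitzZ; exact: lab].
rewrite haarD; [|exact: lab|exact: lab].
rewrite haarZ; last exact: lab.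
by rewrite (H0 _ _ p1) (H0 _ _ p2) (H0 _ _ p3) mulr0 addr0 subr0.
Qed.

Definition kdist (k i : nat) := ((k - i) + (i - k))%N.

(** In the frame of [sphere_frame] the two factors become [|t0|] and a power of [Re (w^* z0)], which
    the binomial formula expands; the products of imaginary parts average to 0. *)
Lemma transform_chb k b x : unitv b -> unitv x ->
  2 ^+ (2 * k) * haar (fun g => dotp b (g *m e0) ^+ (2 * k) * `|dotp x (g *m e0)|) =
  \sum_(i < (2 * k).+1) ('C(2 * k, i)%:R * lam k i) * chb (kdist k i) (2 * dotp x b ^+ 2 - 1).
Proof.
move=> ub ux; have [o [al [rho [sig [oo al1 rs xb [ox ob]]]]]] := sphere_frame ux ub.
pose w : R[i] := (rho +i* sig)%C.
have w1 : cRe w ^+ 2 + cIm w ^+ 2 = 1 by [].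
have xb2 : dotp x b ^+ 2 = cRe w ^+ 2 by rewrite xb exprMn al1 mul1r.
have na : `|al| = 1.
  by apply/eqP; rewrite -(@eqrXn2 _ 2) ?nnegrE // real_normK ?num_real // al1 expr1n.
have lf : lipschitz (fun g => dotp b (g *m e0) ^+ (2 * k) * `|dotp x (g *m e0)|).
  apply: lipschitzM; first by apply: lipschitzX; exists 1 => //; exact: lip_dotp.
  by apply: lipschitz_norm; exists 1 => //; exact: lip_dotp.
have lre i := lip_tre k i.
have lim i : lipschitz (fun g => `|t0 g| * cIm (z0 g ^+ (2 * k - i) * (z0 g)^*%C ^+ i)).
  by apply: lipschitzM lip_t0 _; have [] := lipC_zz (2 * k - i) i.
rewrite -(haar_Ml lf (orthT oo)) -haarZ; last exact: lipschitzMl (orthT oo) lf.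
pose A i := (w^*)%C ^+ (2 * k - i) * w ^+ i.
have distr (c t p q u v : R) :
  c * (p * u - q * v) * t = c * p * (t * u) - c * q * (t * v) by ring.
transitivity (haar (fun g => \sum_(i < (2 * k).+1) ('C(2 * k, i)%:R * cRe (A i) *
     (`|t0 g| * cRe (z0 g ^+ (2 * k - i) * (z0 g)^*%C ^+ i)) -
     'C(2 * k, i)%:R * cIm (A i) *
     (`|t0 g| * cIm (z0 g ^+ (2 * k - i) * (z0 g)^*%C ^+ i))))).
  apply: haar_eq.
  - by apply: lipschitzZ; exact: lipschitzMl (orthT oo) lf.
  - apply: lipschitz_sum => i; apply: lipschitzB; apply: lipschitzZ; [exact: lre | exact: lim].
  move=> g og.
  have -> : dotp x (o^T *m g *m e0) = al * t0 g.
    by rewrite -mulmxA -dotpM ox dotpZl dotp_e0.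
  have -> : dotp b (o^T *m g *m e0) = cRe ((w^*)%C * z0 g).
    rewrite -mulmxA -dotpM ob dotpDl !dotpZl dotp_e0 dotp_e1 cReM cReJ cImJ /=; ring.
  rewrite mulrA cRe_pow_expand normrM na mul1r mulr_suml; apply: eq_bigr => i _.
  have -> : ((w^*)%C * z0 g) ^+ (2 * k - i) * (((w^*)%C * z0 g)^*)%C ^+ i =
     A i * (z0 g ^+ (2 * k - i) * (z0 g)^*%C ^+ i).
    by rewrite cconjM conjcK !exprMn /A; ring.
  by rewrite cReM distr.
rewrite haar_sum; last first.
  by move=> i; apply: lipschitzB; apply: lipschitzZ; [exact: lre | exact: lim].
apply: eq_bigr => i _.
rewrite haarB; [|apply: lipschitzZ; exact: lre|apply: lipschitzZ; exact: lim].
rewrite (haarZ _ (lre i)) (haarZ _ (lim i)) haar_Im0 mulr0 subr0.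
have cm : cRe (A i) = chb (kdist k i) (2 * cRe w ^+ 2 - 1).
  by apply: chb_mixed => //; rewrite -ltnS.
by rewrite xb2 -cm mulrAC.
Qed.

Lemma lam_end k i : (i <= 2 * k)%N -> kdist k i = k -> lam k i = lam k 0.
Proof.
rewrite /kdist => ik ki; have [->//|->] : i = 0%N \/ i = (2 * k)%N by lia.
rewrite /lam subnn subn0; apply: haar_eq.
- by have := lip_tre k (2 * k); rewrite subnn.
- by have := lip_tre k 0; rewrite subn0.
by move=> g _; rewrite !expr0 mul1r mulr1 -rmorphXn cReJ.
Qed.

(** Strong induction on [k]: [transform_chb] is triangular. The extreme indices [i = 0] and [i = 2k]
    carry [chb k], with the nonzero total coefficient [c * lam k 0], and all others a lower
    degree. *)
Lemma W_chb k b : unitv b -> W (fun x => chb k (2 * dotp x b ^+ 2 - 1)).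
Proof.
elim/ltn_ind: k b => k IH b ub.
have WT : W (fun x => haar (fun g => dotp b (g *m e0) ^+ (2 * k) * `|dotp x (g *m e0)|)).
  apply: (@W_haar _ (fun g x => `|dotp x (g *m e0)|) 1) => //.
  - by apply: lipschitzX; exists 1 => //; exact: lip_dotp.
  - move=> x ux g g' og og'; apply: le_trans (lip_dotp ux og og'); exact: ler_dist_dist.
  - move=> x g ux og; rewrite normr_id; apply: dotp_le1 => //; exact: unitvM og unitv_e0.
  - by move=> g og; exact: W_abs.
pose D (i : 'I_(2 * k).+1) := kdist k i == k.
have WS : W (fun x => \sum_(i < (2 * k).+1 | ~~ D i) ('C(2 * k, i)%:R * lam k i) *
   chb (kdist k i) (2 * dotp x b ^+ 2 - 1)).
  apply: W_sum => i Di; apply: IH => //; move: Di (ltn_ord i); rewrite /D /kdist => /eqP; lia.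
pose c : R := \sum_(i < (2 * k).+1 | D i) 'C(2 * k, i)%:R.
have c0 : 0 < c.
  rewrite /c (bigD1 ord0) /=; last by rewrite /D /kdist /= subn0 sub0n addn0.
  by rewrite ltr_wpDr ?sumr_ge0 // bin0 ltr01.
apply: (W_eq _ (W_lin (2 ^+ (2 * k) / (c * lam k 0)) (- (c * lam k 0)^-1) WT WS)) => x ux.
have := transform_chb k ub ux; rewrite (bigID D) /=.
set T := haar _; set S := \sum_(i < _ | ~~ D i) _.
have -> : \sum_(i < (2 * k).+1 | D i) ('C(2 * k, i)%:R * lam k i) *
    chb (kdist k i) (2 * dotp x b ^+ 2 - 1) = c * lam k 0 * chb k (2 * dotp x b ^+ 2 - 1).
  rewrite /c !mulr_suml; apply: eq_bigr => i /eqP Di.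
  by rewrite Di lam_end // -ltnS.
move=> h; have -> : T = (c * lam k 0 * chb k (2 * dotp x b ^+ 2 - 1) + S) / 2 ^+ (2 * k).
  by rewrite -h mulrAC mulfV ?mul1r // expf_neq0 // pnatr_eq0.
field; rewrite lam_neq0 (gt_eqF c0) expf_neq0 // pnatr_eq0 //.
Qed.

Lemma W_pow k b : unitv b -> W (fun x => dotp x b ^+ (2 * k)).
Proof.
move=> ub.
have WS : W (fun x => \sum_(i < (2 * k).+1) ('C(2 * k, i)%:R / 2 ^+ (2 * k)) *
   chb (kdist k i) (2 * dotp x b ^+ 2 - 1)).
  by apply: W_sum => i _; exact: W_chb.
apply: W_eq WS => x ux.
have [o [al [rho [sig [oo al1 rs xb _]]]]] := sphere_frame ux ub.
pose w : R[i] := (rho +i* sig)%C.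
have w1 : cRe w ^+ 2 + cIm w ^+ 2 = 1 by [].
have xb2 : dotp x b ^+ 2 = cRe w ^+ 2 by rewrite xb exprMn al1 mul1r.
rewrite xb2 exprM xb2 -exprM.
have := cRe_pow_expand ((w^*)%C) (2 * k); rewrite cReJ conjcK => h.
have p0 : 2 ^+ (2 * k) != 0 :> R by rewrite expf_neq0 // pnatr_eq0.
rewrite -[LHS](mulKf p0) h mulr_sumr; apply: eq_bigr => i _.
have cm : cRe ((w^*)%C ^+ (2 * k - i) * w ^+ i) = chb (kdist k i) (2 * cRe w ^+ 2 - 1).
  by apply: chb_mixed => //; rewrite -ltnS.
by rewrite cm mulrA [_^-1 * _]mulrC.
Qed.

Lemma fn2_unit x y : unitv x -> unitv y -> fn2 (x - y) = 2 - 2 * dotp x y.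
Proof.
by move=> ux uy; rewrite -dotp_fn2 dotpBl !dotpBr ux uy (dotpC y x); ring.
Qed.

(** Convolution with the zonal power [<x, .>^(2N)], which peaks at both [x] and [-x]; evenness of
    [f] makes the two peaks agree. The convolution lies in [W] by [W_pow] and [W_haar]. *)
Lemma W_dense (f : 'cV[R]_n -> R) (L : R) : 0 <= L ->
  (forall x, f (- x) = f x) ->
  (forall x y, unitv x -> unitv y -> `|f x - f y| <= L * fn (x - y)) -> W f.
Proof.
move=> L0 fe fL; apply: W_lim => eta eta0.
pose r := eta / (2 * (L + 1)).
have r0 : 0 < r by rewrite divr_gt0 // mulr_gt0 //; lra.
have Lr : L * r <= eta / 2 by exact: ler_half_ratio (ltW eta0).
have lt2 : lipschitz (fun g => t0 g ^+ 2) by apply: lipschitzX; exact: lipschitz_entry.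
have t1 g : orth g -> t0 g ^+ 2 <= 1.
  by move=> og; have := orth_entry i0 i0 og; rewrite -real_normK ?num_real // => h; rewrite exprn_ile1.
have t11 : t0 1%:M ^+ 2 = 1 by rewrite /t0 mxE eqxx expr1n.
(* [t0^2 > 1 - r^2/2] forces [2 - 2 |t0| < r^2], and the left side is the squared distance to the
   nearer of the two peaks. *)
have del0 : 0 < r ^+ 2 / 2 by rewrite divr_gt0 // exprn_gt0.
have [N [HN0 HN]] := peak lt2 (fun g _ => sqr_ge0 (t0 g)) t1 t11 ltr01 del0 eta0
   (mulr_ge0 L0 (ler0n R 2)).
set Z := haar _ in HN0 HN.
have lfe : lipschitz (fun g => f (g *m e0)).
  exists L => // g g' og og'; apply: le_trans (fL _ _ (unitvM og unitv_e0) (unitvM og' unitv_e0)) _.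
  by rewrite ler_wpM2l // -mulmxBl; exact: fn_col.
exists (fun x => Z^-1 * haar (fun g => f (g *m e0) * dotp x (g *m e0) ^+ (2 * N)) + 0 * 0).
  apply: (@W_lin Z^-1 0 _ (fun=> 0)); last first.
    by move=> e ee0; exists [::] => x _; rewrite /wsum big_nil subrr normr0 ltW.
  apply: (@W_haar _ (fun g x => dotp x (g *m e0) ^+ (2 * N)) (2 * N)%:R) => //.
  - move=> x ux g g' og og'.
    apply: le_trans (ler_pow_dist (2 * N) _ _) _.
    + by apply: dotp_le1 => //; exact: unitvM og unitv_e0.
    + by apply: dotp_le1 => //; exact: unitvM og' unitv_e0.
    by rewrite ler_wpM2l //; have := lip_dotp ux og og'; rewrite mul1r.
  - move=> x g ux og; rewrite normrX exprn_ile1 //; apply: dotp_le1 => //; exact: unitvM og unitv_e0.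
  - by move=> g og; apply: W_pow; exact: unitvM og unitv_e0.
move=> x ux; rewrite mulr0 addr0.
have [o [al [rho [sig [oo al1 rs xb [ox _]]]]]] := sphere_frame ux ux.
have lx : lipschitz (fun g => f (g *m e0) * dotp x (g *m e0) ^+ (2 * N)).
  by apply: lipschitzM => //; apply: lipschitzX; exists 1 => //; exact: lip_dotp.
have fx : f x = f (o^T *m e0).
  have -> : x = al *: (o^T *m e0).
    by rewrite scalemxAr -ox mulmxA orthTl // mul1mx.
  move: al1 => /eqP; rewrite sqrf_eq1 => /orP[/eqP ->|/eqP ->]; first by rewrite scale1r.
  by rewrite scaleN1r fe.
pose psi g := f (o^T *m g *m e0) - f x.
have lpsi : lipschitz psi.
  apply: lipschitzB; last exact: lip_cst.
  exact: (lipschitzMl (orthT oo) lfe).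
have lN : lipschitz (fun g => (t0 g ^+ 2) ^+ N) by apply: lipschitzX.
have E : haar (fun g => f (g *m e0) * dotp x (g *m e0) ^+ (2 * N)) =
    haar (fun g => (t0 g ^+ 2) ^+ N * psi g) + f x * Z.
  rewrite -(haar_Ml lx (orthT oo)) -haarZ // -haarD; [|exact: lipschitzM|exact: lipschitzZ].
  apply: haar_eq.
  - exact: (lipschitzMl (orthT oo) lx).
  - by apply: lipschitzD; [exact: lipschitzM|exact: lipschitzZ].
  move=> g og.
  have -> : dotp x (o^T *m g *m e0) = al * t0 g.
    by rewrite -mulmxA -dotpM ox dotpZl dotp_e0.
  have at2 : (al * t0 g) ^+ 2 = t0 g ^+ 2 by rewrite exprMn al1 mul1r.
  by rewrite (exprM (al * t0 g)) at2 /psi; ring.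
have psiE g : orth g -> `|psi g| <= L * Num.sqrt (2 - 2 * `|t0 g|).
  move=> og; have ug := unitvM (orthM (orthT oo) og) unitv_e0.
  have ue := unitvM (orthT oo) unitv_e0.
  have d : dotp (o^T *m g *m e0) (o^T *m e0) = t0 g.
    by rewrite -mulmxA dotpM trmxK mulmxA oo mul1mx dotpC dotp_e0.
  rewrite /psi fx; have [p|q] := leP 0 (t0 g).
    by apply: le_trans (fL _ _ ug ue) _; rewrite /fn fn2_unit // d ger0_norm.
  rewrite -[f (o^T *m g *m e0)]fe.
  have ung : unitv (- (o^T *m g *m e0)) by rewrite /unitv dotpNl dotpC dotpNl opprK.
  apply: le_trans (fL _ _ ung ue) _; rewrite /fn fn2_unit // dotpNl d ltr0_norm //.
rewrite E mulrDr mulrC [Z^-1 * _]mulrC -mulrA mulfV ?gt_eqF // mulr1 opprD addrCA subrr addr0.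
rewrite normrN normrM (@gtr0_norm _ Z^-1) ?invr_gt0 // ler_pdivrMr //.
apply: HN => // g og.
  move=> ht; apply: le_trans (psiE g og) _; apply: le_trans Lr; rewrite ler_wpM2l //.
  have a1 : `|t0 g| <= 1 := orth_entry i0 i0 og.
  have a2 : t0 g ^+ 2 <= `|t0 g|.
    by rewrite -real_normK ?num_real // expr2 ler_piMl.
  rewrite -[X in _ <= X](@ger0_norm _ r) ?(ltW r0) // -(sqrtr_sqr r) ler_sqrt ?sqr_ge0 //.
  by move: ht a2; lra.
apply: le_trans (psiE g og) _; rewrite ler_wpM2l //.
have : Num.sqrt (2 - 2 * `|t0 g|) <= Num.sqrt (2 ^+ 2).
  by rewrite ler_sqrt ?exprn_ge0 //; have := normr_ge0 (t0 g); lra.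
by rewrite sqrtr_sqr normr_nat.
Qed.

End Sphere.

(** * Support functions *)

Section Support.
Variables (R : realType) (n : nat).
Implicit Types (A B K L : set 'cV[R]_n) (x y u a : 'cV[R]_n).

(** The supremum as a relation with approximate maximisers, which passes directly through sums,
    scalings and linear images. *)
Definition is_supp A u (v : R) := (forall x, A x -> dotp x u <= v) /\
  (forall e, 0 < e -> exists2 x, A x & v - e <= dotp x u).

Lemma supp_msum A B u v w : is_supp A u v -> is_supp B u w -> is_supp (msum A B) u (v + w).
Proof.
move=> [a1 a2] [b1 b2]; split.
  by move=> _ [x [y [Ax By ->]]]; rewrite dotpDl lerD // ?a1 ?b1.
move=> e e0; have e2 : 0 < e / 2 by rewrite divr_gt0.
have [x Ax hx] := a2 _ e2; have [y By hy] := b2 _ e2.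
by exists (x + y); [exists x, y | rewrite dotpDl; lra].
Qed.

Lemma supp_scale c A u v : 0 <= c -> is_supp A u v -> is_supp (mscale c A) u (c * v).
Proof.
move=> c0 [a1 a2]; split.
  by move=> _ [x Ax <-]; rewrite dotpZl ler_wpM2l // a1.
move=> e e0; have e2 : 0 < e / (c + 1) by rewrite divr_gt0 //; lra.
have [x Ax hx] := a2 _ e2; exists (c *: x); first by exists x.
rewrite dotpZl; have h := ler_wpM2l c0 hx.
have : c * (e / (c + 1)) <= e.
  by rewrite mulrA ler_pdivrMr; [rewrite mulrC ler_wpM2l ?(ltW e0) //; lra | lra].
by move: h; rewrite mulrBr; lra.
Qed.

Lemma supp_set0 u : is_supp [set 0] u 0.
Proof.
have d0 : dotp 0 u = 0 by apply: big1 => i _; rewrite mxE mul0r.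
split; first by move=> _ ->; rewrite d0.
by move=> e e0; exists 0 => //; rewrite d0 sub0r oppr_le0 ltW.
Qed.

Lemma supp_seg u a : is_supp (seg a) u `|dotp u a|.
Proof.
split.
  move=> _ [s s1 ->]; rewrite dotpZl dotpC; apply: le_trans (ler_norm _) _.
  by rewrite normrM ler_piMl.
move=> e e0; have [p|q] := leP 0 (dotp u a).
  exists a; first by exists 1; rewrite ?normr1 // scale1r.
  by rewrite ger0_norm // dotpC gerBl ltW.
exists (- a); first by exists (-1); rewrite ?normrN1 // scaleN1r.
by rewrite ltr0_norm // dotpNl dotpC gerBl ltW.
Qed.

Definition mimg (m : nat) (g : 'M[R]_(m, n)) K : set 'cV[R]_m := [set g *m x | x in K].

(* Nearest-point argument, run with an approximate minimiser so that no
   compactness is needed. *)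
Lemma separation L x (eta : R) : convex L -> vbounded L -> L !=set0 -> 0 < eta ->
  (forall u, unitv u -> exists2 y, L y & dotp x u <= dotp y u + eta / 2) ->
  fat eta L x.
Proof.
move=> cL [M LM] [l0 Ll0] eta0 H; apply/fatE; apply: contrapT => nE.
have nfat a : L a -> ~ (forall i, `|x i 0 - a i 0| <= eta) by move=> La ha; apply: nE; exists a.
have far y : L y -> eta ^+ 2 <= fn2 (x - y).
  move=> Ly; rewrite leNgt; apply/negP => lt; apply: (nfat y Ly) => i.
  have := fn_entry (x - y) i 0; rewrite !mxE => h; apply: le_trans h _.
  rewrite /fn -[X in _ <= X](@ger0_norm _ eta) ?(ltW eta0) // -sqrtr_sqr.
  by rewrite ler_sqrt ?sqr_ge0 // ltW.
pose E := [set fn2 (x - y) | y in L].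
have Einf : has_inf E.
  split; first by exists (fn2 (x - l0)), l0.
  by exists 0 => _ [y _ <-]; exact: fn2_ge0.
pose D := fn2 (const_mx (2 * M) : 'cV[R]_n) + 1.
have D0 : 0 < D by rewrite /D; have := fn2_ge0 (const_mx (2 * M) : 'cV[R]_n); lra.
have LD y y' : L y -> L y' -> fn2 (y - y') <= D.
  move=> /LM yM /LM yM'; rewrite /D.
  have : fn2 (y - y') <= fn2 (const_mx (2 * M) : 'cV[R]_n); last lra.
  apply: ler_sum => i _; apply: ler_sum => k _; rewrite !mxE ord1.
  rewrite -[X in X <= _]real_normK ?num_real // lerXn2r ?nnegrE //.
    by have := le_trans (normr_ge0 _) (yM i); lra.
  apply: le_trans (ler_normB _ _) _; have := yM i; have := yM' i; lra.
have e20 : 0 < eta ^+ 2 by rewrite exprn_gt0.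
(* Step length towards [y]: with [s D <= eta^2 / 4] the second-order term stays within
   [s eta^2 / 4], the same tolerance with which [y0] minimises the distance. *)
pose s := Num.min 1 (eta ^+ 2 / (4 * D)).
have s0 : 0 < s by rewrite lt_min ltr01 divr_gt0 // mulr_gt0.
have s1 : s <= 1 by rewrite ge_min lexx.
have sD : s * D <= eta ^+ 2 / 4.
  apply: (@le_trans _ _ (eta ^+ 2 / (4 * D) * D)).
    by rewrite ler_wpM2r ?(ltW D0) // ge_min lexx orbT.
  by rewrite le_eqVlt; apply/orP; left; apply/eqP; field; rewrite gt_eqF.
have tau0 : 0 < s * (eta ^+ 2 / 4) by rewrite mulr_gt0 // divr_gt0.
have [_ [y0 Ly0 <-] hy0] := inf_adherent tau0 Einf.
set u0 := x - y0 in hy0.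
have u0e := far y0 Ly0; rewrite -/u0 in u0e.
have fu0 : eta <= fn u0.
  rewrite /fn -[X in X <= _](@ger0_norm _ eta) ?(ltW eta0) // -sqrtr_sqr.
  by rewrite ler_sqrt ?fn2_ge0.
have fu0p : 0 < fn u0 by apply: lt_le_trans fu0.
have uu : unitv ((fn u0)^-1 *: u0).
  rewrite /unitv dotpZl dotpZr dotp_fn2 -(sqr_sqrtr (fn2_ge0 u0)) -/(fn u0).
  by field; rewrite gt_eqF.
have [y Ly hy] := H _ uu.
have h1 : dotp (x - y) u0 <= eta / 2 * fn u0.
  have : dotp (x - y) ((fn u0)^-1 *: u0) <= eta / 2 by rewrite dotpBl; lra.
  by rewrite dotpZr mulrC ler_pdivrMr.
(* Near minimality of [y0] against [ys] gives [<y - y0, u0> <= eta^2 / 4]; the choice of [y] gives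
   [<y - y0, u0> >= |u0| (|u0| - eta / 2) >= eta^2 / 2]. *)
pose ys := s *: y + (1 - s) *: y0.
have Lys : L ys by apply: cL => //; exact: ltW.
have : inf E <= fn2 (x - ys) by apply: ge_inf; [case: Einf | exists ys].
have -> : x - ys = u0 - s *: (y - y0).
  by rewrite /u0 /ys; apply/colP => i; rewrite !mxE; ring.
have exp2 (u d : 'cV[R]_n) : fn2 (u - s *: d) = fn2 u - 2 * (s * dotp d u) + s * (s * fn2 d).
  by rewrite -!dotp_fn2 dotpBl !dotpBr !dotpZl !dotpZr (dotpC u d); ring.
rewrite exp2 => h2.
have h3 := LD y y0 Ly Ly0.
have h4 : dotp (x - y) u0 = fn2 u0 - dotp (y - y0) u0.
  have -> : x - y = u0 - (y - y0) by rewrite /u0 opprB addrA subrK.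
  by rewrite dotpBl dotp_fn2.
set P := dotp (y - y0) u0 in h2 h4.
have h5 : 2 * P <= eta ^+ 2 / 2.
  have h6 : s * (s * fn2 (y - y0)) <= s * (eta ^+ 2 / 4).
    apply: ler_wpM2l; first exact: ltW.
    by apply: le_trans sD; apply: ler_wpM2l; first exact: ltW.
  rewrite -(ler_pM2l s0); move: h2 h6 hy0; lra.
have fE : fn2 u0 = fn u0 * fn u0 by rewrite -expr2 sqr_sqrtr ?fn2_ge0.
have h7 : eta * (eta / 2) <= fn u0 * (fn u0 - eta / 2).
  by apply: ler_pM => //; lra.
by move: h1 h4 h5 h7; rewrite fE expr2 => *; lra.
Qed.

Lemma supp_sub A L (eta : R) (v w : 'cV[R]_n -> R) :
  convex L -> vbounded L -> L !=set0 -> 0 < eta ->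
  (forall u, unitv u -> is_supp A u (v u)) -> (forall u, unitv u -> is_supp L u (w u)) ->
  (forall u, unitv u -> v u <= w u + eta / 4) -> A `<=` fat eta L.
Proof.
move=> cL bL nL eta0 sA sL vw x Ax; apply: separation => // u uu.
have [a1 _] := sA u uu; have [_ l2] := sL u uu.
have e4 : 0 < eta / 4 by rewrite divr_gt0.
have [y Ly hy] := l2 _ e4; exists y => //.
have := a1 x Ax; have := vw u uu; lra.
Qed.

Definition suppf K u : R := sup [set dotp x u | x in K].

Lemma suppfP K u : vbounded K -> K !=set0 -> is_supp K u (suppf K u).
Proof.
move=> [M KM] [x0 Kx0].
have hs : has_sup [set dotp x u | x in K].
  split; first by exists (dotp x0 u), x0.
  exists (\sum_i M * `|u i 0|) => _ [x /KM xM <-]; apply: ler_sum => i _.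
  by apply: le_trans (ler_norm _) _; rewrite normrM ler_wpM2r.
split; first by move=> x Kx; apply: ub_le_sup; [case: hs | exists x].
by move=> e e0; have [_ [x Kx <-] h] := sup_adherent e0 hs; exists x => //; exact: ltW.
Qed.

Lemma suppf_lip K : vbounded K -> K !=set0 -> exists2 r, 0 <= r &
  forall u v, `|suppf K u - suppf K v| <= r * fn (u - v).
Proof.
move=> bK nK; have [M KM] := bK; pose r := (n * 1)%:R * `|M|.
have fx x : K x -> fn x <= r.
  move=> /KM xM; apply: fn_le => // i k; rewrite ord1; apply: le_trans (xM i) _; exact: ler_norm.
exists r; first by rewrite mulr_ge0.
have half u v : suppf K u - suppf K v <= r * fn (u - v).
  apply/ler_addgt0Pr => e e0.
  have [_ h] := suppfP u bK nK; have [x Kx hx] := h e e0.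
  have [h' _] := suppfP v bK nK; have := h' x Kx.
  have := cauchy_schwarz x (u - v); rewrite dotpBr => /(le_trans (ler_norm _)).
  have := ler_wpM2r (fn_ge0 (u - v)) (fx x Kx); lra.
move=> u v; rewrite ler_norml; apply/andP; split; last exact: half.
by have := half v u; rewrite -fnN opprB; lra.
Qed.

Definition symm K := forall x, K x -> K (- x).

Lemma suppf_even K u : symm K -> suppf K (- u) = suppf K u.
Proof.
move=> sK; congr sup; apply/seteqP; split=> _ [x Kx <-]; exists (- x); try exact: sK.
  by rewrite dotpNl [dotp x (- u)]dotpC dotpNl dotpC.
by rewrite dotpNl dotpC dotpNl opprK dotpC.
Qed.

End Support.

(** * Generalized zonoids *)

(** The reproducing formula of [interpolation] uses finitely many fixed nodes, so it passes to
    uniform limits. *)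
Lemma span_closed (R : realType) (T : Type) (t0 : T) (I : eqType) (e : I -> T -> R) (s : seq I) f :
  uniq s -> (forall eta : R, 0 < eta -> exists2 f', span e s f' & forall t, `|f t - f' t| <= eta) ->
  span e s f.
Proof.
move=> us H; have [r [x [u [su Hi]]]] := interpolation t0 e us.
suff E t : f t = \sum_(k < r) f (x k) * u k t.
  by have [c cE] := span_sum r (fun k => f (x k)) su; exists c => t; rewrite E cE.
apply/eqP; rewrite -subr_eq0 -normr_eq0 eq_le normr_ge0 andbT.
pose C := 1 + \sum_(k < r) `|u k t|.
have C0 : 0 < C by rewrite ltr_pwDl // sumr_ge0.
apply/ler_addgt0Pr => eta eta0; rewrite add0r.
have [f' sf' hf] := H (eta / C) (divr_gt0 eta0 C0).
have -> : f t - \sum_(k < r) f (x k) * u k t =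
    (f t - f' t) - \sum_(k < r) (f (x k) - f' (x k)) * u k t.
  under [in RHS]eq_bigr do rewrite mulrBl.
  by rewrite sumrB -(Hi f' sf' t); move: (f t) (f' t) (\sum_(_ < _) _) => u1 u2 u3; ring.
apply: le_trans (ler_normB _ _) _.
have eC : eta / C + \sum_(k < r) (eta / C) * `|u k t| = eta.
  by rewrite -mulr_sumr -[X in X + _]mulr1 -mulrDr -/C mulfVK // gt_eqF.
rewrite -[leRHS]eC.
apply: lerD; first exact: hf.
apply: le_trans (ler_norm_sum _ _ _) _; apply: ler_sum => k _.
by rewrite normrM ler_wpM2r.
Qed.

Section Zonoid.
Variables (R : realType) (j l : nat).
Notation n := (j + l)%N.
Variables (i0 i1 : 'I_n).
Hypotheses (h0 : nat_of_ord i0 = 0%N) (h1 : nat_of_ord i1 = 1%N).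
Implicit Types (g : 'M[R]_n) (x y a : 'cV[R]_n) (K : set 'cV[R]_n).
Notation e0 := (e0 R i0).

Lemma unit_orbit x : unitv x -> exists2 o : 'M[R]_n, orth o & x = o *m e0.
Proof.
move=> ux; have [o [al [_ [_ [oo al1 _ _ [ox _]]]]]] := sphere_frame h0 h1 ux ux.
have al2 : al * al = 1 by rewrite -expr2.
exists (al *: o^T).
  rewrite /orth linearZ /= trmxK -scalemxAl -scalemxAr scalerA al2 scale1r; exact: orthTl.
by rewrite -scalemxAl scalemxAr -ox mulmxA orthTl // mul1mx.
Qed.

Lemma vec_orbit a : exists c, exists2 o : 'M[R]_n, orth o & a = c *: (o *m e0).
Proof.
have [/eqP a0|an] := boolP (dotp a a == 0).
  by exists 0, 1%:M; [exact: orth1 | rewrite scale0r; exact: dotp_eq0].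
have p : 0 < dotp a a by rewrite lt_neqAle eq_sym an dotp_ge0.
pose c := Num.sqrt (dotp a a).
have c0 : 0 < c by rewrite sqrtr_gt0.
have ua : unitv (c^-1 *: a).
  rewrite /unitv dotpZl dotpZr -(sqr_sqrtr (ltW p)) -/c; field; rewrite gt_eqF //.
have [o oo oE] := unit_orbit ua; exists c, o => //.
by rewrite -oE scalerA mulfV ?gt_eqF // scale1r.
Qed.

Lemma lip_act (h : 'cV[R]_n -> R) (L : R) x : 0 <= L ->
  (forall x y, unitv x -> unitv y -> `|h x - h y| <= L * fn (x - y)) -> unitv x ->
  lip L (fun g => h (g^T *m x)).
Proof.
move=> L0 hL ux g g' og og'; have [o oo xo] := unit_orbit ux.
apply: le_trans (hL _ _ (unitvM (orthT og) ux) (unitvM (orthT og') ux)) _.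
rewrite ler_wpM2l // -mulmxBl xo mulmxA; apply: le_trans (fn_col _ _) _.
by rewrite fnMr // -linearB /= fnT.
Qed.

Lemma dotp_act g x a : dotp (g^T *m x) a = dotp x (g *m a).
Proof. by rewrite dotpM trmxK. Qed.

Lemma lipschitz_dotp x a : lipschitz (fun g => `|dotp x (g *m a)|).
Proof.
apply: lipschitz_norm; have -> : (fun g => dotp x (g *m a)) =
    (fun g => \sum_i x i 0 * (\sum_k a k 0 * g i k)).
  by apply/funext => g; apply: eq_bigr => i _; rewrite mxE; congr (_ * _);
    apply: eq_bigr => k _; rewrite mulrC.
apply: (@lipschitz_sum _ _ _ _ (fun i g => x i 0 * (\sum_k a k 0 * g i k))) => i.
apply: lipschitzZ; apply: (@lipschitz_sum _ _ _ _ (fun k g => a k 0 * g i k)) => k.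
by apply: lipschitzZ; exact: lipschitz_entry.
Qed.

Lemma lipschitz_wsum s x : lipschitz (fun g => wsum s (g^T *m x)).
Proof.
have -> : (fun g => wsum s (g^T *m x)) = (fun g => \sum_(p <- s) p.1 * `|dotp x (g *m p.2)|).
  by apply/funext => g; apply: eq_bigr => p _; rewrite dotp_act.
apply: (@lipschitz_sum _ _ _ _ (fun p g => p.1 * `|dotp x (g *m p.2)|)) => p.
by apply: lipschitzZ; exact: lipschitz_dotp.
Qed.

(* The smoothed function is a generalized zonoid: before smoothing [h] is a
   uniform limit of combinations of the |<., a>|, and smoothing against the
   polynomial [bump N] maps all of these into one finite-dimensional space. *)
Lemma gen_zonoid N (h : 'cV[R]_n -> R) (L : R) : 0 <= L -> (forall x, h (- x) = h x) ->
  (forall x y, unitv x -> unitv y -> `|h x - h y| <= L * fn (x - y)) ->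
  exists2 q, lipschitz q & forall x, unitv x ->
    haar (fun g => bump N g * h (g^T *m x)) = haar (fun g => q g * `|dotp x (g *m e0)|).
Proof.
move=> L0 he hL; have Wh := W_dense h0 h1 L0 he hL.
pose T := {x : 'cV[R]_n | unitv x}.
pose t0 : T := exist _ e0 (unitv_e0 R i0).
pose cidx := ('I_n * 'I_n + unit)%type.
pose S := enum {: {ffun 'I_N -> cidx}}.
pose e (al : {ffun 'I_N -> cidx}) (t : T) := haar (fun g => monof al g * `|dotp (sval t) (g *m e0)|).
have lm (al : {ffun 'I_N -> cidx}) x : lipschitz (fun g => monof al g * `|dotp x (g *m e0)|).
  by apply: lipschitzM; [exact: lipschitz_monof | exact: lipschitz_dotp].
have lb x a : lipschitz (fun g => bump N g * `|dotp x (g *m a)|).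
  by apply: lipschitzM; [exact: lipschitz_bump | exact: lipschitz_dotp].
have comb (c : {ffun 'I_N -> cidx} -> R) (x : 'cV[R]_n) :
    haar (fun g => (\sum_al c al * monof al g) * `|dotp x (g *m e0)|) =
    \sum_al c al * haar (fun g => monof al g * `|dotp x (g *m e0)|).
  rewrite -[LHS](@haar_eq _ _ (fun g => \sum_al c al * (monof al g * `|dotp x (g *m e0)|))).
  - rewrite haar_sum; last by move=> al; apply: lipschitzZ; exact: lm.
    by apply: eq_bigr => al _; rewrite haarZ.
  - by apply: lipschitz_sum => al; apply: lipschitzZ; exact: lm.
  - by apply: lipschitzM; [exact: lipschitz_comb | exact: lipschitz_dotp].
  - by move=> g og; rewrite mulr_suml; apply: eq_bigr => al _; rewrite mulrA.
(* Writing [a] as a multiple of [o e0] moves the rotation [o] into [bump], whose translates lie in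
   the span of the [monof]. *)
have span1 a : span e S (fun t => haar (fun g => bump N g * `|dotp (sval t) (g *m a)|)).
  have [c [o oo ->]] := vec_orbit a.
  have [b bE] := bump_expand N o^T; exists (fun al => `|c| * b al) => t.
  rewrite big_enum /=; under [RHS]eq_bigr do rewrite -mulrA.
  rewrite -mulr_sumr /e -comb.
  rewrite -(haar_Mr (lb _ _) (orthT oo)) -haarZ; last first.
    by apply: lipschitzM; [exact: lipschitz_comb | exact: lipschitz_dotp].
  apply: haar_eq; first exact: (lipschitzMr (orthT oo) (lb _ _)).
    by apply: lipschitzZ; apply: lipschitzM; [exact: lipschitz_comb | exact: lipschitz_dotp].
  move=> g og; rewrite bumpC bE -scalemxAr dotpZr normrM mulrA (mulmxA (g *m o^T)) -(mulmxA g).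
  by rewrite orthTl // mulmx1; ring.
have spanw s : span e S (fun t => haar (fun g => bump N g * wsum s (g^T *m sval t))).
  elim: s => [|p s [c IH]].
    exists (fun=> 0) => t; rewrite big1 => [|al _]; last by rewrite mul0r.
    rewrite -(haar_cst n 0); apply: haar_eq.
    - by apply: lipschitzM; [exact: lipschitz_bump | exact: lipschitz_wsum].
    - exact: lip_cst.
    by move=> g og; rewrite /wsum big_nil mulr0.
  have [c' cE] := span_lin p.1 1 (span1 p.2) (ex_intro _ c IH).
  exists c' => t; rewrite -cE mul1r -haarZ // -haarD; last first.
  - by apply: lipschitzM; [exact: lipschitz_bump | exact: lipschitz_wsum].
  - by apply: lipschitzZ.
  apply: haar_eq.
  - by apply: lipschitzM; [exact: lipschitz_bump | exact: lipschitz_wsum].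
  - apply: lipschitzD; first exact: lipschitzZ.
    by apply: lipschitzM; [exact: lipschitz_bump | exact: lipschitz_wsum].
  by move=> g og; rewrite /wsum big_cons dotp_act; ring.
have lh (t : T) : lipschitz (fun g => h (g^T *m sval t)).
  by exists L => //; apply: lip_act => //; exact: svalP t.
have lbh (t : T) : lipschitz (fun g => bump N g * h (g^T *m sval t)).
  by apply: lipschitzM; [exact: lipschitz_bump | exact: lh].
have [c cE] : span e S (fun t => haar (fun g => bump N g * h (g^T *m sval t))).
  apply: (span_closed t0 (enum_uniq _)) => eta eta0.
  pose B := haar (@bump R j l N) + 1.
  have B0 : 0 < B.
    rewrite ltr_wpDl // haar_ge0 //; first exact: lipschitz_bump.
    by move=> g og; apply: exprn_ge0; exact: bump1_ge0.
  have [s hs] := Wh _ (divr_gt0 eta0 B0).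
  exists (fun t => haar (fun g => bump N g * wsum s (g^T *m sval t))) => // t.
  have lbw : lipschitz (fun g => bump N g * wsum s (g^T *m sval t)).
    by apply: lipschitzM; [exact: lipschitz_bump | exact: lipschitz_wsum].
  rewrite -haarB //.
  have lD : lipschitz (fun g => bump N g * h (g^T *m sval t) - bump N g * wsum s (g^T *m sval t)).
    exact: lipschitzB.
  have lE c : lipschitz (fun g => c * bump N g) by apply: lipschitzZ; exact: lipschitz_bump.
  have bd g : orth g -> `|bump N g * h (g^T *m sval t) - bump N g * wsum s (g^T *m sval t)|
      <= (eta / B) * bump N g.
    move=> og; have b0 : 0 <= bump N g by apply: exprn_ge0; exact: bump1_ge0.
    rewrite -mulrBr normrM (ger0_norm b0) mulrC ler_wpM2r // hs //.
    exact: unitvM (orthT og) (svalP t).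
  have hb : (eta / B) * haar (@bump R j l N) <= eta.
    rewrite -{2}[eta](@mulfVK _ B) ?gt_eqF // ler_wpM2l //; first by rewrite ltW ?divr_gt0.
    by rewrite /B lerDl.
  have lbp : lipschitz (@bump R j l N) := lipschitz_bump _ _ _ N.
  rewrite ler_norml; apply/andP; split.
    apply: le_trans (_ : - (eta / B) * haar (@bump R j l N) <= _); first by rewrite mulNr lerN2.
    rewrite -haarZ //; apply: haar_le => // g og.
    by have := bd g og; rewrite ler_norml mulNr => /andP[].
  apply: le_trans hb; rewrite -haarZ //; apply: haar_le => // g og.
  by have := bd g og; rewrite ler_norml => /andP[].
exists (fun g => \sum_al c al * monof al g); first exact: lipschitz_comb.
move=> x ux; have := cE (exist _ x ux); rewrite big_enum /= => ->.
by rewrite comb /e /=.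
Qed.

End Zonoid.

Lemma posneg_parts (R : realDomainType) (a : R) : a = Num.max a 0 - Num.max (- a) 0.
Proof. by rewrite !maxEle; have [k1|k1] := leP a 0; have [k2|k2] := leP (- a) 0; lra. Qed.

Section Images.
Variables (R : realType).

Lemma vbounded_mimg (n m : nat) (g : 'M[R]_(m, n)) (K : set 'cV[R]_n) : vbounded K -> vbounded (mimg g K).
Proof.
move=> [M KM]; exists (\sum_i \sum_k `|g i k| * `|M|) => _ [x /KM xM <-] i.
rewrite mxE; apply: le_trans (ler_norm_sum _ _ _) _.
apply: le_trans (_ : \sum_k `|g i k| * `|M| <= _).
  apply: ler_sum => k _; rewrite normrM ler_wpM2l //; apply: le_trans (xM k) _; exact: ler_norm.
rewrite [leRHS](bigD1 i) //= lerDl; apply: sumr_ge0 => ? _; apply: sumr_ge0 => ? _.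
exact: mulr_ge0.
Qed.

Lemma convex_mimg (n m : nat) (g : 'M[R]_(m, n)) (K : set 'cV[R]_n) : convex K -> convex (mimg g K).
Proof.
move=> cK _ _ t [x Kx <-] [y Ky <-] t0 t1; exists (t *: x + (1 - t) *: y); first exact: cK.
by rewrite mulmxDr -!scalemxAr.
Qed.

Lemma convex_mscale (n : nat) (c : R) (K : set 'cV[R]_n) : convex K -> convex (mscale c K).
Proof.
move=> cK _ _ t [x Kx <-] [y Ky <-] t0 t1; exists (t *: x + (1 - t) *: y); first exact: cK.
by rewrite scalerDr !scalerA mulrC [c * (1 - t)]mulrC.
Qed.

Lemma convex_set0 (n : nat) : convex [set (0 : 'cV[R]_n)].
Proof. by move=> _ _ t -> -> _ _; rewrite !scaler0 addr0. Qed.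

Lemma vbounded_set0 (n : nat) : vbounded [set (0 : 'cV[R]_n)].
Proof. by exists 0 => _ -> i; rewrite mxE normr0. Qed.

Lemma supp_mimg (n : nat) (g : 'M[R]_n) K u (v : R) : is_supp K (g^T *m u) v -> is_supp (mimg g K) u v.
Proof.
move=> [a1 a2]; split; first by move=> _ [x Kx <-]; rewrite dotpM a1.
by move=> e ep; have [x Kx hx] := a2 e ep; exists (g *m x); [exists x | rewrite dotpM].
Qed.

Lemma supp_zl (n : nat) (s : seq 'cV[R]_n) u : is_supp (zl s) u (\sum_(v <- s) `|dotp u v|).
Proof.
elim: s => [|v s IH]; first by rewrite big_nil; exact: supp_set0.
by rewrite big_cons addrC; apply: supp_msum IH _; exact: supp_seg.
Qed.

Lemma zl_entry (n : nat) (s : seq 'cV[R]_n) x i : zl s x -> `|x i 0| <= \sum_(v <- s) `|v i 0|.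
Proof.
elim: s x => [|v s IH] x /=; first by move=> ->; rewrite mxE normr0 big_nil.
move=> [y [z [zy [t t1 ->] ->]]]; rewrite big_cons [leRHS]addrC !mxE.
apply: le_trans (ler_normD _ _) _; apply: lerD; first exact: IH.
by rewrite normrM ler_piMl.
Qed.

(** A discretised smoothing: for nonnegative weights its support function is the weighted sum of the
    rotated support functions of [K]. *)
Definition rotsum (n : nat) (c : R * 'M[R]_n -> R) K s : set 'cV[R]_n :=
  foldr (fun p A => msum A (mscale (c p) (mimg p.2 K))) [set 0] s.

Lemma convex_rotsum (n : nat) (c : R * 'M[R]_n -> R) K s : convex K -> convex (rotsum c K s).
Proof.
move=> cK; elim: s => [|p s IH] /=; first exact: convex_set0.
by apply: convex_msum => //; apply: convex_mscale; exact: convex_mimg.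
Qed.

Lemma vbounded_rotsum (n : nat) (c : R * 'M[R]_n -> R) K s : vbounded K -> vbounded (rotsum c K s).
Proof.
move=> bK; elim: s => [|p s IH] /=; first exact: vbounded_set0.
by apply: vbounded_msum => //; apply: vbounded_scale; exact: vbounded_mimg.
Qed.

Lemma rotsum_neq0 (n : nat) (c : R * 'M[R]_n -> R) K s : K !=set0 -> rotsum c K s !=set0.
Proof.
move=> [x Kx]; elim: s => [|p s [y hy]] /=; first by exists 0.
by exists (y + c p *: (p.2 *m x)), y, (c p *: (p.2 *m x)); split=> //; exists (p.2 *m x) => //; exists x.
Qed.

Lemma supp_rotsum (n : nat) (c : R * 'M[R]_n -> R) K s u : vbounded K -> K !=set0 ->
  (forall p, p \in s -> 0 <= c p) ->
  is_supp (rotsum c K s) u (\sum_(p <- s) c p * suppf K (p.2^T *m u)).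
Proof.
move=> bK nK; elim: s => [|p s IH] c0 /=; first by rewrite big_nil; exact: supp_set0.
rewrite big_cons addrC; apply: supp_msum; first by apply: IH => q qs; apply: c0; rewrite inE qs orbT.
apply: supp_scale; first by apply: c0; rewrite inE eqxx.
by apply: supp_mimg; exact: suppfP.
Qed.

Lemma lip_weight (n : nat) (c : 'M[R]_n -> R) (L2 M2 : R) : lipschitz c -> 0 <= L2 -> 0 <= M2 ->
  exists2 L', 0 <= L' & forall psi, lip L2 psi -> (forall g, orth g -> `|psi g| <= M2) ->
    lip L' (fun g => c g * psi g).
Proof.
move=> lc L20 M20; have [B B0 cB] := lipschitz_bounded lc; have [L1 L10 cL] := lc.
exists (B * L2 + L1 * M2); first by rewrite addr_ge0 ?mulr_ge0.
move=> psi lP bP g g' og og'.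
have -> : c g * psi g - c g' * psi g' = c g * (psi g - psi g') + (c g - c g') * psi g' by ring.
apply: le_trans (ler_normD _ _) _; rewrite !normrM mulrDl -mulrA.
apply: lerD; first by apply: ler_pM => //; [exact: cB | exact: lP].
by rewrite mulrAC; apply: ler_pM => //; [exact: cL | exact: bP].
Qed.

End Images.

Section Approx.
Variables (R : realType) (j l : nat).
Notation n := (j + l)%N.
Variables (i0 i1 : 'I_n).
Hypotheses (h0 : nat_of_ord i0 = 0%N) (h1 : nat_of_ord i1 = 1%N).
Implicit Types (g : 'M[R]_n) (x y a : 'cV[R]_n) (K : set 'cV[R]_n).
Notation e0 := (e0 R i0).

(** One quadrature rule [s] discretises both sides of [gen_zonoid]: the smoothed support function
    becomes that of the body [K'], and the density [q], split by sign, a difference of support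
    functions of two zonotopes. The bound [R0 = B / H] is independent of [eta], so the subtracted
    zonotope stays bounded while the error shrinks. *)
Lemma zonoid_approx K (delta : R) : convex K -> vbounded K -> K !=set0 -> symm K -> 0 < delta ->
  exists R0, forall eta, 0 < eta -> exists K' s s', [/\ convex K', K' `<=` fat delta K,
    K `<=` fat delta K' &
    [/\ zl s `<=` cube R0, msum K' (zl s) `<=` fat eta (zl s') &
        zl s' `<=` fat eta (msum K' (zl s))]].
Proof.
move=> cK bK nK sK delta0.
have [r r0 hr] := suppf_lip bK nK; pose h := suppf K.
have d8 : 0 < delta / 8 by rewrite divr_gt0.
have n0 : (0 < n)%N by apply: leq_trans (ltn_ord i0).
have [N [H0 HN]] := bump_peak n0 r0 d8; set H := haar _ in H0 HN.
have hr' x y : unitv x -> unitv y -> `|h x - h y| <= r * fn (x - y) by move=> _ _; exact: hr.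
have [q lq qE] := gen_zonoid h0 h1 N r0 (fun x => suppf_even x sK) hr'.
have [B B0 qB] := lipschitz_bounded lq.
have Mh : 0 <= r + `|h 0| by rewrite addr_ge0.
have hM u : unitv u -> `|h u| <= r + `|h 0|.
  move=> uu; have := hr u 0; rewrite subr0 fn_unit // mulr1 => k1.
  by have := ler_normD (h u - h 0) (h 0); rewrite subrK; move: k1; rewrite -/h; lra.
have [La La0 HLa] := lip_weight (lipschitz_bump R j l N) r0 Mh.
have [Lb Lb0 HLb] := lip_weight lq (@ler01 R) (@ler01 R).
exists (B / H) => eta eta0.
(* Two quadrature errors of [eta / 8] make the [eta / 4] demanded by [supp_sub]; likewise one of
   [delta / 8] is added to the peak error [delta / 8]. *)
pose m := Num.min (eta / 8) (delta / 8).
have m0 : 0 < m by rewrite lt_min d8 andbT divr_gt0.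
have m1 : m <= eta / 8 by rewrite ge_min lexx.
have m2 : m <= delta / 8 by rewrite ge_min lexx orbT.
have [s [s1 sp] Hs] := haar_riemann n (mulr_gt0 H0 m0) (addr_ge0 La0 Lb0).
have lu x : unitv x -> lip r (fun g => h (g^T *m x)) by move=> ux; apply: (lip_act h0 h1 r0 hr').
pose c (p : R * 'M[R]_n) := p.1 * bump N p.2 / H.
pose cp (p : R * 'M[R]_n) := p.1 * Num.max (q p.2) 0 / H.
pose cm (p : R * 'M[R]_n) := p.1 * Num.max (- q p.2) 0 / H.
pose A x := \sum_(p <- s) c p * h (p.2^T *m x).
pose Bp x := \sum_(p <- s) cp p * `|dotp x (p.2 *m e0)|.
pose Bm x := \sum_(p <- s) cm p * `|dotp x (p.2 *m e0)|.
have Hn : H != 0 by rewrite gt_eqF.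
have I1 x : unitv x -> `|H * A x - haar (fun g => bump N g * h (g^T *m x))| <= H * m.
  move=> ux.
  have -> : H * A x = avg s (fun g => bump N g * h (g^T *m x)) 1%:M.
    rewrite /A /avg mulr_sumr; apply: eq_bigr => p _; rewrite mulmx1 /c.
    by move: (bump _ _) (h _) => b1 b2; field.
  apply: Hs; last exact: orth1.
  apply: lip_mono (HLa _ (lu x ux) _); first by rewrite lerDl.
  by move=> g og; apply: hM; exact: unitvM (orthT og) ux.
have I2 x : unitv x -> `|H * (Bp x - Bm x) - haar (fun g => bump N g * h (g^T *m x))| <= H * m.
  move=> ux; rewrite qE //.
  have -> : H * (Bp x - Bm x) = avg s (fun g => q g * `|dotp x (g *m e0)|) 1%:M.
    rewrite /Bp /Bm /avg -sumrB mulr_sumr; apply: eq_bigr => p _; rewrite mulmx1 /cp /cm.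
    rewrite [in RHS](posneg_parts (q p.2)).
    by move: (Num.max (q _) _) (Num.max (- _) _) `|_| => b1 b2 b3; field.
  apply: Hs; last exact: orth1.
  apply: lip_mono (HLb (fun g => `|dotp x (g *m e0)|) _ _); first by rewrite lerDr.
    by move=> g g' og og'; apply: le_trans (lip_dotp i0 ux og og'); exact: ler_dist_dist.
  by move=> g og; rewrite normr_id dotp_le1 //; apply: unitvM => //; exact: unitv_e0.
have I3 x : unitv x -> `|haar (fun g => bump N g * h (g^T *m x)) - h x * H| <= delta / 8 * H.
  by move=> ux; have := HN _ (lu x ux); rewrite trmx1 mul1mx.
have AB x : unitv x -> `|A x - (Bp x - Bm x)| <= eta / 4.
  move=> ux; have := I1 x ux; have := I2 x ux; move: (haar _) => hh.
  rewrite distrC => k1 k2.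
  have := le_trans (ler_distD hh (H * A x) (H * (Bp x - Bm x))) (lerD k2 k1).
  rewrite -mulrBr -mulrDr normrM gtr0_norm // ler_pM2l // => /le_trans; apply; move: m1; lra.
have Ah x : unitv x -> `|A x - h x| <= delta / 4.
  move=> ux; have := I1 x ux; have := I3 x ux; move: (haar _) => hh k1 k2.
  have := le_trans (ler_distD hh (H * A x) (h x * H)) (lerD k2 k1).
  rewrite [h x * H]mulrC [_ * H]mulrC -mulrBr -mulrDr normrM gtr0_norm // ler_pM2l //.
  by move=> /le_trans; apply; move: m2; lra.
pose K' := rotsum c K s.
pose zp := [seq cp p *: (p.2 *m e0) | p <- s].
pose zm := [seq cm p *: (p.2 *m e0) | p <- s].
have c0 p : p \in s -> 0 <= c p.
  move=> /sp[p0 op]; rewrite /c mulr_ge0 ?invr_ge0 ?(ltW H0) // mulr_ge0 //.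
  by apply: exprn_ge0; exact: bump1_ge0.
have cp0 p : p \in s -> 0 <= cp p.
  by move=> /sp[p0 op]; rewrite /cp mulr_ge0 ?invr_ge0 ?(ltW H0) // mulr_ge0 // le_max lexx orbT.
have cm0 p : p \in s -> 0 <= cm p.
  by move=> /sp[p0 op]; rewrite /cm mulr_ge0 ?invr_ge0 ?(ltW H0) // mulr_ge0 // le_max lexx orbT.
have sz cc x : (forall p, p \in s -> 0 <= cc p) ->
    is_supp (zl [seq cc p *: (p.2 *m e0) | p <- s]) x (\sum_(p <- s) cc p * `|dotp x (p.2 *m e0)|).
  move=> cc0; have := supp_zl [seq cc p *: (p.2 *m e0) | p <- s] x.
  rewrite big_map; set a1 := (X in is_supp _ _ X); set a2 := (X in _ -> is_supp _ _ X).
  suff -> : a1 = a2 by [].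
  by apply: eq_big_seq => p ps; rewrite dotpZr normrM ger0_norm // cc0.
have cK' : convex K' by apply: convex_rotsum.
have bK' : vbounded K' by apply: vbounded_rotsum.
have nK' : K' !=set0 by apply: rotsum_neq0.
have sK' x : unitv x -> is_supp K' x (A x) by move=> _; exact: supp_rotsum.
have sKh x : unitv x -> is_supp K x (h x) by move=> _; exact: suppfP.
have sKm x : unitv x -> is_supp (msum K' (zl zm)) x (A x + Bm x).
  by move=> ux; apply: supp_msum; [exact: sK' | exact: sz].
have szp x : unitv x -> is_supp (zl zp) x (Bp x) by move=> _; exact: sz.
have cM : convex (msum K' (zl zm)) by apply: convex_msum => //; exact: convex_zl.
have bM : vbounded (msum K' (zl zm)) by apply: vbounded_msum => //; exact: vbounded_zl.
have nM : msum K' (zl zm) !=set0.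
  by have [x Kx] := nK'; exists x; apply: msum_subl => //; exact: zl0.
have nz : zl zp !=set0 by exists 0; exact: zl0.
exists K', zm, zp; split=> //.
- apply: (supp_sub cK bK nK delta0 sK' sKh) => x ux.
  by have := Ah x ux; rewrite ler_norml; lra.
- apply: (supp_sub cK' bK' nK' delta0 sKh sK') => x ux.
  by have := Ah x ux; rewrite ler_norml; lra.
split.
- move=> x zx i; apply: le_trans (zl_entry i zx) _; rewrite big_map.
  have -> : B / H = \sum_(p <- s) p.1 * (B / H) by rewrite -mulr_suml s1 mul1r.
  rewrite big_seq [leRHS]big_seq; apply: ler_sum => p ps; have [p0 op] := sp p ps.
  rewrite mxE normrM ger0_norm ?cm0 // -colE mxE.
  have g1 := orth_entry i i0 op; apply: le_trans (ler_piMr (cm0 p ps) g1) _.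
  rewrite /cm -mulrA ler_wpM2l // ler_wpM2r ?invr_ge0 ?(ltW H0) //.
  rewrite ge_max B0 andbT; apply: le_trans (qB _ op); rewrite -normrN; exact: ler_norm.
- apply: (supp_sub (@convex_zl _ _ zp) (@vbounded_zl _ _ zp) nz eta0 sKm szp) => x ux.
  by have := AB x ux; rewrite ler_norml; lra.
- apply: (supp_sub cM bM nM eta0 szp sKm) => x ux.
  by have := AB x ux; rewrite ler_norml; lra.
Qed.

End Approx.

(** * Extension of identities from zonotopes to symmetric bodies *)

Section Extension.
Variables (R : realType) (d : nat).
Implicit Types (K : set 'cV[R]_d) (F : set 'cV[R]_d -> R).

Lemma mscaleS K (i : nat) : convex K -> mscale i.+1%:R K = msum K (mscale i%:R K).
Proof.
move=> cK; apply/seteqP; split=> [_ [x Kx <-]|_ [x [_ [Kx [y Ky <-] ->]]]].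
  by exists x, (i%:R *: x); split=> //; [exists x | rewrite -natr1 scalerDl scale1r addrC].
have i0 : i.+1%:R != 0 :> R by rewrite pnatr_eq0.
exists (i.+1%:R^-1 *: x + (1 - i.+1%:R^-1) *: y).
  apply: cK => //; first by rewrite invr_ge0.
  by rewrite invf_le1 ?ltr0n // ler1n.
rewrite scalerDr !scalerA mulfV // mulrBr mulfV // mulr1 scale1r -natr1 addrK //.
Qed.

Lemma msum_cube (a b : R) : msum (cube a) (cube b) `<=` (cube (a + b) : set 'cV[R]_d).
Proof.
move=> _ [x [y [xa yb ->]]] i; rewrite mxE.
by apply: le_trans (ler_normD _ _) _; rewrite lerD.
Qed.

Lemma mscale_cube (c a : R) : 0 <= c -> mscale c (cube a) `<=` (cube (c * a) : set 'cV[R]_d).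
Proof. by move=> c0 _ [x xa <-] i; rewrite mxE normrM ger0_norm // ler_wpM2l. Qed.

Lemma cube_sub (a b : R) : a <= b -> cube a `<=` (cube b : set 'cV[R]_d).
Proof. by move=> ab x xa i; apply: le_trans ab. Qed.

Definition hlip F := forall M : R, exists2 C, 0 <= C & forall e K K', 0 < e -> e <= 1 ->
  convex K -> convex K' -> K `<=` cube M -> K' `<=` cube M ->
  K `<=` fat e K' -> K' `<=` fat e K -> `|F K - F K'| <= C * e.

(** Extrapolation to [r = 0] of a polynomial in [r] from its values on [K + r Z], [r = 1, ..., m],
    with weights common to all [K] and [Z]. *)
Definition zextrap F := exists m (beta : 'I_m -> R), forall K s, convex K -> vbounded K ->
  F K = \sum_i beta i * F (msum K (zl (map ( *:%R i.+1%:R) s))).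

End Extension.

Section Vanish.
Variables (R : realType) (j l : nat).
Notation n := (j + l)%N.
Variables (i0 i1 : 'I_n).
Hypotheses (h0 : nat_of_ord i0 = 0%N) (h1 : nat_of_ord i1 = 1%N).

(* Zonotopes are not dense among symmetric bodies, but K' + Z ~ Z' with
   zonotopes Z, Z' and K' close to K; [zextrap] then removes Z again. *)
Lemma symm_vanish (F : set 'cV[R]_n -> R) K : hlip F -> zextrap F -> (forall s, F (zl s) = 0) ->
  convex K -> vbounded K -> K !=set0 -> symm K -> F K = 0.
Proof.
move=> hF [m [beta FE]] Fz cK bK nK sK; have [M0 KM] := bK.
have [C0 C00 HC0] := hF (M0 + 1).
have fat_cube (e M : R) (A : set 'cV[R]_n) : e <= 1 -> A `<=` cube M -> fat e A `<=` cube (M + 1).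
  move=> e1 AM; apply: subset_trans (@msum_cube _ _ _ _).
  by apply: msum_sub => //; exact: cube_sub.
suff main delta : 0 < delta -> delta <= 1 -> `|F K| <= C0 * delta.
  apply/eqP; rewrite -normr_eq0 eq_le normr_ge0 andbT; apply/ler_addgt0Pr => e ep; rewrite add0r.
  pose de := Num.min 1 (e / (C0 + 1)).
  have C1 : 0 < C0 + 1 by rewrite ltr_wpDl.
  have de0 : 0 < de by rewrite lt_min ltr01 divr_gt0.
  apply: le_trans (main de de0 _) _; first by rewrite ge_min lexx.
  apply: le_trans (_ : (C0 + 1) * (e / (C0 + 1)) <= _); last by rewrite mulrC mulfVK // gt_eqF.
  by apply: ler_pM => //; [exact: ltW | rewrite lerDl | rewrite ge_min lexx orbT].
move=> delta0 delta1; have [R0 HR0] := zonoid_approx h0 h1 cK bK nK sK delta0.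
(* All sets compared below lie in [cube M1]. Since [R0] is independent of [eta], the Lipschitz
   constant [C1] can be fixed before [eta]. *)
pose M1 := M0 + 1 + 1 + m%:R * `|R0|.
have [C1 C10 HC1] := hF M1.
pose B := \sum_i `|beta i|.
have B0 : 0 <= B by rewrite sumr_ge0.
apply/ler_addgt0Pr => e ep.
pose eta := Num.min 1 (e / (B * C1 + 1)).
have BC : 0 <= B * C1 by rewrite mulr_ge0.
have BC1 : 0 < B * C1 + 1 by rewrite ltr_wpDl.
have eta0 : 0 < eta by rewrite lt_min ltr01 divr_gt0.
have eta1 : eta <= 1 by rewrite ge_min lexx.
have [K' [s [s' [cK' K'K KK' [sR ss' s's]]]]] := HR0 eta eta0.
have K'M : K' `<=` cube (M0 + 1) by apply: subset_trans K'K _; exact: fat_cube.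
have bK' : vbounded K' by exists (M0 + 1).
have k1 : `|F K - F K'| <= C0 * delta.
  by apply: HC0 => //; apply: subset_trans KM _; apply: cube_sub; rewrite lerDl.
have k2 : `|F K'| <= B * (C1 * eta).
  rewrite (FE K' s cK' bK') /B mulr_suml; apply: le_trans (ler_norm_sum _ _ _) _.
  apply: ler_sum => i _; rewrite normrM ler_wpM2l //.
  pose T := mscale i%:R (zl s).
  have cZ := @convex_zl _ _ s.
  have cT : convex T by apply: convex_mscale.
  (* [K' + (i+1) Z = (K' + Z) + i Z] is close to the zonotope [Z' + i Z], where [F] vanishes. *)
  have E1 : msum K' (zl (map ( *:%R i.+1%:R) s)) = msum (msum K' (zl s)) T.
    by rewrite -mscale_zl mscaleS // msumA.
  have Fz0 : F (msum (zl s') T) = 0 by rewrite /T mscale_zl -zl_cat Fz.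
  have R0' : zl s `<=` cube `|R0| by apply: subset_trans sR _; apply: cube_sub; exact: ler_norm.
  have TM : T `<=` cube (i%:R * `|R0|).
    by move=> _ [x /R0' xR <-]; apply: mscale_cube => //; exists x.
  have im : i%:R * `|R0| + `|R0| <= m%:R * `|R0|.
    by rewrite -[X in _ + X]mul1r -mulrDl natr1 ler_wpM2r // ler_nat.
  have KZM : msum K' (zl s) `<=` cube (M0 + 1 + `|R0|).
    by apply: subset_trans (@msum_cube _ _ _ _); apply: msum_sub.
  rewrite E1 -[F _]subr0 -Fz0; apply: HC1 => //.
  - by apply: convex_msum => //; exact: convex_msum.
  - by apply: convex_msum => //; exact: convex_zl.
  - apply: subset_trans (msum_sub KZM TM) _; apply: subset_trans (@msum_cube _ _ _ _) _.
    by apply: cube_sub; rewrite /M1; lra.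
  - apply: subset_trans (msum_sub (subset_trans s's (fat_cube _ _ _ eta1 KZM)) TM) _.
    apply: subset_trans (@msum_cube _ _ _ _) _.
    by apply: cube_sub; rewrite /M1; lra.
  - by rewrite /fat [X in _ `<=` X]msumAC; apply: msum_sub.
  - by rewrite /fat [X in _ `<=` X]msumAC; apply: msum_sub.
have k3 : B * (C1 * eta) <= e.
  rewrite mulrA; apply: le_trans (_ : (B * C1 + 1) * (e / (B * C1 + 1)) <= _); last first.
    by rewrite mulrC mulfVK // gt_eqF.
  by apply: ler_pM => //; [exact: ltW | rewrite lerDl | rewrite ge_min lexx orbT].
have := ler_normD (F K - F K') (F K'); rewrite subrK; move: k1 k2 k3; lra.
Qed.

End Vanish.

(** * Averaged mixed volumes *)

Lemma Vol_hlip (R : realType) (d : nat) (M : R) : exists2 C, 0 <= C & forall e (K L : set 'cV[R]_d),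
  0 <= e -> convex K -> convex L -> K `<=` cube M -> L `<=` cube M ->
  K `<=` fat e L -> L `<=` fat e K -> `|Vol K - Vol L| <= C * e.
Proof.
pose V := Vol (cube (M + 1) : set 'cV[R]_d); pose C := (2 * d%:R + 1) * V.
have V0 : 0 <= V := Vol_ge0 _.
have d0 : 0 <= 2 * d%:R :> R by rewrite mulr_ge0.
have C0 : 0 <= C by rewrite mulr_ge0 // addr_ge0.
have vc (a : R) : vbounded (cube a : set 'cV[R]_d) by exists a.
have half e (K L : set 'cV[R]_d) : 0 < e -> convex L -> K `<=` cube M -> L `<=` cube M ->
    K `<=` fat e L -> Vol K - Vol L <= C * e.
  move=> e0 cL KM LM KL; have bL : vbounded L by exists M.
  have [e1|e1] := leP e 1.
    have := Vol_lip e0 e1 cL bL KL.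
    have : Vol (fat 1 L) <= V.
      apply: Vol_le => //; apply: subset_trans (@msum_cube _ _ _ _); exact: msum_sub.
    move=> /(ler_wpM2l (mulr_ge0 d0 (ltW e0))) k1 k2.
    have := mulr_ge0 V0 (ltW e0); rewrite /C mulrDl mul1r; move: k1 k2.
    by move: (Vol K) (Vol L) (Vol _) (V) d%:R => *; lra.
  have k1 : Vol K <= V by apply: Vol_le => //; apply: subset_trans KM _; apply: cube_sub; rewrite lerDl.
  have k2 := Vol_ge0 L.
  apply: le_trans (_ : V * 1 <= _); first by rewrite mulr1; lra.
  by apply: ler_pM => //; [rewrite /C mulrDl mul1r lerDr mulr_ge0 | exact: ltW].
exists C => // e K L e0 cK cL KM LM KL LK; apply/ler_addgt0Pr => a a0.
(* The one-sided bound [half] wants a positive distance; [e = 0] is reached by adding an arbitrarily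
   small [b]. *)
pose b := a / (C + 1); have C1 : 0 < C + 1 by rewrite ltr_wpDl.
have b0 : 0 < b by rewrite divr_gt0.
have Cb : C * b <= a.
  rewrite -[leRHS](@mulfVK _ (C + 1)) ?gt_eqF // -/b mulrC ler_wpM2l ?(ltW b0) //.
  by rewrite lerDl.
have eb : 0 < e + b by rewrite ltr_wpDl.
have fe (A : set 'cV[R]_d) : fat e A `<=` fat (e + b) A by apply: fat_sub => //; rewrite lerDl ltW.
have k1 := half _ _ _ eb cL KM LM (subset_trans KL (fe L)).
have k2 := half _ _ _ eb cK LM KM (subset_trans LK (fe K)).
move: k1 k2; rewrite mulrDr ler_norml => *; apply/andP; split; lra.
Qed.

Section Psi.
Variables (R : realType) (n d : nat).
Implicit Types (X Y : 'M[R]_(d, n)) (K L : set 'cV[R]_n).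

(** Covers both kinds of data: [X = r g], [Y = 1] gives the dilated sums behind mixed volumes, and
    [Y = 0] the volumes of projections. *)
Definition Psi X Y K L : R := Vol (msum (mimg X K) (mimg Y L)).

Lemma PsiC X Y K L : Psi X Y K L = Psi Y X L K.
Proof. by rewrite /Psi msumC. Qed.

Lemma mimg_msum X K L : mimg X (msum K L) = msum (mimg X K) (mimg X L).
Proof.
apply/seteqP; split=> [_ [_ [x [y [Kx Ly ->]]] <-]|_ [_ [_ [[x Kx <-] [y Ly <-] ->]]]].
  by exists (X *m x), (X *m y); rewrite mulmxDr; split=> //; [exists x | exists y].
by exists (x + y); [exists x, y | rewrite mulmxDr].
Qed.

Lemma mimg_seg X v : mimg X (seg v) = seg (X *m v).
Proof.
apply/seteqP; split=> [_ [_ [t t1 ->] <-]|_ [t t1 ->]].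
  by exists t; rewrite // scalemxAr.
by exists (t *: v); [exists t | rewrite scalemxAr].
Qed.

Lemma mimg_0 X : mimg X [set 0] = [set 0].
Proof.
by apply/seteqP; split=> [_ [_ -> <-]|_ ->]; [rewrite /= mulmx0 | exists 0; rewrite // mulmx0].
Qed.

Lemma mimg_zl X s : mimg X (zl s) = zl (map (mulmx X) s).
Proof. by elim: s => [|v s IH] /=; [exact: mimg_0 | rewrite mimg_msum mimg_seg IH]. Qed.

Lemma mimg_cl m X (A : 'M[R]_(n, m)) : map (mulmx X) (cl A) = cl (X *m A).
Proof. by rewrite /cl -map_comp; apply: eq_map => i /=; rewrite !colE mulmxA. Qed.

Lemma mimg_cube X (b M : R) K : 0 <= b -> (forall i k, `|X i k| <= b) ->
  K `<=` cube M -> mimg X K `<=` cube (n%:R * (b * `|M|)).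
Proof.
move=> b0 Xb KM _ [x /KM xM <-] i; rewrite mxE; apply: le_trans (ler_norm_sum _ _ _) _.
rewrite -[X in X%:R * _](card_ord n) mulr_natl -sumr_const; apply: ler_sum => k _.
rewrite normrM; apply: ler_pM => //; apply: le_trans (xM k) _; exact: ler_norm.
Qed.

Lemma mimg_fat X X' (b M e : R) K K' : 0 <= b -> 0 <= e -> (forall i k, `|X' i k| <= b) ->
  (forall i k, `|X i k - X' i k| <= e) -> K `<=` cube M -> K `<=` fat e K' ->
  mimg X K `<=` fat (n%:R * (e * `|M| + b * e)) (mimg X' K').
Proof.
move=> b0 e0 Xb Xe KM KK' _ [x Kx <-]; apply/fatE.
have /fatE[x' Kx' xx'] := KK' x Kx; exists (X' *m x'); first by exists x'.
move=> i; rewrite !mxE -sumrB; apply: le_trans (ler_norm_sum _ _ _) _.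
rewrite -[X in X%:R * _](card_ord n) mulr_natl -sumr_const; apply: ler_sum => k _.
have -> : X i k * x k 0 - X' i k * x' k 0 =
  (X i k - X' i k) * x k 0 + X' i k * (x k 0 - x' k 0) by ring.
apply: le_trans (ler_normD _ _) _; rewrite !normrM; apply: lerD; apply: ler_pM => //.
by apply: le_trans (KM x Kx k) _; exact: ler_norm.
Qed.

Lemma msum_fat (a b : R) (A B A' B' : set 'cV[R]_d) : A `<=` fat a A' -> B `<=` fat b B' ->
  msum A B `<=` fat (a + b) (msum A' B').
Proof.
move=> AA BB; apply: subset_trans (msum_sub AA BB) _; rewrite /fat.
have -> : msum (msum A' (cube a)) (msum B' (cube b)) = msum (msum A' B') (msum (cube a) (cube b)).
  by rewrite msumA (msumAC A' _ B') msumA.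
by apply: msum_sub => //; exact: msum_cube.
Qed.

Lemma Psi_lip (b M : R) : 0 <= b -> exists2 C, 0 <= C & forall e X X' Y Y' K K' L L', 0 <= e ->
  [/\ forall i k, `|X i k| <= b, forall i k, `|X' i k| <= b,
      forall i k, `|Y i k| <= b & forall i k, `|Y' i k| <= b] ->
  (forall i k, `|X i k - X' i k| <= e) -> (forall i k, `|Y i k - Y' i k| <= e) ->
  [/\ convex K, convex K', convex L & convex L'] ->
  [/\ K `<=` cube M, K' `<=` cube M, L `<=` cube M & L' `<=` cube M] ->
  [/\ K `<=` fat e K', K' `<=` fat e K, L `<=` fat e L' & L' `<=` fat e L] ->
  `|Psi X Y K L - Psi X' Y' K' L'| <= C * e.
Proof.
move=> b0; pose M1 := n%:R * (b * `|M|) + n%:R * (b * `|M|).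
have [C C0 HC] := @Vol_hlip R d M1.
pose c := n%:R * (`|M| + b) + n%:R * (`|M| + b).
have c0 : 0 <= c by rewrite addr_ge0 // mulr_ge0 // addr_ge0.
exists (C * c); first exact: mulr_ge0.
move=> e X X' Y Y' K K' L L' e0 [X1 X2 Y1 Y2] Xe Ye [k1 k2 k3 k4] [m1 m2 m3 m4] [f1 f2 f3 f4].
have Xe' i k : `|X' i k - X i k| <= e by rewrite distrC.
have Ye' i k : `|Y' i k - Y i k| <= e by rewrite distrC.
have ce : c * e = n%:R * (e * `|M| + b * e) + n%:R * (e * `|M| + b * e) by rewrite /c; ring.
rewrite -mulrA; apply: HC.
- exact: mulr_ge0.
- by apply: convex_msum; exact: convex_mimg.
- by apply: convex_msum; exact: convex_mimg.
- by apply: subset_trans (@msum_cube _ _ _ _); apply: msum_sub; exact: mimg_cube.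
- by apply: subset_trans (@msum_cube _ _ _ _); apply: msum_sub; exact: mimg_cube.
- by rewrite ce; apply: msum_fat; exact: mimg_fat.
- by rewrite ce; apply: msum_fat; exact: mimg_fat.
Qed.

Lemma seg2_Psi X Y L : convex L -> vbounded L -> seg2 (fun K => Psi X Y K L).
Proof.
move=> cL bL K v cK bK; rewrite /Psi !mimg_msum !mimg_seg -scalemxAr.
rewrite (msumAC (mimg X K)) [in RHS](msumAC (mimg X K)); apply: seg2_Vol.
  by apply: convex_msum; exact: convex_mimg.
by apply: vbounded_msum; exact: vbounded_mimg.
Qed.

Lemma Psi_poly X Y K L s : convex K -> vbounded K -> convex L -> vbounded L ->
  exists2 P : {poly R}, (size P <= d.+1)%N &
    forall N : nat, Psi X Y (msum K (zl (map ( *:%R N%:R) s))) L = P.[N%:R].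
Proof.
move=> cK bK cL bL.
have [||P sP PE] := @Vol_poly R d (msum (mimg X K) (mimg Y L)) (map (mulmx X) s).
- by apply: convex_msum; exact: convex_mimg.
- by apply: vbounded_msum; exact: vbounded_mimg.
exists P => // N; rewrite -PE /Psi mimg_msum mimg_zl msumAC -!map_comp.
by congr (Vol (msum _ (zl _))); apply: eq_map => v /=; rewrite scalemxAr.
Qed.

End Psi.

Lemma haar_norm_le (R : realType) (n : nat) (f : 'M[R]_n -> R) (c : R) : lipschitz f ->
  (forall g, orth g -> `|f g| <= c) -> `|haar f| <= c.
Proof.
move=> lf fc; have h g : orth g -> - c <= f g /\ f g <= c.
  by move=> og; have := fc g og; rewrite ler_norml => /andP.
rewrite ler_norml -{1}(haar_cst n (- c)) -{2}(haar_cst n c); apply/andP.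
by split; apply: haar_le => //; try exact: lip_cst; move=> g /h[].
Qed.

Section Nice.
Variables (R : realType) (n : nat) (beta0 : 'I_n.+1 -> R).
Hypothesis beta0P : forall P : {poly R}, (size P <= n.+1)%N -> P`_0 = \sum_r beta0 r * P.[r.+1%:R].
Implicit Types (Phi : 'M[R]_n -> set 'cV[R]_n -> R) (K L : set 'cV[R]_n).

Definition zext (F : set 'cV[R]_n -> R) := forall K s, convex K -> vbounded K ->
  F K = \sum_i beta0 i * F (msum K (zl (map ( *:%R i.+1%:R) s))).

(* Family of functionals, indexed by rotations, that can be averaged and to
   which the vanishing lemmas for zonotopes and symmetric bodies apply. *)
Definition niceF Phi := [/\ forall K, convex K -> vbounded K -> lipschitz (Phi^~ K),
  forall g, orth g -> seg2 (Phi g), forall g, orth g -> zext (Phi g) &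
  forall M : R, exists2 C, 0 <= C & forall g e K K', orth g -> 0 < e -> e <= 1 ->
    convex K -> convex K' -> K `<=` cube M -> K' `<=` cube M ->
    K `<=` fat e K' -> K' `<=` fat e K -> `|Phi g K - Phi g K'| <= C * e].

Lemma nice_lin (a : R) Phi Phi' : niceF Phi -> niceF Phi' ->
  niceF (fun g K => a * Phi g K + Phi' g K).
Proof.
move=> [l1 s1 z1 h1] [l2 s2 z2 h2]; split.
- by move=> K cK bK; apply: lipschitzD; [apply: lipschitzZ; exact: l1 | exact: l2].
- move=> g og K v cK bK; set A := msum _ _; set B := msum _ (seg v).
  have -> : a * Phi g A + Phi' g A + (a * Phi g K + Phi' g K) =
    a * (Phi g A + Phi g K) + (Phi' g A + Phi' g K) by ring.
  by rewrite s1 // s2 // -/B; ring.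
- move=> g og K s cK bK; rewrite (z1 g og K s) // (z2 g og K s) // mulr_sumr -big_split.
  by apply: eq_bigr => i _ /=; ring.
- move=> M; have [C C0 H] := h1 M; have [C' C'0 H'] := h2 M.
  exists (`|a| * C + C'); first by rewrite addr_ge0 // mulr_ge0.
  move=> g e K K' og e0 e1 cK cK' KM KM' KK KK'.
  have k1 := H g e K K' og e0 e1 cK cK' KM KM' KK KK'.
  have k2 := H' g e K K' og e0 e1 cK cK' KM KM' KK KK'.
  have -> : a * Phi g K + Phi' g K - (a * Phi g K' + Phi' g K') =
     a * (Phi g K - Phi g K') + (Phi' g K - Phi' g K') by ring.
  apply: le_trans (ler_normD _ _) _; rewrite normrM mulrDl -mulrA lerD //.
  by rewrite ler_wpM2l.
Qed.

Lemma nice_0 : niceF (fun _ _ => 0).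
Proof.
split.
- by move=> *; exact: lip_cst.
- by move=> g _ K v _ _; rewrite addr0 mulr0.
- by move=> g _ K s _ _; rewrite big1 // => i _; rewrite mulr0.
- by move=> M; exists 0 => // *; rewrite subrr normr0 mul0r.
Qed.

Lemma nice_sum m (c : 'I_m -> R) (Phi : 'I_m -> 'M[R]_n -> set 'cV[R]_n -> R) :
  (forall i, niceF (Phi i)) -> niceF (fun g K => \sum_i c i * Phi i g K).
Proof.
move=> nP.
suff H (r : seq 'I_m) : niceF (fun g K => \sum_(i <- r) c i * Phi i g K) by exact: H.
elim: r => [|i r IH].
  have -> : (fun g K => \sum_(i <- [::]) c i * Phi i g K) = (fun _ _ => 0).
    by apply/funext => g; apply/funext => K; rewrite big_nil.
  exact: nice_0.
have -> : (fun g K => \sum_(k <- i :: r) c k * Phi k g K) =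
    (fun g K => c i * Phi i g K + \sum_(k <- r) c k * Phi k g K).
  by apply/funext => g; apply/funext => K; rewrite big_cons.
exact: nice_lin.
Qed.

Lemma nice_haar Phi w : niceF Phi -> lipschitz w ->
  niceF (fun _ K => haar (fun g => w g * Phi g K)).
Proof.
move=> [l1 s1 z1 h1] lw.
have lwP K : convex K -> vbounded K -> lipschitz (fun g => w g * Phi g K).
  by move=> cK bK; apply: lipschitzM => //; exact: l1.
split.
- by move=> *; exact: lip_cst.
- move=> _ _ K v cK bK.
  have KS u : lipschitz (fun g => w g * Phi g (msum K (seg u))).
    by apply: lwP; [apply: convex_msum => //; exact: convex_seg |
      apply: vbounded_msum => //; exact: vbounded_seg].
  have lK := lwP K cK bK.
  rewrite -haarD // -haarZ //; apply: haar_eq; first exact: lipschitzD.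
    exact: lipschitzZ.
  by move=> g og; rewrite -mulrDr s1 //; ring.
- move=> _ _ K s cK bK.
  have KS t : lipschitz (fun g => w g * Phi g (msum K (zl t))).
    by apply: lwP; [apply: convex_msum => //; exact: convex_zl |
      apply: vbounded_msum => //; exact: vbounded_zl].
  transitivity (haar (fun g => \sum_i beta0 i *
      (w g * Phi g (msum K (zl (map ( *:%R i.+1%:R) s)))))).
    apply: haar_eq; first exact: lwP.
      by apply: lipschitz_sum => i; exact: lipschitzZ.
    by move=> g og; rewrite (z1 g og K s) // mulr_sumr; apply: eq_bigr => i _; ring.
  rewrite haar_sum; last by move=> i; exact: lipschitzZ.
  by apply: eq_bigr => i _; rewrite haarZ.
- move=> M; have [C C0 H] := h1 M; have [B B0 wB] := lipschitz_bounded lw.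
  exists (B * C); first exact: mulr_ge0.
  move=> _ e K K' _ e0 e1 cK cK' KM KM' KK KK'.
  have bK : vbounded K by exists M.
  have bK' : vbounded K' by exists M.
  have lK := lwP K cK bK; have lK' := lwP K' cK' bK'.
  rewrite -haarB //; apply: haar_norm_le; first exact: lipschitzB.
  move=> g og; rewrite -mulrBr normrM -mulrA; apply: ler_pM => //; first exact: wB.
  exact: H.
Qed.

Lemma nice_Psi d (X Y : 'M[R]_n -> 'M[R]_(d, n)) (b : R) L : (d <= n)%N -> 0 <= b ->
  convex L -> vbounded L ->
  (forall g i k, orth g -> `|X g i k| <= b) -> (forall g i k, orth g -> `|Y g i k| <= b) ->
  (forall g g' i k, orth g -> orth g' -> `|X g i k - X g' i k| <= b * fn (g - g')) ->
  (forall g g' i k, orth g -> orth g' -> `|Y g i k - Y g' i k| <= b * fn (g - g')) ->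
  niceF (fun g K => Psi (X g) (Y g) K L).
Proof.
move=> dn b0 cL bL Xb Yb Xl Yl; have [ML LM] := bL.
have sub_fat (e : R) (A : set 'cV[R]_n) : 0 <= e -> A `<=` fat e A.
  by move=> e0; apply: msum_subl => i; rewrite mxE normr0.
have maxc (M M' : R) (A : set 'cV[R]_n) : A `<=` cube M -> M <= M' -> A `<=` cube M'.
  by move=> AM MM; apply: subset_trans AM _; exact: cube_sub.
split.
- move=> K cK [MK KM]; pose M := Num.max MK ML.
  have KM' : K `<=` cube M by apply: maxc KM _; rewrite le_max lexx.
  have LM' : L `<=` cube M by apply: maxc LM _; rewrite le_max lexx orbT.
  have [C C0 HC] := @Psi_lip R n d b M b0.
  exists (C * b); first exact: mulr_ge0.
  move=> g g' og og'; rewrite -mulrA; have e0 : 0 <= b * fn (g - g') by rewrite mulr_ge0 // fn_ge0.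
  apply: HC => //; try (by move=> i k; apply: Xl); try (by move=> i k; apply: Yl).
    by split=> i k; try exact: Xb; exact: Yb.
  by split; exact: sub_fat.
- by move=> g og; exact: seg2_Psi.
- move=> g og K s cK bK; have [P sP PE] := Psi_poly (X g) (Y g) s cK bK cL bL.
  have sP' : (size P <= n.+1)%N by apply: leq_trans sP _; rewrite ltnS.
  (* A summand dilated by 0 disappears, so the constant coefficient is the value at [K] itself. *)
  have K0 : msum K (zl (map ( *:%R 0%:R) s)) = K.
    have -> : zl (map ( *:%R 0%:R) s) = [set 0] :> set 'cV[R]_n; last by rewrite msum0.
    rewrite -mscale_zl; apply/seteqP; split=> [_ [x _ <-]|_ ->]; first by rewrite /= scale0r.
    by exists 0; [exact: zl0 | rewrite scaler0].
  have := beta0P sP'; rewrite -horner_coef0 -[X in P.[X]](mulr0n 1) -PE K0 => ->.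
  by apply: eq_bigr => i _; rewrite PE.
- move=> M0; pose M := Num.max M0 ML.
  have LM' : L `<=` cube M by apply: maxc LM _; rewrite le_max lexx orbT.
  have [C C0 HC] := @Psi_lip R n d b M b0.
  exists C => // g e K K' og e0 e1 cK cK' KM KM' KK KK'.
  apply: HC => //.
  + exact: ltW.
  + by split=> i k; try exact: Xb; exact: Yb.
  + by move=> i k; rewrite subrr normr0 ltW.
  + by move=> i k; rewrite subrr normr0 ltW.
  + by split=> //; [apply: maxc KM _ | apply: maxc KM' _]; rewrite le_max lexx.
  + by split=> //; apply: sub_fat; exact: ltW.
Qed.

Lemma nice_hlip F : niceF (fun=> F) -> hlip F.
Proof.
move=> [_ _ _ h] M; have [C C0 H] := h M; exists C => // e K K' *.
by apply: (H 1%:M) => //; exact: orth1.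
Qed.

Lemma nice_zextrap F : niceF (fun=> F) -> zextrap F.
Proof. by move=> [_ _ z _]; exists n.+1, beta0; apply: (z 1%:M); exact: orth1. Qed.

Lemma nice_seg2 F : niceF (fun=> F) -> seg2 F.
Proof. by move=> [_ s _ _]; apply: (s 1%:M); exact: orth1. Qed.

End Nice.

Section Columns.
Variables (R : realType) (d : nat).

Lemma nth_cl m (A : 'M[R]_(d, m)) (i : 'I_m) : nth 0 (cl A) i = col i A.
Proof. by rewrite /cl (nth_map i) ?size_enum_ord // nth_ord_enum. Qed.

Lemma cl_row_mx m p (A : 'M[R]_(d, m)) (B : 'M[R]_(d, p)) : cl (row_mx A B) = cl A ++ cl B.
Proof.
apply: (@eq_from_nth _ 0); first by rewrite size_cat !size_cl.
move=> k; rewrite size_cl => kmp; rewrite nth_cat size_cl.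
have -> : nth 0 (cl (row_mx A B)) k = col (Ordinal kmp) (row_mx A B) by rewrite -nth_cl.
case: ltnP => [km|mk].
  have -> : Ordinal kmp = lshift p (Ordinal km) by apply/val_inj.
  by rewrite colKl -nth_cl.
have kp : (k - m < p)%N by rewrite ltn_subLR.
have -> : Ordinal kmp = rshift m (Ordinal kp) by apply/val_inj; rewrite /= subnKC.
by rewrite colKr -nth_cl.
Qed.

Lemma ex_cl (s : seq 'cV[R]_d) m : size s = m -> exists A : 'M[R]_(d, m), s = cl A.
Proof.
move=> sm; exists (\matrix_(i, k) (nth 0 s k) i 0).
apply: (@eq_from_nth _ 0); first by rewrite size_cl.
move=> k; rewrite sm => km; rewrite (nth_cl _ (Ordinal km)).
by apply/colP => i; rewrite !mxE.
Qed.

End Columns.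

Lemma det_orth (R : realType) n (g : 'M[R]_n) : orth g -> `|\det g| = 1.
Proof.
move=> og; have := congr1 determinant og; rewrite det_mulmx det_tr det1 => h.
by apply/eqP; rewrite -(@eqrXn2 _ 2) ?nnegrE // expr1n real_normK ?num_real // expr2 h.
Qed.

Lemma mimg_scale (R : realType) (d n : nat) (X : 'M[R]_(d, n)) (c : R) K :
  mimg X (mscale c K) = mscale c (mimg X K).
Proof.
apply/seteqP; split=> [_ [_ [x Kx <-] <-]|_ [_ [x Kx <-] <-]].
  by exists (X *m x); [exists x | rewrite scalemxAr].
by exists (c *: x); [exists x | rewrite scalemxAr].
Qed.

Lemma Psi_scale2 (R : realType) (d n : nat) (X Y : 'M[R]_(d, n)) K L :
  vbounded K -> vbounded L -> Psi X Y (mscale 2 K) (mscale 2 L) = 2 ^+ d * Psi X Y K L.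
Proof.
move=> bK bL; rewrite /Psi !mimg_scale -mscale_msum Vol_scale2 //.
by apply: vbounded_msum; exact: vbounded_mimg.
Qed.

Lemma haar_weight_scale (R : realType) n (w f f' : 'M[R]_n -> R) (c : R) :
  lipschitz w -> lipschitz f -> lipschitz f' ->
  (forall g, orth g -> f g = c * f' g) ->
  haar (fun g => w g * f g) = c * haar (fun g => w g * f' g).
Proof.
move=> lw lf lf' E; rewrite -haarZ; last exact: lipschitzM.
apply: haar_eq; first exact: lipschitzM.
  by apply: lipschitzZ; exact: lipschitzM.
by move=> g og; rewrite E // mulrCA.
Qed.

(** * The averaged formula for mixed volumes in terms of projections *)

Section Crofton.
Variables (R : realType) (j l : nat).
Notation n := (j + l)%N.
Variables (i0 i1 : 'I_n).
Hypotheses (h0 : nat_of_ord i0 = 0%N) (h1 : nat_of_ord i1 = 1%N).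
Variables (beta beta0 : 'I_n.+1 -> R).
Hypothesis betaP : forall P : {poly R}, (size P <= n.+1)%N -> P`_j = \sum_r beta r * P.[r.+1%:R].
Hypothesis beta0P : forall P : {poly R}, (size P <= n.+1)%N -> P`_0 = \sum_r beta0 r * P.[r.+1%:R].
Implicit Types (g : 'M[R]_n) (K M : set 'cV[R]_n).

Notation kap d := (Vol (cube 1 : set 'cV[R]_d)).

(* [beta] extracts the coefficient of r^j, so this is binom(n,j) V(gK[j], M[n-j]). *)
Definition mixG g K M : R := \sum_r beta r * Psi (r.+1%:R *: g) 1%:M K M.
Definition projU g K : R := Psi (usubmx g) 0 K [set 0].
Definition projD g K : R := Psi (dsubmx g) 0 K [set 0].

Lemma coef_dilate (P : {poly R}) : (size P <= n.+1)%N ->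
  \sum_r beta r * P.[(2 * r.+1)%:R] = 2 ^+ j * \sum_r beta r * P.[r.+1%:R].
Proof.
move=> sP; pose P2 := \poly_(i < n.+1) (2 ^+ i * P`_i).
rewrite -betaP //.
have -> : 2 ^+ j * P`_j = P2`_j by rewrite coef_poly ltnS leq_addr.
rewrite (betaP (size_poly _ _)); apply: eq_bigr => r _; congr (_ * _).
rewrite horner_poly (horner_coef_wide _ sP); apply: eq_bigr => i _.
by rewrite natrM exprMn; ring.
Qed.

Lemma Psi_zl_poly g s M : convex M -> vbounded M -> exists2 P : {poly R}, (size P <= n.+1)%N &
  forall c N : nat, Psi (N%:R *: g) 1%:M (zl (map ( *:%R c%:R) s)) M = P.[(c * N)%:R].
Proof.
move=> cM bM; have [||P sP PE] := @Vol_poly R n (mimg 1%:M M) (map (mulmx g) s).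
- exact: convex_mimg.
- exact: vbounded_mimg.
exists P => // c N; rewrite -PE /Psi mimg_zl msumC -!map_comp.
congr (Vol (msum _ (zl _))); apply: eq_map => v /=.
by rewrite -scalemxAl -scalemxAr scalerA natrM mulrC.
Qed.

Lemma zl_scale1 (s : seq 'cV[R]_n) : zl (map ( *:%R 1%:R) s) = zl s.
Proof. by rewrite -[in RHS](map_id s); congr zl; apply: eq_map => v; rewrite scale1r. Qed.

Lemma mixG_hom_l g s M : convex M -> vbounded M ->
  mixG g (zl (map ( *:%R 2) s)) M = 2 ^+ j * mixG g (zl s) M.
Proof.
move=> cM bM; have [P sP PE] := Psi_zl_poly g s cM bM.
rewrite /mixG; under eq_bigr do rewrite (PE 2%N).
rewrite coef_dilate //; congr (_ * _); apply: eq_bigr => r _.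
by rewrite -(zl_scale1 s) PE mul1n.
Qed.

(** Joint doubling scales by [2^(j+l)], and [mixG_hom_l] accounts for [2^j] of it. *)
Lemma mixG_hom_r g s t : mixG g (zl s) (zl (map ( *:%R 2) t)) = 2 ^+ l * mixG g (zl s) (zl t).
Proof.
have p0 : 2 ^+ j != 0 :> R by rewrite expf_neq0 // pnatr_eq0.
apply: (mulfI p0); rewrite -mixG_hom_l; [|exact: convex_zl|exact: vbounded_zl].
rewrite mulrA -exprD /mixG mulr_sumr; apply: eq_bigr => r _.
by rewrite -!mscale_zl Psi_scale2; [ring|exact: vbounded_zl|exact: vbounded_zl].
Qed.

Lemma proj_hom d (X : 'M[R]_(d, n)) s :
  Psi X 0 (zl (map ( *:%R 2) s)) [set 0] = 2 ^+ d * Psi X 0 (zl s) [set 0].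
Proof.
rewrite -Psi_scale2; [|exact: vbounded_zl|exact: vbounded_set0].
rewrite mscale_zl; congr (Psi _ _ _ _).
by apply/seteqP; split=> [_ ->|_ [_ -> <-]]; [exists 0; rewrite // scaler0 | rewrite /= scaler0].
Qed.

(** The columns of [r g A] and [B] are [n] segments in all, so the volume is the monomial [c r^j],
    and [beta] returns [c]. *)
Lemma mixG_det g (A : 'M[R]_(n, j)) (B : 'M[R]_(n, l)) :
  mixG g (zl (cl A)) (zl (cl B)) = `|\det (row_mx (g *m A) B)| * kap n.
Proof.
pose c := `|\det (row_mx (g *m A) B)| * kap n.
have E r : Psi (r.+1%:R *: g) 1%:M (zl (cl A)) (zl (cl B)) = (c *: 'X^j).[r.+1%:R].
  rewrite /Psi !mimg_zl !mimg_cl mul1mx -zl_cat -cl_row_mx Vol_det hornerZ hornerXn /c.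
  have -> : row_mx (r.+1%:R *: g *m A) B =
     row_mx (g *m A) B *m block_mx (r.+1%:R)%:M 0 0 1%:M :> 'M[R]_(n, j + l).
    by rewrite mul_row_block !mulmx0 addr0 add0r mulmx1 mul_mx_scalar scalemxAl.
  rewrite det_mulmx det_ublock det_scalar det1 mulr1 normrM normrX.
  by rewrite normr_nat mulrAC.
rewrite /mixG; under eq_bigr do rewrite E.
rewrite -betaP; first by rewrite coefZ coefXn eqxx mulr1.
apply: leq_trans (size_scale_leq _ _) _; by rewrite size_polyXn ltnS leq_addr.
Qed.

Lemma proj_det d (X : 'M[R]_(d, n)) (A : 'M[R]_(n, d)) :
  Psi X 0 (zl (cl A)) [set 0] = `|\det (X *m A)| * kap d.
Proof. by rewrite /Psi mimg_0 msum0 mimg_zl mimg_cl Vol_det. Qed.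

Variables (p : 'M[R]_n -> R) (r : nat) (q q' : nat -> 'M[R]_n -> R).
Hypotheses (lp : lipschitz p) (lq : forall k, lipschitz (q k)) (lq' : forall k, lipschitz (q' k)).

(** The error in the averaged formula. On segments [mixG] carries the constant [kap n], the
    projections carry [kap j] and [kap l]; crosswise multiplication balances them without their
    values. [projD] takes [g^T] because in [minor (y *m g)] the rotation reaches [y] through its
    transpose. *)
Definition defect K M : R :=
  (kap j * kap l) * haar (fun g => p g * mixG g K M) +
  \sum_(k < r) (- kap n * haar (fun g => q' k g * projD g^T M)) * haar (fun g => q k g * projU g K).

Let nat_entry (N : 'I_n.+1) g i k : orth g -> `|(N.+1%:R *: g) i k| <= n.+1%:R.
Proof.
move=> og; rewrite mxE normrM normr_nat -[leRHS]mulr1; apply: ler_pM => //.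
  by rewrite ler_nat.
exact: orth_entry.
Qed.

Let nat_lip (N : 'I_n.+1) g g' i k : `|(N.+1%:R *: g) i k - (N.+1%:R *: g') i k| <= n.+1%:R * fn (g - g').
Proof.
rewrite !mxE -mulrBr normrM normr_nat; apply: ler_pM => //; first by rewrite ler_nat.
by have := fn_entry (g - g') i k; rewrite !mxE.
Qed.

Let one_entry i k : `|(1%:M : 'M[R]_n) i k| <= n.+1%:R.
Proof. by rewrite mxE; case: (i == k); rewrite ?normr1 ?normr0 ?ler1n. Qed.

Lemma nice_mixG_l M : convex M -> vbounded M -> niceF beta0 (fun g K => mixG g K M).
Proof.
move=> cM bM; apply: nice_sum => N.
apply: (@nice_Psi _ _ _ beta0P n (fun g => N.+1%:R *: g) (fun=> 1%:M) n.+1%:R).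
- exact: leqnn.
- exact: ler0n.
- exact: cM.
- exact: bM.
- by move=> g i k; exact: nat_entry.
- by move=> g i k _; exact: one_entry.
- by move=> g g' i k _ _; exact: nat_lip.
- by move=> g g' i k _ _; rewrite subrr normr0 mulr_ge0 // fn_ge0.
Qed.

Lemma nice_mixG_r K : convex K -> vbounded K -> niceF beta0 (fun g M => mixG g K M).
Proof.
move=> cK bK.
have -> : (fun g M => mixG g K M) =
    (fun g M => \sum_r beta r * Psi 1%:M (r.+1%:R *: g) M K).
  by apply/funext => g; apply/funext => M; apply: eq_bigr => N _; rewrite PsiC.
apply: nice_sum => N.
apply: (@nice_Psi _ _ _ beta0P n (fun=> 1%:M) (fun g => N.+1%:R *: g) n.+1%:R).
- exact: leqnn.
- exact: ler0n.
- exact: cK.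
- exact: bK.
- by move=> g i k _; exact: one_entry.
- by move=> g i k; exact: nat_entry.
- by move=> g g' i k _ _; rewrite subrr normr0 mulr_ge0 // fn_ge0.
- by move=> g g' i k _ _; exact: nat_lip.
Qed.

Lemma nice_proj d (X : 'M[R]_n -> 'M[R]_(d, n)) : (d <= n)%N ->
  (forall g i k, orth g -> `|X g i k| <= 1) ->
  (forall g g' i k, orth g -> orth g' -> `|X g i k - X g' i k| <= fn (g - g')) ->
  niceF beta0 (fun g K => Psi (X g) 0 K [set 0]).
Proof.
move=> dn X1 Xl; apply: (@nice_Psi _ _ _ beta0P d X (fun=> 0) 1) => //.
- exact: convex_set0.
- exact: vbounded_set0.
- by move=> g i k _; rewrite mxE normr0.
- by move=> g g' i k og og'; rewrite mul1r; exact: Xl.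
- by move=> g g' i k _ _; rewrite subrr normr0 mul1r fn_ge0.
Qed.

Lemma nice_projU : niceF beta0 (fun g K => projU g K).
Proof.
apply: nice_proj; first exact: leq_addr.
  by move=> g i k og; rewrite mxE; exact: orth_entry.
move=> g g' i k _ _; rewrite !mxE.
by have := fn_entry (g - g') (lshift l i) k; rewrite !mxE.
Qed.

Lemma nice_projDT : niceF beta0 (fun g K => projD g^T K).
Proof.
apply: (@nice_proj l (fun g => dsubmx g^T)); first exact: leq_addl.
  by move=> g i k og; rewrite !mxE; exact: orth_entry.
move=> g g' i k _ _; rewrite !mxE.
by have := fn_entry (g - g') k (rshift j i); rewrite !mxE.
Qed.

Lemma nice_defect_l M : convex M -> vbounded M -> niceF beta0 (fun _ K => defect K M).
Proof.
move=> cM bM; apply: nice_lin; first by apply: nice_haar => //; exact: nice_mixG_l.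
apply: (@nice_sum _ _ _ r _ (fun k _ K => haar (fun g => q k g * projU g K))) => k.
by apply: nice_haar => //; exact: nice_projU.
Qed.

Lemma nice_defect_r K : convex K -> vbounded K -> niceF beta0 (fun _ M => defect K M).
Proof.
move=> cK bK.
have -> : (fun (_ : 'M[R]_n) M => defect K M) =
  (fun _ M => (kap j * kap l) * haar (fun g => p g * mixG g K M) +
  \sum_(k < r) (- kap n * haar (fun g => q k g * projU g K)) * haar (fun g => q' k g * projD g^T M)).
  by apply/funext => _; apply/funext => M; congr (_ + _); apply: eq_bigr => k _; ring.
apply: nice_lin; first by apply: nice_haar => //; exact: nice_mixG_r.
apply: (@nice_sum _ _ _ r _ (fun k _ M => haar (fun g => q' k g * projD g^T M))) => k.
by apply: nice_haar => //; exact: nice_projDT.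
Qed.

Lemma hom_defect_l M : convex M -> vbounded M -> hom2 j (fun K => defect K M).
Proof.
move=> cM bM s; rewrite /defect.
have [lG _ _ _] := nice_mixG_l cM bM; have [lU _ _ _] := nice_projU.
have cz t := @convex_zl R n t; have bz t := @vbounded_zl R n t.
have -> := @haar_weight_scale _ _ p _ _ (2 ^+ j) lp (lG _ (cz (map ( *:%R 2) s)) (bz _))
  (lG _ (cz s) (bz s)) (fun g _ => mixG_hom_l g s cM bM).
rewrite [RHS]mulrDr mulr_sumr; congr (_ + _); first by rewrite [RHS]mulrCA.
apply: eq_bigr => k _; rewrite [RHS]mulrCA; congr (_ * _).
apply: (haar_weight_scale (lq k)); [exact: lU | exact: lU |].
by move=> g _; exact: proj_hom.
Qed.

Lemma hom_defect_r s : hom2 l (fun M => defect (zl s) M).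
Proof.
move=> t; rewrite /defect.
have cz u := @convex_zl R n u; have bz u := @vbounded_zl R n u.
have [lG _ _ _] := nice_mixG_r (cz s) (bz s); have [lD _ _ _] := nice_projDT.
have -> := @haar_weight_scale _ _ p _ _ (2 ^+ l) lp (lG _ (cz (map ( *:%R 2) t)) (bz _))
  (lG _ (cz t) (bz t)) (fun g _ => mixG_hom_r g s t).
rewrite [RHS]mulrDr mulr_sumr; congr (_ + _); first by rewrite [RHS]mulrCA.
apply: eq_bigr => k _; rewrite [RHS]mulrA; congr (_ * _); rewrite [RHS]mulrCA; congr (_ * _).
apply: (haar_weight_scale (lq' k)); [exact: lD | exact: lD |].
by move=> g _; exact: proj_hom.
Qed.

Hypothesis kernel : forall x y, orth x -> orth y ->
    haar (fun g => p g * minor (y *m g *m x)) =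
    \sum_(k < r) haar (fun g => q k g * minor (g *m x)) * haar (fun g => q' k g * minor (y *m g)).

(** QR writes the segments as [o1 (a, 0)] and [o2 (0, b)]; the three volumes are then multiples of
    [minor] at [o2^T g o1], [g o1] and [o2^T g], and [kernel] applies. *)
Lemma defect_base s t : size s = j -> size t = l -> defect (zl s) (zl t) = 0.
Proof.
move=> /ex_cl[A ->] /ex_cl[B ->].
have [o1 [a [oo1 ->]]] := ex_qr_top A; have [o2 [b [oo2 ->]]] := ex_qr_bot B.
have lm := lipschitz_minor R j l.
have lmx x y : orth x -> orth y -> lipschitz (fun g => minor (y *m g *m x)).
  by move=> ox oy; apply: (lipschitzMl oy (lipschitzMr ox lm)).
have lmr x : orth x -> lipschitz (fun g => minor (g *m x)) by move=> ox; exact: lipschitzMr.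
have lml y : orth y -> lipschitz (fun g => minor (y *m g)) by move=> oy; exact: lipschitzMl.
have cz u := @convex_zl R n u; have bz u := @vbounded_zl R n u.
have EG g : orth g -> mixG g (zl (cl (o1 *m col_mx a 0))) (zl (cl (o2 *m col_mx 0 b))) =
    (`|\det a| * `|\det b| * kap n) * minor (o2^T *m g *m o1).
  move=> og; rewrite mixG_det; pose h := o2^T *m g *m o1.
  have -> : row_mx (g *m (o1 *m col_mx a 0)) (o2 *m col_mx 0 b) =
      o2 *m block_mx (ulsubmx h *m a) 0 (dlsubmx h *m a) b.
    have -> : block_mx (ulsubmx h *m a) 0 (dlsubmx h *m a) b =
       row_mx (h *m col_mx a 0) (col_mx 0 b).
      by rewrite -{3}[h]submxK mul_block_col !mulmx0 !addr0 block_mxEh.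
    by rewrite mul_mx_row /h !mulmxA oo2 mul1mx.
  rewrite det_mulmx normrM (det_orth oo2) mul1r det_lblock det_mulmx !normrM /minor -/h.
  by move: `|\det (ulsubmx h)| `|\det a| `|\det b| (kap n) => *; ring.
have EU g : orth g -> projU g (zl (cl (o1 *m col_mx a 0))) = (`|\det a| * kap j) * minor (g *m o1).
  move=> og; rewrite /projU proj_det mulmxA mul_usub_mx -[g *m o1]submxK block_mxEv col_mxKu.
  rewrite mul_row_col mulmx0 addr0 det_mulmx normrM /minor.
  rewrite -block_mxEv block_mxKul.
  by move: `|_| `|_| (kap j) => *; ring.
have ED g : orth g -> projD g^T (zl (cl (o2 *m col_mx 0 b))) = (`|\det b| * kap l) * minor (o2^T *m g).
  move=> og; rewrite /projD proj_det mulmxA mul_dsub_mx.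
  have -> : o2^T *m g = (g^T *m o2)^T by rewrite trmx_mul trmxK.
  rewrite minorT minor_dr; last by apply: orthM => //; exact: orthT.
  rewrite -[g^T *m o2]submxK block_mxEv col_mxKd.
  rewrite mul_row_col mulmx0 add0r det_mulmx normrM.
  rewrite -block_mxEv block_mxKdr.
  by move: `|_| `|_| (kap l) => *; ring.
have [lG _ _ _] := nice_mixG_l (cz (cl (o2 *m col_mx 0 b))) (bz (cl (o2 *m col_mx 0 b))).
have [lU _ _ _] := nice_projU; have [lD _ _ _] := nice_projDT.
rewrite /defect.
have ot2 := orthT oo2.
have -> := @haar_weight_scale _ _ p _ _ (`|\det a| * `|\det b| * kap n) lp
  (lG _ (cz (cl (o1 *m col_mx a 0))) (bz _)) (lmx _ _ oo1 ot2) EG.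
rewrite kernel // mulrA mulr_sumr -big_split big1 //= => k _.
have -> := @haar_weight_scale _ _ (q k) _ _ (`|\det a| * kap j) (lq k)
  (lU _ (cz (cl (o1 *m col_mx a 0))) (bz _)) (lmr _ oo1) EU.
have -> := @haar_weight_scale _ _ (q' k) _ _ (`|\det b| * kap l) (lq' k)
  (lD _ (cz (cl (o2 *m col_mx 0 b))) (bz _)) (lml _ ot2) ED.
move: `|\det a| `|\det b| (kap n) (kap j) (kap l) (haar _) (haar _) => *; ring.
Qed.

(** One variable at a time: [zl_vanish_above] frees the number of segments in [M], then in [K];
    [symm_vanish] replaces the zonotope [K], then [M], by a symmetric body. *)
Lemma defect_eq0 K M : convex K -> vbounded K -> K !=set0 -> symm K ->
  convex M -> vbounded M -> M !=set0 -> symm M -> defect K M = 0.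
Proof.
move=> cK bK nK sK cM bM nM sM.
have cz u := @convex_zl R n u; have bz u := @vbounded_zl R n u.
have z1 s : size s = j -> forall t, defect (zl s) (zl t) = 0.
  move=> sj; apply: (@zl_vanish_above _ _ (fun M => defect (zl s) M) l).
  - by apply: (nice_seg2 (beta0 := beta0)); exact: nice_defect_r.
  - exact: hom_defect_r.
  - by move=> t tl; exact: defect_base.
have z2 s t : defect (zl s) (zl t) = 0.
  apply: (@zl_vanish_above _ _ (fun K => defect K (zl t)) j).
  - by apply: (nice_seg2 (beta0 := beta0)); exact: nice_defect_l.
  - exact: hom_defect_l.
  - by move=> u uj; exact: z1.
have z3 t : defect K (zl t) = 0.
  apply: (@symm_vanish _ _ _ i0 i1 h0 h1 (fun K => defect K (zl t))) => //.
  - by apply: (nice_hlip (beta0 := beta0)); exact: nice_defect_l.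
  - by apply: (nice_zextrap (beta0 := beta0)); exact: nice_defect_l.
apply: (@symm_vanish _ _ _ i0 i1 h0 h1 (fun M => defect K M)) => //.
- by apply: (nice_hlip (beta0 := beta0)); exact: nice_defect_r.
- by apply: (nice_zextrap (beta0 := beta0)); exact: nice_defect_r.
Qed.

End Crofton.

Definition sbody (R : realType) n (K : set 'cV[R]_n) :=
  [/\ convex K, vbounded K, K !=set0 & symm K].

(** * Exchange of the two pairs of bodies and localisation at the identity *)

Section Duality.
Variables (R : realType) (j l : nat).
Notation n := (j + l)%N.
Variables (i0 i1 : 'I_n).
Hypotheses (h0 : nat_of_ord i0 = 0%N) (h1 : nat_of_ord i1 = 1%N).
Variable beta : 'I_n.+1 -> R.
Hypothesis betaP : forall P : {poly R}, (size P <= n.+1)%N -> P`_j = \sum_r beta r * P.[r.+1%:R].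
Variables K1 K2 L1 L2 : set 'cV[R]_n.
Hypotheses (bK1 : sbody K1) (bK2 : sbody K2) (bL1 : sbody L1) (bL2 : sbody L2).
Hypothesis proj1 : forall g, orth g -> projU g K1 = projD g L1.
Hypothesis proj2 : forall g, orth g -> projD g K2 = projU g L2.

Let diff (g : 'M[R]_n) := mixG beta g K1 K2 - mixG beta g L2 L1.

(* The second application uses the transposed kernel, which swaps the roles of
   the two projections. *)
Lemma haar_bump_mixG N (beta0 : 'I_n.+1 -> R) :
  (forall P : {poly R}, (size P <= n.+1)%N -> P`_0 = \sum_r beta0 r * P.[r.+1%:R]) ->
  haar (fun g => bump N g * mixG beta g K1 K2) = haar (fun g => bump N g * mixG beta g L2 L1).
Proof.
move=> beta0P.
have [cK1 vK1 nK1 sK1] := bK1; have [cK2 vK2 nK2 sK2] := bK2.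
have [cL1 vL1 nL1 sL1] := bL1; have [cL2 vL2 nL2 sL2] := bL2.
have lm := lipschitz_minor R j l; have lb := lipschitz_bump R j l N.
have [r [q [q' [lq lq' ker]]]] := kernel_factor N lm.
have lmr (x : 'M[R]_n) : orth x -> lipschitz (fun g => minor (g *m x)) by move=> ox; exact: lipschitzMr.
have lml (y : 'M[R]_n) : orth y -> lipschitz (fun g => minor (y *m g)) by move=> oy; exact: lipschitzMl.
have kerT (x y : 'M[R]_n) : orth x -> orth y ->
    haar (fun g => bump N g^T * minor (y *m g *m x)) =
    \sum_(k < r) haar (fun g => q' k g^T * minor (g *m x)) * haar (fun g => q k g^T * minor (y *m g)).
  move=> ox oy; have ox' := orthT ox; have oy' := orthT oy.
  have lx : lipschitz (fun g => bump N g * minor (x^T *m g *m y^T)).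
    by apply: lipschitzM => //; apply: (lipschitzMl ox' (lmr _ oy')).
  rewrite -[LHS](_ : haar (fun g => bump N g^T * minor (x^T *m g^T *m y^T)) = _); last first.
    congr haar; apply/funext => g; congr (_ * _); by rewrite -[LHS]minorT !trmx_mul !trmxK mulmxA.
  rewrite (haar_T lx) ker //; apply: eq_bigr => k _; rewrite mulrC; congr (_ * _).
    have lk : lipschitz (fun g => q' k g * minor (x^T *m g)) by apply: lipschitzM => //; exact: lml.
    rewrite -(haar_T lk); congr haar; apply/funext => g.
    by rewrite -[in RHS]minorT trmx_mul.
  have lk : lipschitz (fun g => q k g * minor (g *m y^T)) by apply: lipschitzM => //; exact: lmr.
  rewrite -(haar_T lk); congr haar; apply/funext => g.
  by rewrite -[in RHS]minorT trmx_mul.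
have d1 := defect_eq0 h0 h1 betaP beta0P lb lq lq' ker cK1 vK1 nK1 sK1 cK2 vK2 nK2 sK2.
have d2 := defect_eq0 h0 h1 betaP beta0P (lipschitzT lb) (fun k => lipschitzT (lq' k))
  (fun k => lipschitzT (lq k)) kerT cL2 vL2 nL2 sL2 cL1 vL1 nL1 sL1.
have [lU _ _ _] := nice_projU beta0P; have [lD _ _ _] := nice_projDT beta0P.
pose S := \sum_(k < r) haar (fun g => q' k g * projD g^T K2) * haar (fun g => q k g * projU g K1).
pose kn := Vol (cube 1 : set 'cV[R]_n).
pose kjl := Vol (cube 1 : set 'cV[R]_j) * Vol (cube 1 : set 'cV[R]_l).
have e1 : kjl * haar (fun g => bump N g * mixG beta g K1 K2) = kn * S.
  apply/eqP; rewrite -subr_eq0 -[X in _ == X]d1 /defect -/kn -/kjl; apply/eqP; congr (_ + _).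
  by rewrite /S mulr_sumr -sumrN; apply: eq_bigr => k _; rewrite mulrA !mulNr.
have e2 : kjl * haar (fun g => bump N g * mixG beta g L2 L1) = kn * S.
  apply/eqP; rewrite -subr_eq0 -[X in _ == X]d2 /defect -/kn -/kjl; apply/eqP; congr (_ + _).
    by congr (_ * haar _); apply/funext => g; rewrite bumpT.
  rewrite /S mulr_sumr -sumrN; apply: eq_bigr => k _.
  (* Invariance of the mean under transposition and the hypothesis on [K1] and [L1] turn this factor
     into the one of the first formula. *)
  have -> : haar (fun g => q k g^T * projD g^T L1) = haar (fun g => q k g * projU g K1).
    have lk : lipschitz (fun g => q k g * projU g K1) by apply: lipschitzM => //; exact: lU.
    rewrite -(haar_T lk); apply: haar_eq; last by move=> g og; rewrite proj1 //; exact: orthT.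
      by apply: lipschitzM; [exact: (lipschitzT (lq k)) | exact: lD].
    exact: (lipschitzT lk).
  have -> : haar (fun g => q' k g^T * projU g L2) = haar (fun g => q' k g * projD g^T K2).
    have lk : lipschitz (fun g => q' k g * projD g^T K2) by apply: lipschitzM => //; exact: lD.
    rewrite -(haar_T lk); apply: haar_eq; last by move=> g og; rewrite trmxK proj2.
      by apply: lipschitzM; [exact: (lipschitzT (lq' k)) | exact: lU].
    exact: (lipschitzT lk).
  by move: (haar _) (haar _) => *; ring.
have k0 : kjl != 0.
  by rewrite /kjl mulf_neq0 // gt_eqF // (lt_le_trans ltr01) // Vol_cube1_ge1.
exact: (mulfI k0) (etrans e1 (esym e2)).
Qed.

(** All averages of [diff] against [bump N] vanish, and these kernels concentrate at the identity
    faster than the Lipschitz function [diff] can vary. *)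
Lemma mixG_duality : mixG beta 1%:M K1 K2 = mixG beta 1%:M L2 L1.
Proof.
have [beta0 beta0P] := @coef_from_values R n 0 (leq0n _).
have [cK1 vK1 nK1 sK1] := bK1; have [cK2 vK2 nK2 sK2] := bK2.
have [cL1 vL1 nL1 sL1] := bL1; have [cL2 vL2 nL2 sL2] := bL2.
have [lG1 _ _ _] := nice_mixG_l beta beta0P cK2 vK2.
have [lG2 _ _ _] := nice_mixG_l beta beta0P cL1 vL1.
have l1 := lG1 _ cK1 vK1; have l2 := lG2 _ cL2 vL2.
have [L L0 dL] : lipschitz diff by exact: lipschitzB.
have n0 : (0 < n)%N by apply: leq_trans (ltn_ord i0).
apply/eqP; rewrite -subr_eq0 -normr_eq0 eq_le normr_ge0 andbT; apply/ler_addgt0Pr => e e0.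
rewrite add0r -/(diff 1%:M); have [N [H0 HN]] := @bump_peak R j l L e n0 L0 e0.
have lb := lipschitz_bump R j l N.
have := HN diff dL.
have -> : haar (fun g => bump N g * diff g) = 0.
  have E := haar_bump_mixG N beta0P.
  rewrite -[RHS](subrr (haar (fun g => bump N g * mixG beta g K1 K2))) [in X in _ - X]E.
  rewrite -haarB; [|exact: lipschitzM|exact: lipschitzM].
  by congr haar; apply/funext => g; rewrite /diff mulrBr.
by rewrite sub0r normrN normrM (gtr0_norm H0) ler_pM2r.
Qed.

End Duality.

(** * Jordan content and the theorem *)

Notation cvec d := 'cV[R]_d.

Lemma IZR_int z : IZR z = (int_of_Z z)%:~R.
Proof.
have pE p : IZR (Z.pos p) = (Pos.to_nat p)%:R by rewrite IZRposE INRE Pos_to_natE.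
case: z => [|p|p] //.
rewrite -[Z.neg p]/(- Z.pos p)%Z opp_IZR pE RoppE.
by rewrite /= NegzE prednK ?mulrNz //; apply/ssrnat.ltP; exact: Pos2Nat.is_pos.
Qed.

Lemma InP (T : eqType) (x : T) s : List.In x s <-> x \in s.
Proof.
elim: s => [|y s IH] //=; rewrite inE IH; split; last by case/orP => [/eqP ->|]; [left|right].
by case=> [->|->]; rewrite ?eqxx ?orbT.
Qed.

Lemma NoDup_uniq (T : eqType) (s : seq T) : NoDup s -> uniq s.
Proof.
elim: s => [|y s IH] //= nd; inversion nd; subst; rewrite IH // andbT.
by apply/negP => /InP.
Qed.

Lemma ncard_seq (T : choiceType) (s : seq T) : uniq s -> ncard [set x | x \in s] = size s.
Proof.
move=> us; have fs : finite_set [set x | x \in s] by exact: finite_seq.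
apply/perm_size; apply: uniq_perm => // x.
by rewrite (in_fset_set fs); apply/idP/idP; rewrite inE.
Qed.

Section Vectors.
Variable d : nat.

Definition c2v (c : cvec d) : vec := fun k => if insub k is Some i then c i 0 else 0.

Definition v2c (x : vec) : cvec d := \col_i x i.

Lemma c2vE c (i : 'I_d) : c2v c i = c i 0.
Proof. by rewrite /c2v valK. Qed.

Lemma c2v_out c k : (d <= k)%N -> c2v c k = 0.
Proof. by move=> dk; rewrite /c2v insubF // ltnNge dk. Qed.

Lemma supp_c2v c : supp d (c2v c).
Proof. by move=> k /ssrnat.leP; exact: c2v_out. Qed.

Lemma v2cK x : supp d x -> c2v (v2c x) = x.
Proof.
move=> sx; apply/funext => k; have [dk|kd] := leqP d k.
  by rewrite c2v_out // sx //; exact/ssrnat.leP.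
by rewrite (c2vE _ (Ordinal kd)) mxE.
Qed.

Definition bset (A : vec -> Prop) : set (cvec d) := [set c | A (c2v c)].

Definition zfun (z : list Z) : {ffun 'I_d -> int} := [ffun i : 'I_d => int_of_Z (List.nth i z Z0)].

(** The grid of index [m] has mesh [1/(m+1)]; along [m + 1 = 2^k] it is the dyadic lattice of
    [Vol]. *)
Lemma grid_c2v (z : list Z) m k : List.length z = d -> m.+1 = (2 ^ k)%N ->
  grid_pt m z = c2v (lat R k (zfun z)).
Proof.
move=> zd mk; apply/funext => i; rewrite /grid_pt RdivE INRE IZR_int mk natrX.
have [di|id] := leqP d i.
  by rewrite c2v_out // List.nth_overflow ?mul0r // zd; exact/ssrnat.leP.
by rewrite (c2vE _ (Ordinal id)) mxE ffunE.
Qed.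

Lemma grid_count_cnt (A : vec -> Prop) m k N : grid_count d m A N -> m.+1 = (2 ^ k)%N ->
  cnt k (bset A) = N.
Proof.
move=> [s [nd [<- H]]] mk.
have us : uniq (map zfun s).
  rewrite map_inj_in_uniq ?NoDup_uniq // => z z' /InP/H[lz _] /InP/H[lz' _] E.
  apply: (List.nth_ext z z' Z0 Z0); first by rewrite lz lz'.
  move=> i; rewrite lz => /ssrnat.ltP id.
  have := congr1 (fun f : {ffun 'I_d -> int} => f (Ordinal id)) E; rewrite !ffunE /=.
  exact: (can_inj int_of_ZK).
rewrite /cnt; have -> : [set z | bset A (lat R k z)] = [set z | z \in map zfun s].
  apply/seteqP; split=> z /=.
    move=> Az; pose t := map (fun i => Z_of_int (z i)) (enum 'I_d).
    have td : List.length t = d by rewrite -[List.length t]/(size t) size_map size_enum_ord.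
    have tz : zfun t = z.
      apply/ffunP => i; rewrite ffunE.
      have -> : List.nth i t Z0 = nth Z0 t i by elim: (t) (nat_of_ord i) => [|? ? IH] [|?] //=.
      by rewrite (nth_map i) ?size_enum_ord // nth_ord_enum Z_of_intK.
    by apply/mapP; exists t => //; apply/InP/H; split=> //; rewrite (grid_c2v td mk) tz.
  move=> /mapP[t /InP/H[td At] ->]; by rewrite /bset /= -(grid_c2v td mk).
by rewrite ncard_seq // size_map.
Qed.

Lemma is_vol_Vol (A : vec -> Prop) v x (r : R) : convex (bset A) -> vbounded (bset A) -> 0 < r ->
  shift x (cube r) `<=` bset A -> is_vol d A v -> v = Vol (bset A).
Proof.
move=> cA bA r0 xA [N [HN cv]]; apply: (Vol_of_counts cA bA r0 xA) => del del0.
have [k0 Hk] := cv del (elimT RltP del0); exists k0 => k kk0.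
pose m := (2 ^ k).-1; have mk : m.+1 = (2 ^ k)%N by rewrite prednK // expn_gt0.
have mk0 : (m >= k0)%coq_nat.
  by apply/ssrnat.leP; rewrite -ltnS mk; apply: leq_ltn_trans kk0 _; exact: ltn_expl.
have := Hk m mk0; rewrite RdistE RdivE RpowE !INRE mk => /RltP /ltW.
by rewrite (grid_count_cnt (HN m) mk) natrX -exprM.
Qed.

End Vectors.

Arguments v2c : clear implicits.
Arguments bset : clear implicits.

Lemma rsumE m (f : nat -> R) : rsum m f = \sum_(k < m) f k.
Proof. by elim: m => [|m IH] /=; rewrite ?big_ord0 // big_ord_recr /= IH. Qed.

Definition interior_pt d (A : set (cvec d)) :=
  exists x, exists2 r : R, 0 < r & shift x (cube r) `<=` A.

Section Bodies.
Variable n : nat.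
Implicit Types K L : vec -> Prop.

Lemma c2v_comb (s t : R) (x y : cvec n) : c2v (s *: x + t *: y) = (fun k => s * c2v x k + t * c2v y k).
Proof.
apply/funext => k; have [nk|kn] := leqP n k; first by rewrite !c2v_out // !mulr0 addr0.
by rewrite !(c2vE _ (Ordinal kn)) !mxE.
Qed.

Lemma c2v_opp (x : cvec n) : c2v (- x) = (fun k => - c2v x k).
Proof.
apply/funext => k; have [nk|kn] := leqP n k; first by rewrite !c2v_out // oppr0.
by rewrite !(c2vE _ (Ordinal kn)) !mxE.
Qed.

Lemma bset_sbody K : convex_body n K -> origin_symmetric K -> sbody (bset n K) /\ interior_pt (bset n K).
Proof.
move=> [sK cK [M KM] _ [x [r [r0 xK]]]] oK.
have {}r0 : 0 < r by exact/RltP.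
have int : interior_pt (bset n K).
  exists (v2c n x), (r / 2); first by rewrite divr_gt0.
  move=> _ [y yr <-]; apply: xK; first exact: supp_c2v.
  move=> k /ssrnat.ltP kn; rewrite (c2vE _ (Ordinal kn)) !mxE /= RabsE RminusE addrK.
  apply/RltP; apply: le_lt_trans (yr _) _; lra.
split=> //; split.
- move=> u v t Ku Kv t0 t1; rewrite /bset /= c2v_comb; apply: cK => //.
  by split; exact/RleP.
- by exists M => c Kc i; rewrite -c2vE -RabsE; apply/RleP; exact: KM.
- have [c [r' r'0 cK']] := int; exists (0 + c); apply: cK'; exists 0 => // i.
  by rewrite mxE normr0 ltW.
- by move=> u Ku; rewrite /bset /= c2v_opp; exact: oK.
Qed.

Lemma bset_mink (lam mu : R) K L : (forall x, K x -> supp n x) -> (forall x, L x -> supp n x) ->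
  bset n (mink_comb lam mu K L) = msum (mscale lam (bset n K)) (mscale mu (bset n L)).
Proof.
move=> sK sL; apply/seteqP; split=> [c [x [y [Kx [Ly E]]]]|_ [_ [_ [[x Kx <-] [y Ly <-] ->]]]].
  exists (lam *: v2c n x), (mu *: v2c n y); split.
  - by exists (v2c n x); rewrite // /bset /= v2cK //; exact: sK.
  - by exists (v2c n y); rewrite // /bset /= v2cK //; exact: sL.
  by apply/colP => i; rewrite -(c2vE c i) E !mxE.
exists (c2v x), (c2v y); split=> //; split=> // k.
by rewrite c2v_comb.
Qed.

Lemma bset_proj K u a d : (forall x, K x -> supp n x) ->
  bset d (proj_coords n K u a d) = mimg (\matrix_(i, k) u (a + i)%coq_nat k) (bset n K).
Proof.
move=> sK; have dotE (x : cvec n) (i : 'I_d) :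
    ((\matrix_(i < d, k < n) u (a + i)%coq_nat k) *m x) i 0 = dot n (c2v x) (u (a + i)%coq_nat).
  by rewrite mxE /dot rsumE; apply: eq_bigr => k _; rewrite mxE mulrC c2vE.
apply/seteqP; split=> [c [_ [x [Kx E]]]|_ [x Kx <-]].
  exists (v2c n x); first by rewrite /bset /= v2cK //; exact: sK.
  apply/colP => i; rewrite dotE v2cK; last exact: sK.
  by rewrite -c2vE E //; exact/ssrnat.ltP.
split; first exact: supp_c2v.
by exists (c2v x); split=> // k /ssrnat.ltP kd; rewrite (c2vE _ (Ordinal kd)) dotE.
Qed.

(** [X^T] is a right inverse of [X] with entries at most 1, so it enlarges sup norms at most [d]
    times; the [+ 1] also covers [d = 0]. *)
Lemma interior_mimg d (X : 'M[R]_(d, n)) (K : set (cvec n)) : X *m X^T = 1%:M ->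
  (forall i k, `|X i k| <= 1) -> interior_pt K -> interior_pt (mimg X K).
Proof.
move=> XX X1 [x [r r0 xK]]; have d0 : 0 < d%:R + 1 :> R by rewrite ltr_wpDl.
exists (X *m x), (r / (d%:R + 1)); first exact: divr_gt0.
move=> _ [w wr <-]; exists (X^T *m w + x); last by rewrite mulmxDr mulmxA XX mul1mx.
apply: xK; exists (X^T *m w) => // i; rewrite mxE; apply: le_trans (ler_norm_sum _ _ _) _.
apply: le_trans (_ : \sum_(k < d) r / (d%:R + 1) <= _).
  apply: ler_sum => k _; rewrite normrM mxE -[leRHS]mul1r; exact: ler_pM.
rewrite sumr_const card_ord -[leLHS]mulr_natl mulrA ler_pdivrMr // mulrC ler_wpM2l ?(ltW r0) //.
by rewrite lerDl.
Qed.

Lemma interior_msum (lam mu : R) (A B : set (cvec n)) : 0 < lam -> interior_pt A -> B !=set0 ->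
  interior_pt (msum (mscale lam A) (mscale mu B)).
Proof.
move=> l0 [x [r r0 xA]] [y By]; exists (lam *: x + mu *: y), (lam * r); first exact: mulr_gt0.
move=> _ [w wr <-]; exists (w + lam *: x), (mu *: y); split; last by rewrite addrA.
  exists (lam^-1 *: w + x); last by rewrite scalerDr scalerA mulfV ?scale1r // gt_eqF.
  apply: xA; exists (lam^-1 *: w) => // i; rewrite mxE normrM ger0_norm ?invr_ge0 ?(ltW l0) //.
  by rewrite ler_pdivrMl.
by exists y.
Qed.

Lemma vol_proj K (u : nat -> vec) a d v (X : 'M[R]_(d, n)) : convex_body n K -> origin_symmetric K ->
  X = \matrix_(i, k) u (a + i)%coq_nat k -> X *m X^T = 1%:M ->
  (forall i k, `|X i k| <= 1) -> is_vol d (proj_coords n K u a d) v -> v = Vol (mimg X (bset n K)).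
Proof.
move=> bK oK XE XX X1 vK; have [[cK vbK _ _] iK] := bset_sbody bK oK.
have [x [r r0 xA]] := interior_mimg XX X1 iK.
have E := bset_proj u a d (cb_supp _ _ bK); rewrite -XE in E.
rewrite -E; apply: (is_vol_Vol _ _ r0 _ vK); rewrite E.
- exact: convex_mimg.
- exact: vbounded_mimg.
- exact: xA.
Qed.

Lemma vol_mink (lam mu : R) K L v : convex_body n K -> origin_symmetric K ->
  convex_body n L -> origin_symmetric L -> 0 < lam -> is_vol n (mink_comb lam mu K L) v ->
  v = Vol (msum (mscale lam (bset n K)) (mscale mu (bset n L))).
Proof.
move=> bK oK bL oL l0 vKL; have [[cK vbK _ _] iK] := bset_sbody bK oK.
have [[cL vbL nL _] _] := bset_sbody bL oL.
have [x [r r0 xA]] := interior_msum mu l0 iK nL.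
have E := bset_mink lam mu (cb_supp _ _ bK) (cb_supp _ _ bL).
rewrite -E; apply: (is_vol_Vol _ _ r0 _ vKL); rewrite E.
- by apply: convex_msum; exact: convex_mscale.
- by apply: vbounded_msum; exact: vbounded_scale.
- exact: xA.
Qed.

Definition rowv (g : 'M[R]_n) (k : nat) : vec :=
  if insub k is Some i then c2v (row i g)^T else fun=> 0.

Lemma rowvE g (i k : 'I_n) : rowv g i k = g i k.
Proof. by rewrite /rowv valK c2vE !mxE. Qed.

Lemma rowv_basis g (s : nat -> nat) : orth g ->
  (forall i, (i < n)%N -> (s i < n)%N) ->
  (forall i k, (i < n)%N -> (k < n)%N -> s i = s k -> i = k) ->
  orthonormal_basis n (fun i => rowv g (s i)).
Proof.
move=> og sn si; split.
  by move=> i _; rewrite /rowv; case: insubP => [k _ _|_]; [exact: supp_c2v | move=> ? _].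
move=> i k /ssrnat.ltP iN /ssrnat.ltP kN; rewrite /dot rsumE.
pose i' := Ordinal (sn i iN); pose k' := Ordinal (sn k kN).
have -> : \sum_(c < n) rowv g (s i) c * rowv g (s k) c = (g *m g^T) i' k'.
  by rewrite mxE; apply: eq_bigr => c _; rewrite mxE -!rowvE.
rewrite og mxE; case: Nat.eqb_spec => [ik|ik].
  by have -> : i' = k' by [apply/val_inj; rewrite /= ik]; rewrite eqxx.
by case: eqP => // /(congr1 val) /= /(si _ _ iN kN).
Qed.

End Bodies.

Lemma mimg_scalar n (c : R) (K : set (cvec n)) : mimg (c *: 1%:M) K = mscale c K.
Proof. by congr image; apply/funext => x; rewrite -scalemxAl mul1mx. Qed.

Lemma binom_neq0 n k : C n k <> 0.
Proof.
rewrite /C RdivE; apply/eqP; rewrite mulf_neq0 // ?invr_neq0 //; last rewrite mulf_neq0 //.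
all: by apply/eqP; exact: INR_fact_neq_0.
Qed.

Lemma is_proj_body_vol n i k (K L : vec -> Prop) u : n = (k + i)%N -> is_proj_body n i K L ->
  orthonormal_basis n u -> exists v, is_vol i (proj_coords n K u k i) v /\
    is_vol k (proj_coords n L u 0 k) v.
Proof.
move=> nE pK ou; have ni : (n - i)%coq_nat = k by rewrite nE; exact: addnK.
by have [v] := pK u ou; rewrite ni; exists v.
Qed.

Lemma usubmx_orth j l (g : 'M[R]_(j + l)) : orth g -> usubmx g *m (usubmx g)^T = 1%:M.
Proof.
move=> og; have := congr1 (@ulsubmx _ j l j l) og.
by rewrite -{1 2}[g]vsubmxK tr_col_mx mul_col_row block_mxKul => ->; rewrite scalar_mx_block block_mxKul.
Qed.

Lemma dsubmx_orth j l (g : 'M[R]_(j + l)) : orth g -> dsubmx g *m (dsubmx g)^T = 1%:M.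
Proof.
move=> og; have := congr1 (@drsubmx _ j l j l) og.
by rewrite -{1 2}[g]vsubmxK tr_col_mx mul_col_row block_mxKdr => ->; rewrite scalar_mx_block block_mxKdr.
Qed.

Lemma Psi_mimg n d (X : 'M[R]_(d, n)) (K : set (cvec n)) : Psi X 0 K [set 0] = Vol (mimg X K).
Proof. by rewrite /Psi mimg_0 msum0. Qed.

(** Moves the last [l] rows to the front: [is_proj_body] projects [L1] to the first [l] basis
    vectors and [K1] to the last [j], whereas [projU] uses the first [j] rows of [g] and [projD] the
    last [l]. *)
Definition swapn j l i := if (i < l)%N then (j + i)%N else (i - l)%N.

Lemma swapn_lt j l i : (i < j + l)%N -> (swapn j l i < j + l)%N.
Proof. by rewrite /swapn => h; case: (ltnP i l); lia. Qed.

Lemma swapn_inj j l i k : (i < j + l)%N -> (k < j + l)%N -> swapn j l i = swapn j l k -> i = k.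
Proof. by rewrite /swapn => hi hk; case: (ltnP i l); case: (ltnP k l); lia. Qed.

Section Final.
Variables (j l : nat) (K1 K2 L1 L2 : vec -> Prop).
Notation n := (j + l)%N.
Hypotheses (bK1 : convex_body n K1) (bK2 : convex_body n K2).
Hypotheses (bL1 : convex_body n L1) (bL2 : convex_body n L2).
Hypotheses (oK1 : origin_symmetric K1) (oK2 : origin_symmetric K2).
Hypotheses (oL1 : origin_symmetric L1) (oL2 : origin_symmetric L2).

Lemma proj_body_UD : is_proj_body n j K1 L1 ->
  forall g, orth g -> projU g (bset n K1) = projD g (bset n L1).
Proof.
move=> pK g og; pose s := swapn j l.
have ou : orthonormal_basis n (fun i => rowv g (s i)).
  by apply: rowv_basis => //; [exact: swapn_lt | exact: swapn_inj].
have [v [v1 v2]] := is_proj_body_vol (addnC j l) pK ou.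
rewrite /projU /projD !Psi_mimg.
rewrite -(vol_proj (X := usubmx g) bK1 oK1 _ _ _ v1) ?usubmx_orth //.
- rewrite -(vol_proj (X := dsubmx g) bL1 oL1 _ _ _ v2) ?dsubmx_orth //.
    by apply/matrixP => i k; rewrite !mxE -rowvE /s /swapn -[(0 + i)%coq_nat]/(nat_of_ord i) ltn_ord.
  by move=> i k; rewrite mxE; exact: orth_entry.
- apply/matrixP => i k; rewrite !mxE -rowvE /s /swapn.
  have -> : (l + i)%coq_nat = (l + i)%N by [].
  by rewrite ltnNge leq_addr /= addKn.
by move=> i k; rewrite mxE; exact: orth_entry.
Qed.

Lemma proj_body_DU : is_proj_body n l K2 L2 ->
  forall g, orth g -> projD g (bset n K2) = projU g (bset n L2).
Proof.
move=> pK g og; have ou : orthonormal_basis n (fun i => rowv g i) by exact: (rowv_basis (s := id)).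
have [v [v1 v2]] := is_proj_body_vol erefl pK ou.
rewrite /projU /projD !Psi_mimg.
rewrite -(vol_proj (X := dsubmx g) bK2 oK2 _ _ _ v1) ?dsubmx_orth //.
- rewrite -(vol_proj (X := usubmx g) bL2 oL2 _ _ _ v2) ?usubmx_orth //.
    by apply/matrixP => i k; rewrite !mxE -rowvE.
  by move=> i k; rewrite mxE; exact: orth_entry.
- by apply/matrixP => i k; rewrite !mxE -rowvE.
by move=> i k; rewrite mxE; exact: orth_entry.
Qed.

Variable beta : 'I_n.+1 -> R.
Hypothesis betaP : forall P : {poly R}, (size P <= n.+1)%N -> P`_j = \sum_r beta r * P.[r.+1%:R].

Lemma mixG_coeff_l a : mixed_vol_coeffs n K1 K2 a ->
  mixG beta 1%:M (bset n K1) (bset n K2) = C n j * a j.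
Proof.
move=> H; pose P := \poly_(k < n.+1) (C n k * a k).
have -> : C n j * a j = P`_j by rewrite coef_poly ltnS leq_addr.
rewrite (betaP (size_poly _ _)); apply: eq_bigr => r _; congr (_ * _).
have r0 : 0 < r.+1%:R :> R by rewrite ltr0n.
have := H r.+1%:R 1 (elimT RltP r0) (elimT RltP ltr01).
move=> /(vol_mink bK1 oK1 bK2 oK2 r0) E.
rewrite /Psi mimg_scalar -[X in mimg X (bset n K2)]scale1r mimg_scalar -E rsumE horner_poly.
by apply: eq_bigr => k _; rewrite !RealsE expr1n mulr1.
Qed.

(** Here [L2] is dilated, while the expansion for [b] lists [L1] first. Hence [lam = 1], [mu = r],
    and the coefficient of [r^k] has index [n - k]. *)
Lemma mixG_coeff_r b : mixed_vol_coeffs n L1 L2 b ->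
  mixG beta 1%:M (bset n L2) (bset n L1) = C n l * b l.
Proof.
move=> H; pose P := \poly_(k < n.+1) (C n (n - k) * b (n - k)%N).
have -> : C n l * b l = P`_j by rewrite coef_poly ltnS leq_addr addKn.
rewrite (betaP (size_poly _ _)); apply: eq_bigr => r _; congr (_ * _).
have r0 : 0 < r.+1%:R :> R by rewrite ltr0n.
have := H 1 r.+1%:R (elimT RltP ltr01) (elimT RltP r0).
move=> /(vol_mink bL1 oL1 bL2 oL2 ltr01) E.
rewrite /Psi mimg_scalar -[X in mimg X (bset n L1)]scale1r mimg_scalar msumC -E rsumE horner_poly.
rewrite (reindex_inj rev_ord_inj); apply: eq_bigr => k _ /=.
have kn : (k <= n)%N by rewrite -ltnS.
rewrite !RealsE subSS expr1n mulr1; congr (_ * _ ^+ _).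
by have -> : (n - (n - k))%coq_nat = (n - (n - k))%N by []; rewrite subKn.
Qed.

Lemma projection_duality a b : (1 < n)%N -> is_proj_body n j K1 L1 -> is_proj_body n l K2 L2 ->
  mixed_vol_coeffs n K1 K2 a -> mixed_vol_coeffs n L1 L2 b -> a j = b l.
Proof.
move=> n1 p1 p2 Ha Hb.
have [sK1 _] := bset_sbody bK1 oK1; have [sK2 _] := bset_sbody bK2 oK2.
have [sL1 _] := bset_sbody bL1 oL1; have [sL2 _] := bset_sbody bL2 oL2.
have := @mixG_duality R j l (Ordinal (ltnW n1)) (Ordinal n1) erefl erefl beta betaP
  _ _ _ _ sK1 sK2 sL1 sL2 (proj_body_UD p1) (proj_body_DU p2).
rewrite (mixG_coeff_l Ha) (mixG_coeff_r Hb).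
(* The binomial factors on the two sides agree by symmetry and cancel. *)
have -> : C n l = C n j.
  rewrite (pascal_step1 n j); last by apply/ssrnat.leP; exact: leq_addr.
  by congr C; rewrite -[l in LHS](addKn j).
by apply: mulfI; apply/eqP; exact: binom_neq0.
Qed.

End Final.

Lemma projection_body_duality n j (K1 K2 L1 L2 : vec -> Prop) :
  (3 <= n)%coq_nat -> (1 <= j)%coq_nat -> (j <= (n - 1)%coq_nat)%coq_nat ->
  convex_body n K1 -> convex_body n K2 -> convex_body n L1 -> convex_body n L2 ->
  origin_symmetric K1 -> origin_symmetric K2 ->
  origin_symmetric L1 -> origin_symmetric L2 ->
  is_proj_body n j K1 L1 -> is_proj_body n (n - j)%coq_nat K2 L2 ->
  forall a b : nat -> R,
    mixed_vol_coeffs n K1 K2 a -> mixed_vol_coeffs n L1 L2 b ->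
    a j = b (n - j)%coq_nat.
Proof.
move=> n3 _ jn; pose l := (n - j)%coq_nat; rewrite -/l.
have [n1 nE] : (1 < n)%N /\ n = (j + l)%N by rewrite /l; lia.
clearbody l; move: n1 {n3 jn}; rewrite nE => n1 bK1 bK2 bL1 bL2 oK1 oK2 oL1 oL2 p1 p2 a b Ha Hb.
have [beta betaP] := @coef_from_values R (j + l) j (leq_addr _ _).
exact: (projection_duality bK1 bK2 bL1 bL2 oK1 oK2 oL1 oL2 betaP n1 p1 p2 Ha Hb).
Qed.

End ProjectionBodies.

Theorem theorem5p4 (n j : nat) (K1 K2 L1 L2 : vec -> Prop) :
  (3 <= n)%nat -> (1 <= j)%nat -> (j <= n - 1)%nat ->
  convex_body n K1 -> convex_body n K2 -> convex_body n L1 -> convex_body n L2 ->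
  origin_symmetric K1 -> origin_symmetric K2 ->
  origin_symmetric L1 -> origin_symmetric L2 ->
  is_proj_body n j K1 L1 -> is_proj_body n (n - j) K2 L2 ->
  forall a b : nat -> R,
    mixed_vol_coeffs n K1 K2 a -> mixed_vol_coeffs n L1 L2 b ->
    a j = b (n - j)%nat.
Proof.
exact (@ProjectionBodies.projection_body_duality n j K1 K2 L1 L2).
Qed.
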